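(* For every integer $g \geq 2$, the moduli space $M_g$ of closed Riemann surfaces of genus $g$ contains an origami curve whose Veech group is a non congruence group. That is, for every $g\ge 2$ there is an origami $O$ of genus $g$, with associated Teichmüller curve $C(O)\subset M_g$, such that the Veech group $\Gamma(O)\subseteq \mathrm{SL}_2(\mathbb{Z})$ is a non congruence group.
   Context: Fix the torus $E=\mathbb{C}/\Lambda_I$ with $\Lambda_I=\mathbb{Z}\oplus\mathbb{Z}i$ (the unit square with opposite edges glued by translations), and let $\infty\in E$ be the image of the vertices of the unit square. An origami $O$ of genus $g$ and degree $d$ is a (possibly ramified) covering $p:X\to E$ of degree $d$ from a closed, oriented, connected topological surface $X$ of genus $g$, ramified over at most the point $\infty$. Put $X^*=X-p^{-1}(\infty)$. Translation structures: for $A=\begin{pmatrix}a&b\\c&d\end{pmatrix}\in\mathrm{SL}_2(\mathbb{R})$ let $\Lambda_A$ be the lattice in $\mathbb{C}\cong\mathbb{R}^2$ spanned by $(a,c)^t$ and $(b,d)^t$, let $\eta_A$ be the translation structure on $E$ obtained by identifying $E$ with $\mathbb{C}/\Lambda_A$ (via the linear map $A$), and let $\mu_A=p^*\eta_A$ be the lifted translation structure on $X^*$. It is in particular a complex structure, which extends to $X$. Origami curve: the map $\mathrm{SL}_2(\mathbb{R})\to T_g$, $A\mapsto[(X,\mu_A),\mathrm{id}]$, into Teichmüller space factors through $\mathrm{SO}_2(\mathbb{R})\backslash\mathrm{SL}_2(\mathbb{R})\cong\mathbb{H}$, giving a Teichmüller embedding $\mathbb{H}\to T_g$. The image of its composition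 with the projection $T_g\to M_g$ is a complex algebraic curve $C(O)$ in $M_g$, called the Teichmüller curve (origami curve) of $O$. Veech group: an affine diffeomorphism of $(X^*,\mu_I)$ is a diffeomorphism of $X^*$ which in local charts of $\mu_I$ has the form $z\mapsto Az+z_0$ with $A\in\mathrm{GL}_2(\mathbb{R})$, $z_0\in\mathbb{R}^2$; the matrix $A$ does not depend on the charts. The Veech group $\Gamma(O)=\Gamma(X^*,\mu_I)$ is the group of all matrices $A$ arising from orientation preserving affine diffeomorphisms of $(X^*,\mu_I)$. It is a finite index subgroup of $\mathrm{SL}_2(\mathbb{Z})$. The Veech group of the origami curve $C(O)$ means $\Gamma(O)$. A congruence group is a subgroup of $\mathrm{SL}_2(\mathbb{Z})$ that contains $\Gamma(n)=\ker(\mathrm{SL}_2(\mathbb{Z})\to\mathrm{SL}_2(\mathbb{Z}/n\mathbb{Z}))$ for some $n\ge1$ (equivalently, is the full preimage of a subgroup of $\mathrm{SL}_2(\mathbb{Z}/n\mathbb{Z})$ for some $n$). A non congruence group is a subgroup of $\mathrm{SL}_2(\mathbb{Z})$ that is not a congruence group. *)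

(* Defs.v *)
From HB Require Import structures.
From mathcomp Require Import all_boot all_order all_algebra.
From mathcomp Require Import all_classical all_reals all_analysis.

Set Implicit Arguments.
Unset Strict Implicit.
Unset Printing Implicit Defensive.

Import Order.TTheory GRing.Theory Num.Theory.
Import numFieldNormedType.Exports.

Local Open Scope classical_set_scope.
Local Open Scope quotient_scope.
Local Open Scope ring_scope.

(* C is identified with R^2, realised as the column vectors 'cV[R]_2, so that
   real matrices act on it by left multiplication. *)

Section Surfaces.
Variable R : realType.

(* f restricts to a homeomorphism from A onto B; its values outside A are
   irrelevant. *)
Definition homeomorphism_between (X Y : topologicalType) (A : set X)
    (B : set Y) (f : X -> Y) : Prop :=
  exists g : Y -> X,
    [/\ set_fun A B f, set_fun B A g,
        (forall x, A x -> g (f x) = x) & (forall y, B y -> f (g y) = y)] /\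
    ({within A, continuous f} /\ {within B, continuous g}).

(* A chart is a pair (U, phi); phi is meaningful on U only. *)
Definition is_chart (X : topologicalType) (c : set X * (X -> 'cV[R]_2)) : Prop :=
  [/\ open c.1, open (c.2 @` c.1)
    & homeomorphism_between c.1 (c.2 @` c.1) c.2].

(* Second countability is automatic for a compact locally Euclidean space. *)
Definition closed_surface (X : topologicalType) : Prop :=
  [/\ hausdorff_space X, compact [set: X], connected [set: X]
    & forall x : X, exists2 c, is_chart c & c.1 x].

Definition closed_cube (n : nat) : set 'cV[R]_n :=
  [set t | forall i, 0 <= t i 0 <= 1].
Definition open_cube (n : nat) : set 'cV[R]_n :=
  [set t | forall i, 0 < t i 0 < 1].

(* For a Hausdorff space X this is a finite CW structure, with the cube
   [0,1]^n in the role of the closed n-ball. *)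
Definition is_cell_decomposition (X : topologicalType) (I : finType)
    (dim : I -> nat) (Phi : forall i, 'cV[R]_(dim i) -> X) : Prop :=
  [/\ forall i, {within @closed_cube (dim i), continuous (Phi i)},
      forall x : X, exists! c : {i : I & 'cV[R]_(dim i)},
        open_cube (tagged c) /\ Phi (tag c) (tagged c) = x
    & forall i t, closed_cube t -> ~ open_cube t ->
        exists j (s : 'cV[R]_(dim j)),
          [/\ (dim j < dim i)%N, open_cube s & Phi j s = Phi i t] ].

(* Genus of a closed orientable surface through its Euler characteristic
   2 - 2g, which does not depend on the cell decomposition. *)
Definition has_genus (X : topologicalType) (g : nat) : Prop :=
  exists (I : finType) (dim : I -> nat) (Phi : forall i, 'cV[R]_(dim i) -> X),
    is_cell_decomposition Phi /\
    \sum_(i : I) (-1) ^+ dim i = 2 - 2 * g%:Z :> int.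

End Surfaces.

Section Torus.
Variable R : realType.

Definition lattice_rel (u v : 'cV[R]_2) : bool :=
  [forall i, (u i 0 - v i 0) \is a Num.int].

Lemma lattice_rel_refl : reflexive lattice_rel.
Proof. by move=> u; apply/forallP => i; rewrite subrr rpred0. Qed.

Lemma lattice_rel_sym : symmetric lattice_rel.
Proof.
by move=> u v; apply/eq_forallb => i; rewrite -[LHS]rpredN opprB.
Qed.

Lemma lattice_rel_trans : transitive lattice_rel.
Proof.
move=> v u w /forallP uv /forallP vw; apply/forallP => i.
by rewrite -(subrKA (v i 0)) rpredD.
Qed.

Canonical lattice_equiv :=
  EquivRel lattice_rel lattice_rel_refl lattice_rel_sym lattice_rel_trans.

Definition torus : topologicalType :=
  quotient_topology {eq_quot lattice_equiv}.

Definition torus_pi : 'cV[R]_2 -> torus :=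
  \pi_(quotient_topology {eq_quot lattice_equiv})%qT.

Definition infty : torus := torus_pi 0.

(* p restricts to an unramified covering of degree d over B. *)
Definition covering_over (X E : topologicalType) (p : X -> E) (B : set E)
    (d : nat) : Prop :=
  forall e, B e -> exists (V : set E) (U : 'I_d -> set X),
    [/\ open V, V e & V `<=` B] /\
    [/\ p @^-1` V = \bigcup_(i in [set: 'I_d]) U i,
        trivIset [set: 'I_d] U
      & forall i, open (U i) /\ homeomorphism_between (U i) V p].

(* Since the surface is a closed 2-manifold, finiteness of the fibre over
   infty forces p to look like z |-> z^k near each point of that fibre: the
   surface is the completion of the punctured surface by one point per end.
   The orientation of the surface is the one pulled back along p from the
   standard orientation of R^2. *)
Record origami := Origami {
  ori_surface :> topologicalType;
  ori_degree : nat;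
  ori_map : ori_surface -> torus;
  ori_closed : closed_surface R ori_surface;
  ori_degree_gt0 : (0 < ori_degree)%N;
  ori_continuous : continuous ori_map;
  ori_covering : covering_over ori_map [set~ infty] ori_degree;
  ori_finite : finite_set (ori_map @^-1` [set infty])
}.

Definition punctured (O : origami) : set O := ~` (@ori_map O @^-1` [set infty]).

(* The translation structure mu_A: its charts are the local lifts of
   punctured O -> E = C / Lambda_A to C, where A : C -> C induces the
   identification of C / Lambda_I with C / Lambda_A. *)
Definition translation_structure (O : origami) (A : 'M[R]_2) :
    set (set O * (O -> 'cV[R]_2)) :=
  [set c | [/\ is_chart c, c.1 `<=` @punctured O
    & forall y, c.1 y -> torus_pi (invmx A *m c.2 y) = ori_map y]].

(* Such an f is automatically smooth, with smooth inverse. *)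
Definition affine_diffeo (O : origami) (f : O -> O) (A : 'M[R]_2) : Prop :=
  [/\ A \in unitmx,
      homeomorphism_between (@punctured O) (@punctured O) f
    & forall c c', translation_structure 1%:M c ->
        translation_structure 1%:M c' ->
        forall x : O, c.1 x -> c'.1 (f x) ->
        exists z0 : 'cV[R]_2,
          \forall y \near x, c'.2 (f y) = A *m c.2 y + z0].

(* f preserves the orientation exactly when its derivative A has positive
   determinant. *)
Definition veech_group (O : origami) : set 'M[R]_2 :=
  [set A | 0 < \det A /\ exists f : O -> O, affine_diffeo f A].

End Torus.

Section Moduli.
Variable R : realType.

Definition mul_i (v : 'cV[R]_2) : 'cV[R]_2 :=
  \col_k (if k == 0 then - v 1 0 else v 0 0).

Definition complex_differentiable (F : 'cV[R]_2 -> 'cV[R]_2) (z : 'cV[R]_2) :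
    Prop :=
  differentiable F z /\ forall v, 'd F z (mul_i v) = mul_i ('d F z v).

(* F plays the role of psi \o f \o phi^-1 near phi x. *)
Definition holomorphic_map (X Y : topologicalType)
    (atX : set (set X * (X -> 'cV[R]_2))) (atY : set (set Y * (Y -> 'cV[R]_2)))
    (f : X -> Y) : Prop :=
  forall c c', atX c -> atY c' -> forall x, c.1 x -> c'.1 (f x) ->
  exists2 F : 'cV[R]_2 -> 'cV[R]_2,
    complex_differentiable F (c.2 x) &
    \forall y \near x, c'.2 (f y) = F (c.2 y).

Record riemann_surface := RiemannSurface {
  rs_surface :> topologicalType;
  rs_atlas : set (set rs_surface * (rs_surface -> 'cV[R]_2));
  rs_closed : closed_surface R rs_surface;
  rs_charts : forall c, rs_atlas c -> is_chart c;
  rs_cover : forall x, exists2 c, rs_atlas c & c.1 x;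
  rs_compatible : holomorphic_map rs_atlas rs_atlas id
}.

Definition biholomorphic (Y Z : riemann_surface) : Prop :=
  exists2 h : Y -> Z, homeomorphism_between [set: Y] [set: Z] h
    & holomorphic_map (@rs_atlas Y) (@rs_atlas Z) h.

(* Points of moduli space are isomorphism classes. The types are written as
   predicates because riemann_surface is too large for the universe of [set]. *)
Definition iso_class (Y : riemann_surface) : riemann_surface -> Prop :=
  fun Z => biholomorphic Y Z.

Definition moduli_space (g : nat) : (riemann_surface -> Prop) -> Prop :=
  fun c => exists2 Y : riemann_surface, has_genus R Y g & c = iso_class Y.

(* Y is (X, mu_A): the homeomorphism h transports the complex structure of Y
   to one on X that extends the complex structure mu_A of the punctured
   surface. *)
Definition represents (O : origami R) (A : 'M[R]_2) (Y : riemann_surface) :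
    Prop :=
  exists2 h : O -> Y, homeomorphism_between [set: O] [set: Y] h
    & holomorphic_map (@translation_structure R O A) (@rs_atlas Y) h.

(* The image of A |-> [X, mu_A], for A in SL_2(R). *)
Definition origami_curve (O : origami R) : (riemann_surface -> Prop) -> Prop :=
  fun c => exists (A : 'M[R]_2) (Y : riemann_surface),
    [/\ \det A = 1, represents O A Y & c = iso_class Y].

End Moduli.

Section Congruence.
Variable R : realType.

Definition SL2Z : set 'M[int]_2 := [set B | \det B = 1].

Definition principal_congruence (n : nat) : set 'M[int]_2 :=
  [set B | SL2Z B /\ forall i j, (B i j = 1%:M i j %[mod n%:Z])%Z].

Definition intmx (B : 'M[int]_2) : 'M[R]_2 := map_mx intr B.

Definition subgroup_of_SL2Z (G : set 'M[R]_2) : Prop :=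
  [/\ G `<=` @intmx @` SL2Z,
      G 1%:M,
      forall A B, G A -> G B -> G (A *m B)
    & forall A, G A -> G (invmx A)].

Definition congruence_group (G : set 'M[R]_2) : Prop :=
  subgroup_of_SL2Z G /\
  exists2 n : nat, (1 <= n)%N & @intmx @` principal_congruence n `<=` G.

Definition non_congruence_group (G : set 'M[R]_2) : Prop :=
  subgroup_of_SL2Z G /\ ~ congruence_group G.

End Congruence.

(* Main.v *)
(* On the tiled surface with monodromy (h, v), a closed geodesic of holonomy w
   corresponds to a fixed point of the permutation by which crossing edges in
   direction w acts on the squares, and an affine diffeomorphism of derivative A
   carries closed geodesics of holonomy w to closed geodesics of holonomy A w.
   Take d = 3m + 1 squares in one cylinder, h = (0 1 ... 3m), and
   v = (0 1)(2 3)...(2m-2 2m-1); the genus is m + 1. Suppose that Gamma(n) is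
   contained in the Veech group. As d and 2m + 1 are coprime there are a and b with
   n | ab, b even, a = 1 mod d and b = -1 mod 2m + 1. The commutator of the
   elementary matrices with entries a and b lies in Gamma(ab) and sends (1, b) to
   (1 + ab, b). In direction (1, b) the squares are permuted by h v^b = h, which has
   no fixed point. In direction (1 + ab, b) they are permuted by
   h (v h^a)^b = h (v h)^b; the square 2m lies on a cycle of v h of length 2m + 1, so
   (v h)^b acts on it as (v h)^-1, and it is fixed, since v fixes it. This is a
   contradiction.
   That the Veech group is contained in SL_2(Z) holds because an affine map
   preserves the vertices: it can carry an edge only to a segment which joins two
   vertices, as otherwise the image would accumulate at an interior point. *)

Require Import Defs.
From HB Require Import structures.
From mathcomp Require Import all_boot all_order all_fingroup all_algebra.
From mathcomp Require Import all_classical all_reals all_analysis.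
From mathcomp Require Import ring lra zify.

Set Implicit Arguments.
Unset Strict Implicit.
Unset Printing Implicit Defensive.

Import Order.TTheory GRing.Theory Num.Theory.
Import numFieldNormedType.Exports.

Local Open Scope classical_set_scope.
Local Open Scope ring_scope.

(** * Real vectors and the torus *)

(** Why 3m + 1 squares. After its m transposed pairs the cylinder may end in any number k + 1 of
    squares fixed by v without a change of genus; then d = 2m + 1 + k, and the cycle of v h through
    2m has length m + 1 + k. The condition n | ab must be solvable for every n, while a prime factor
    of d never divides a, a prime factor of the cycle length never divides b, and b is even. So the
    length has to be odd and coprime to d; k = m achieves both for every m. Most of the work goes
    into the surface. An origami is a closed topological surface with a covering, so the glued
    squares need charts, at the vertices too, a separation argument and a cell decomposition. Charts
    at the vertices need only be homeomorphisms, hence corners are spread linearly over equal angles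
    instead of taking roots of a complex coordinate. Points of the surface are normal forms, and
    geodesics are paths over straight lines of the torus, followed through strips of three squares;
    closing up is then a matter of linear arithmetic and unique lifting. *)

Lemma connected_locally_constant (T : topologicalType) (A : set T)
    (P : T -> Prop) :
  connected A ->
  (forall x, A x -> \forall y \near x, A y -> (P y <-> P x)) ->
  forall x y, A x -> A y -> P x -> P y.
Proof.
move=> cA locP x y Ax Ay Px.
(* Connectedness of [A] is tested with sets that are open in all of [T]; this union of interiors is
   one, and it meets [A] exactly where [Q] holds. *)
have opn (Q : T -> Prop) :
    (forall x, A x -> \forall y \near x, A y -> (Q y <-> Q x)) ->
    open (\bigcup_(x in A `&` Q) (fun y => A y -> (Q y <-> Q x))°).
  by move=> _; apply: bigcup_open => z _; exact: open_interior.
have memU (Q : T -> Prop) :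
    (forall x, A x -> \forall y \near x, A y -> (Q y <-> Q x)) ->
    A `&` (\bigcup_(x in A `&` Q) (fun y => A y -> (Q y <-> Q x))°) = A `&` Q.
  move=> locQ; apply/seteqP; split=> z [Az].
    by case=> w [Aw Qw] /interior_subset /(_ Az) zw; split => //; apply/zw.
  by move=> Qz; split => //; exists z => //; exact: locQ.
suff : A `&` P = A by move=> AP; have := Ay; rewrite -[in X in X -> _]AP => -[].
have locN z : A z -> \forall w \near z, A w -> ((~ P w) <-> (~ P z)).
  move=> /locP; apply: filterS => w h /h; tauto.
apply: cA.
- by exists x.
- exists (\bigcup_(x in A `&` P) (fun y => A y -> (P y <-> P x))°).
    exact: opn.
  by rewrite memU.
- exists (~` \bigcup_(x in A `&` (fun z => ~ P z))
            (fun y => A y -> ((~ P y) <-> (~ P x)))°).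
    by apply: open_closedC; exact: (opn (fun z => ~ P z)).
  have /seteqP[s1 s2] := memU (fun z => ~ P z) locN.
  apply/seteqP; split=> z [Az h]; split => //.
    by move=> hz; have [] := s1 z (conj Az hz).
  by apply/not_notP => nPz; apply: h; have [] := s2 z (conj Az nPz).
Qed.

Section Plane.
Variable R : realType.

Definition vec (x y : R) : 'cV[R]_2 := \col_k (if k == 0 then x else y).

Lemma vec0 x y : vec x y 0 0 = x. Proof. by rewrite mxE. Qed.
Lemma vec1 x y : vec x y 1 0 = y. Proof. by rewrite mxE. Qed.
Definition vecE := (vec0, vec1).

Lemma ord2P (k : 'I_2) : k = 0 \/ k = 1.
Proof. by case: k => [[|[|//]] i]; [left|right]; exact: val_inj. Qed.

Lemma forall_ord2 (P : 'I_2 -> Prop) : P 0 -> P 1 -> forall k, P k.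
Proof. by move=> P0 P1 k; case: (ord2P k) => ->. Qed.

Lemma eq_vec (u v : 'cV[R]_2) : u 0 0 = v 0 0 -> u 1 0 = v 1 0 -> u = v.
Proof.
by move=> e0 e1; apply/matrixP => i j; rewrite (ord1 j);
  move: i; apply: forall_ord2.
Qed.

Lemma vec_eta (u : 'cV[R]_2) : vec (u 0 0) (u 1 0) = u.
Proof. by apply: eq_vec; rewrite vecE. Qed.

Lemma cvg_cV2 (T : Type) (G : set_system T) (FG : Filter G)
    (f : T -> 'cV[R]_2) (u : 'cV[R]_2) :
  f t 0 0 @[t --> G] --> u 0 0 -> f t 1 0 @[t --> G] --> u 1 0 ->
  f @ G --> u.
Proof.
move=> f0 f1 A [P uP sPA].
have h0 : \forall t \near G, P 0 0 (f t 0 0) by exact: f0 (uP 0 0).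
have h1 : \forall t \near G, P 1 0 (f t 1 0) by exact: f1 (uP 1 0).
apply: filterS2 h0 h1 => t h0 h1; apply: sPA => i j; rewrite (ord1 j).
by case: (ord2P i) => ->.
Qed.

Lemma coord_cvg (u : 'cV[R]_2) i : v i 0 @[v --> u] --> u i 0.
Proof. exact: coord_continuous. Qed.

Lemma cvg_coord (T : Type) (G : set_system T) (FG : Filter G)
    (f : T -> 'cV[R]_2) (u : 'cV[R]_2) i :
  f @ G --> u -> f t i 0 @[t --> G] --> u i 0.
Proof. by move=> fu; exact: (cvg_comp f (fun M : 'cV[R]_2 => M i 0) fu (@coord_cvg u i)). Qed.

Lemma cvg_vec (T : Type) (G : set_system T) (FG : Filter G)
    (f g : T -> R) (x y : R) :
  f @ G --> x -> g @ G --> y -> vec (f t) (g t) @[t --> G] --> vec x y.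
Proof.
move=> fx gy; apply: cvg_cV2.
  by rewrite vec0; under eq_fun do rewrite vec0.
by rewrite vec1; under eq_fun do rewrite vec1.
Qed.

Lemma cvg_lincomb (T : Type) (G : set_system T) (FG : Filter G)
    (f g : T -> R) (a b x y : R) :
  f @ G --> x -> g @ G --> y -> a * f t + b * g t @[t --> G] --> a * x + b * y.
Proof. by move=> fx gy; apply: cvgD; exact: cvgMr. Qed.

Lemma mulmx2E (A : 'M[R]_2) (u : 'cV[R]_2) i :
  (A *m u) i 0 = A i 0 * u 0 0 + A i 1 * u 1 0.
Proof.
rewrite !mxE big_ord_recl big_ord1; do 3 f_equal; f_equal; exact: val_inj.
Qed.

Lemma torus_piP (u v : 'cV[R]_2) :
  torus_pi u = torus_pi v <->
  (u 0 0 - v 0 0 \is a Num.int) /\ (u 1 0 - v 1 0 \is a Num.int).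
Proof.
rewrite /torus_pi; split.
  by move=> /eqquotP/forallP h; split; exact: h.
by move=> [h0 h1]; apply/eqquotP/forallP; apply: forall_ord2.
Qed.

Lemma torus_pi_surj (e : torus R) : exists u, torus_pi u = e.
Proof. by exists (generic_quotient.repr e); rewrite /torus_pi reprK. Qed.

Lemma torus_pi_continuous : continuous (@torus_pi R).
Proof. exact: pi_continuous. Qed.

Lemma continuous_translate (l : 'cV[R]_2) : continuous (fun u : 'cV[R]_2 => u - l).
Proof.
by move=> u; apply: (@cvgB R 'cV[R]_2 _ (nbhs u) _ id (fun=> l) u l);
  [exact: cvg_id|exact: cvg_cst].
Qed.

(** The saturation of [W] is the union of its translates by lattice vectors. *)
Lemma torus_pi_open (W : set 'cV[R]_2) : open W -> open (@torus_pi R @` W).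
Proof.
move=> oW; rewrite /open/= /quotient_open.
rewrite [X in open X](_ : _ = \bigcup_(l in [set l : 'cV[R]_2 |
    torus_pi l = torus_pi 0]) ((fun u => u - l) @^-1` W)).
  apply: bigcup_open => l _; apply: open_comp => // u _.
  exact: continuous_translate.
apply/seteqP; split=> u /=.
  move=> [w Ww wu]; exists (u - w); last by rewrite /= opprB addrC subrK.
  by apply/torus_piP; move/esym/torus_piP: wu => [? ?]; rewrite !mxE !subr0.
move=> [l /torus_piP + Wl]; rewrite !mxE !subr0 => -[l0 l1].
exists (u - l) => //; apply/torus_piP; rewrite !mxE.
by split; rewrite addrAC subrr sub0r rpredN.
Qed.

Lemma sin2_pi_int (x y : R) : x - y \is a Num.int ->
  sin (pi * x) ^+ 2 = sin (pi * y) ^+ 2.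
Proof.
have nat_case (a : R) n : sin (a + pi *+ n) ^+ 2 = sin a ^+ 2.
  elim: n => [|n IHn]; first by rewrite mulr0n addr0.
  by rewrite mulrSr addrA sinDpi sqrrN.
move=> /intrP[m xy]; have {xy} -> : x = y + m%:~R by rewrite -xy addrC subrK.
case: m => n.
  by rewrite mulrDr -pmulrn mulr_natr nat_case.
by rewrite NegzE mulrNz mulrBr -pmulrn mulr_natr -(nat_case _ n.+1) addrNK.
Qed.

Lemma sin_pi_eq0 (x : R) : sin (pi * x) ^+ 2 = 0 -> x \is a Num.int.
Proof.
set s := x - (Num.floor x)%:~R => hs.
have /andP[s0 s1] : 0 <= s < 1 by rewrite /s; have := floor_itv x; rewrite intrD1; lra.
have : sin (pi * s) ^+ 2 = 0.
  by rewrite -hs; apply: sin2_pi_int; rewrite /s addrAC subrr sub0r rpredN intr_int.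
move: s0; rewrite le_eqVlt => /orP[/eqP s_0 _|s_gt0 /eqP].
  by rewrite -[x](subrK (Num.floor x)%:~R) -/s -s_0 add0r intr_int.
rewrite sqrf_eq0 => /eqP; have := @sin_gt0_pi R (pi * s).
rewrite mulr_gt0 ?pi_gt0//= gtr_pMr ?pi_gt0// s1 => /(_ isT) /[swap] ->.
by rewrite ltxx.
Qed.

(** For fixed [v] the function [D v] is continuous, invariant under the lattice and zero only on the
    class of [v], so its values separate that class from any other. *)
Lemma torus_hausdorff : hausdorff_space (torus R).
Proof.
pose D (v u : 'cV[R]_2) : R :=
  sin (pi * (u 0 0 - v 0 0)) ^+ 2 + sin (pi * (u 1 0 - v 1 0)) ^+ 2.
have D_cont v : continuous (D v).
  have phi_cont (a : R) : continuous (fun x : R => sin (pi * (x - a)) ^+ 2).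
    move=> x; apply: (@continuous_comp _ _ _ (fun x => sin (pi * (x - a))) (fun x => x ^+ 2));
      last exact: exprn_continuous.
    apply: (@continuous_comp _ _ _ (fun x => pi * (x - a)) sin);
      last exact: continuous_sin.
    by apply: cvgMr; apply: cvgB; [exact: cvg_id|exact: cvg_cst].
  have coordD i : continuous (fun u : 'cV[R]_2 => sin (pi * (u i 0 - v i 0)) ^+ 2).
    move=> u; apply: (@continuous_comp _ _ _ (fun u : 'cV[R]_2 => u i 0) _ _ _
      (phi_cont _ _)); exact: coord_continuous.
  by move=> u; apply: (@cvgD _ _ _ (nbhs u)); exact: coordD.
have DE v u w : torus_pi u = torus_pi w -> D v u = D v w.
  move=> /torus_piP[h0 h1]; rewrite /D; congr (_ + _); apply: sin2_pi_int;
  by rewrite opprB addrA subrK.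
have D0 v u : D v u = 0 -> torus_pi u = torus_pi v.
  move=> /eqP; rewrite paddr_eq0 ?sqr_ge0// => /andP[/eqP h0 /eqP h1].
  by apply/torus_piP; split; exact: sin_pi_eq0.
have Dvv v : D v v = 0 by rewrite /D !subrr mulr0 sin0 expr0n addr0.
rewrite open_hausdorff => e e'; have [u <-{e}] := torus_pi_surj e.
have [v <-{e'}] := torus_pi_surj e' => /eqP uv.
have Du : 0 < D v u.
  rewrite lt_neqAle addr_ge0 ?sqr_ge0// andbT eq_sym.
  by apply/eqP => /D0.
exists (@torus_pi R @` [set w | D v u / 2 < D v w],
        @torus_pi R @` [set w | D v w < D v u / 2]) => /=.
  split; rewrite inE /=; [exists u => //=|exists v => //=]; rewrite ?Dvv; lra.
split.
- apply: torus_pi_open.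
  by apply: (@open_comp _ _ (D v) [set x | D v u / 2 < x]);
    [move=> *; exact: D_cont|exact: open_gt].
- apply: torus_pi_open.
  by apply: (@open_comp _ _ (D v) [set x | x < D v u / 2]);
    [move=> *; exact: D_cont|exact: open_lt].
- apply/eqP; apply/seteqP; split=> // _ [[w /= h1 <-] [w' /= h2 /DE h3]].
  by have := lt_trans h2 h1; rewrite h3 ltxx.
Qed.

(** Discreteness of the lattice: [f - g] is integral near the limit and tends to the integral vector
    [a - b], so it ends up equal to it. Chart changes are translations, and lifted lines are
    straight in charts, for this reason. *)
Lemma lattice_locally_const (T : Type) (F : set_system T) (FF : Filter F)
    (f g : T -> 'cV[R]_2) (a b : 'cV[R]_2) :
  f @ F --> a -> g @ F --> b -> torus_pi a = torus_pi b ->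
  (\forall y \near F, torus_pi (f y) = torus_pi (g y)) ->
  \forall y \near F, f y = g y + (a - b).
Proof.
move=> fa gb /torus_piP[x0 x1] fg.
have coord i : \forall y \near F, `|(f y i 0 - g y i 0) - (a i 0 - b i 0)| < 1.
  have : f y i 0 - g y i 0 @[y --> F] --> a i 0 - b i 0.
    by apply: cvgB; exact: cvg_coord.
  by move=> /cvgrPdist_lt /(_ 1 ltr01); apply: filterS => y; rewrite distrC.
have key (r s : R) : r \is a Num.int -> s \is a Num.int -> `|r - s| < 1 -> r = s.
  move=> ai bi ab; apply/eqP; rewrite -subr_eq0; apply/negPn/negP => ne.
  by have := norm_intr_ge1 (rpredB ai bi) ne; rewrite leNgt ab.
move: (coord 0) (coord 1) fg; apply: filterS3 => y h0 h1 /torus_piP[y0 y1].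
have e0 := key _ _ y0 x0 h0; have e1 := key _ _ y1 x1 h1.
have -> : a - b = f y - g y by apply: eq_vec; rewrite !mxE.
by rewrite addrC subrK.
Qed.

End Plane.

(** * Affine diffeomorphisms and geodesics *)

Section Homeomorphisms.

Lemma homeomorphism_sym (X Y : topologicalType) (A : set X) (B : set Y)
    (f : X -> Y) :
  homeomorphism_between A B f ->
  exists2 g : Y -> X, homeomorphism_between B A g &
    (forall x, A x -> g (f x) = x) /\ (forall y, B y -> f (g y) = y).
Proof. by move=> [g [[fAB gBA gf fg] [cf cg]]]; exists g => //; exists f. Qed.

Lemma homeomorphism_comp (X Y Z : topologicalType) (A : set X) (B : set Y)
    (C : set Z) (f : X -> Y) (g : Y -> Z) :
  homeomorphism_between A B f -> homeomorphism_between B C g ->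
  homeomorphism_between A C (g \o f).
Proof.
move=> [f' [[fAB fBA f'f ff'] [cf cf']]] [g' [[gBC gCB g'g gg'] [cg cg']]].
exists (f' \o g'); split; [split|split].
- by move=> x Ax; apply: gBC; exact: fAB.
- by move=> z Cz; apply: fBA; exact: gCB.
- by move=> x Ax /=; rewrite g'g ?f'f//; exact: fAB.
- by move=> z Cz /=; rewrite ff' ?gg'//; exact: gCB.
- apply/subspace_continuousP => x Ax.
  move/subspace_continuousP: cf => /(_ x Ax) cf.
  move/subspace_continuousP: cg => /(_ (f x) (fAB _ Ax)) cg.
  apply: (@cvg_trans _ (g @ within B (nbhs (f x)))) => //.
  move=> W /= BW; have /cf := BW; rewrite /within/= !nbhs_simpl/= => BW'.
  by apply: filterS BW' => y /[swap] Ay /(_ Ay); apply; exact: fAB.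
- apply/subspace_continuousP => x Cx.
  move/subspace_continuousP: cg' => /(_ x Cx) cg'.
  move/subspace_continuousP: cf' => /(_ (g' x) (gCB _ Cx)) cf'.
  apply: (@cvg_trans _ (f' @ within B (nbhs (g' x)))) => //.
  move=> W /= BW; have /cg' := BW; rewrite /within/= !nbhs_simpl/= => BW'.
  by apply: filterS BW' => y /[swap] Cy /(_ Cy); apply; exact: gCB.
Qed.

Lemma within_open_continuous (X Y : topologicalType) (A : set X) (f : X -> Y)
    (x : X) :
  open A -> {within A, continuous f} -> A x -> {for x, continuous f}.
Proof.
by move=> oA; rewrite continuous_open_subspace// => cf Ax; apply: cf; rewrite inE.
Qed.

Lemma homeomorphism_continuous (X Y : topologicalType) (A : set X) (B : set Y)
    (f : X -> Y) (x : X) :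
  open A -> homeomorphism_between A B f -> A x -> {for x, continuous f}.
Proof. by move=> oA [g [_ [cf _]]]; exact: within_open_continuous. Qed.

End Homeomorphisms.


Lemma itv_connected (R : realType) (i : interval R) : connected [set` i].
Proof. by apply/connected_intervalP; exact: interval_is_interval. Qed.

Section TranslationCharts.
Variables (R : realType) (O : origami R).
Local Notation p := (@ori_map R O).
Local Notation pX := (@punctured R O).
Local Notation TS := (@translation_structure R O 1%:M).

Lemma translation_chartP c :
  TS c <-> [/\ is_chart c, c.1 `<=` pX
              & forall y, c.1 y -> torus_pi (c.2 y) = p y].
Proof. by split=> -[h1 h2 h3]; split=> // y /h3; rewrite invmx1 mul1mx. Qed.

Lemma punctured_open : open pX.
Proof.
rewrite /punctured; apply: closed_openC.
move: (@ori_continuous R O) => /continuous_closedP; apply.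
exact/accessible_closed_set1/hausdorff_accessible/torus_hausdorff.
Qed.

Lemma translation_chart_open c : TS c -> open c.1.
Proof. by move=> /translation_chartP[[]]. Qed.

Lemma translation_chart_continuous c x :
  TS c -> c.1 x -> {for x, continuous c.2}.
Proof.
move=> /translation_chartP[[oc _ hc] _ _]; exact: homeomorphism_continuous hc.
Qed.

Lemma translation_chart_near c x : TS c -> c.1 x -> \forall y \near x, c.1 y.
Proof. by move=> /translation_chart_open oc cx; exact: open_nbhs_nbhs. Qed.

Lemma translation_chart_ori c x : TS c -> c.1 x -> torus_pi (c.2 x) = p x.
Proof. by move=> /translation_chartP[_ _]; exact. Qed.

Lemma translation_chart_transition c c' x : TS c -> TS c' -> c.1 x -> c'.1 x ->
  exists z0, \forall y \near x, c'.2 y = c.2 y + z0.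
Proof.
move=> tc tc' cx c'x; exists (c'.2 x - c.2 x).
apply: lattice_locally_const; try exact: translation_chart_continuous.
  by rewrite (translation_chart_ori tc)// (translation_chart_ori tc').
have h := translation_chart_near tc cx; have h' := translation_chart_near tc' c'x.
apply: filterS2 h h' => y cy c'y.
by rewrite (translation_chart_ori tc)// (translation_chart_ori tc').
Qed.

Hypothesis chart_at : forall x : O, pX x -> exists2 c, TS c & c.1 x.

Lemma affine_id : affine_diffeo id (1%:M : 'M[R]_2) (O := O).
Proof.
split; first exact: unitmx1.
  exists id; split; first by split.
  by split; apply: continuous_subspaceT => x; exact: cvg_id.
move=> c c' tc tc' x cx c'x.
have [z0 hz] := translation_chart_transition tc tc' cx c'x.
by exists z0; apply: filterS hz => y; rewrite mul1mx.
Qed.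

Lemma affine_fun (f : O -> O) A x : affine_diffeo f A -> pX x -> pX (f x).
Proof. by move=> [_ [g [[fp _ _ _] _]] _]; exact: fp. Qed.

Lemma affine_continuous (f : O -> O) A x :
  affine_diffeo f A -> pX x -> {for x, continuous f}.
Proof. by move=> [_ hf _]; exact: homeomorphism_continuous punctured_open hf. Qed.

Lemma affine_comp (f g : O -> O) (A B : 'M[R]_2) :
  affine_diffeo f A -> affine_diffeo g B -> affine_diffeo (f \o g) (A *m B).
Proof.
move=> af ag; have [uA hf lf] := af; have [uB hg lg] := ag.
split; first by rewrite unitmx_mul uA.
  exact: homeomorphism_comp hg hf.
move=> c c' tc tc' x cx c'x.
have px : pX x by have [_ + _] := tc; apply.
have [c1 tc1 c1x] := chart_at (affine_fun ag px).
have [z1 h1] := lg _ _ tc tc1 _ cx c1x.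
have [z2 h2] := lf _ _ tc1 tc' _ c1x c'x.
exists (A *m z1 + z2); have := affine_continuous ag px h2.
rewrite nbhs_simpl/=; apply: filterS2 h1 => y h1y /= ->.
by rewrite h1y mulmxDr mulmxA addrA.
Qed.

Lemma affine_inv (f : O -> O) (A : 'M[R]_2) : affine_diffeo f A ->
  exists2 g, affine_diffeo g (invmx A) &
    (forall x, pX x -> g (f x) = x) /\ (forall x, pX x -> f (g x) = x).
Proof.
move=> [uA hf lf]; have [g hg [gf fg]] := homeomorphism_sym hf.
exists g => //; split; first by rewrite unitmx_inv.
  exact: hg.
move=> c c' tc tc' x cx c'gx.
have px : pX x by have [_ + _] := tc; apply.
have cg := homeomorphism_continuous punctured_open hg px.
have cfgx : c.1 (f (g x)) by rewrite fg.
have [z0] := lf _ _ tc' tc _ c'gx cfgx.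
move=> /cg; rewrite nbhs_simpl/= => h; exists (- (invmx A *m z0)).
have hp : \forall y \near x, pX y by exact: (open_nbhs_nbhs (conj punctured_open px)).
apply: filterS2 h hp => y /= + py; rewrite fg// => ->.
by rewrite mulmxDr mulKmx// addrK.
Qed.

(** A geodesic with velocity [u] that avoids the vertices, described by its image in the torus
    instead of by charts. The base point [z] counts only modulo the lattice. *)
Definition lifts_line (gamma : R -> O) (J : set R) (z u : 'cV[R]_2) : Prop :=
  {within J, continuous gamma} /\
  forall t, J t -> pX (gamma t) /\ p (gamma t) = torus_pi (z + t *: u).

Lemma torus_piD (u v w : 'cV[R]_2) :
  torus_pi (u + w) = torus_pi (v + w) <-> torus_pi u = torus_pi v.
Proof.
have e i : (u + w) i 0 - (v + w) i 0 = u i 0 - v i 0 by rewrite !mxE; ring.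
by split=> /torus_piP h; apply/torus_piP; move: h; rewrite !e.
Qed.

Lemma lifts_line_shift gamma J z z' u : torus_pi z = torus_pi z' ->
  lifts_line gamma J z u -> lifts_line gamma J z' u.
Proof.
move=> zz [cg h]; split=> // t /h[h1 h2]; split => //.
by rewrite h2; apply/torus_piD.
Qed.

Lemma line_cvg (G : set_system R) (FG : Filter G) (z u : 'cV[R]_2) (t : R) :
  G --> t -> z + s *: u @[s --> G] --> z + t *: u.
Proof.
move=> Gt; apply: cvg_cV2; rewrite !mxE; under eq_fun do rewrite !mxE.
  by apply: cvgD; [exact: cvg_cst|exact: cvgMl].
by apply: cvgD; [exact: cvg_cst|exact: cvgMl].
Qed.

Lemma lifts_line_chart gamma J z u c t : TS c -> lifts_line gamma J z u ->
  J t -> c.1 (gamma t) ->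
  exists z', \forall s \near t, J s ->
    c.1 (gamma s) /\ c.2 (gamma s) = z' + s *: u.
Proof.
move=> tc [/subspace_continuousP cg h] Jt ct.
exists (z + (c.2 (gamma t) - (z + t *: u))).
have cs : within J (nbhs t) (fun s => c.1 (gamma s)).
  exact: (cg t Jt _ (translation_chart_near tc ct)).
have Js : within J (nbhs t) J by exact: withinT.
have tl : torus_pi (c.2 (gamma t)) = torus_pi (z + t *: u).
  by rewrite (translation_chart_ori tc)//; have [] := h t Jt.
have := @lattice_locally_const R R (within J (nbhs t)) _ (c.2 \o gamma)
  (fun t => z + t *: u) (c.2 (gamma t)) (z + t *: u) _ _ tl.
suff near_eq : within J (nbhs t) (fun s =>
    torus_pi (c.2 (gamma s)) = torus_pi (z + s *: u)).
  move=> /(_ _ _ _ near_eq) near_const.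
  have {}near_const : within J (nbhs t) (fun s => c.2 (gamma s) =
      z + s *: u + (c.2 (gamma t) - (z + t *: u))).
    apply: near_const.
      by apply: (cvg_comp _ _ (cg t Jt)); exact: translation_chart_continuous.
    by apply: line_cvg; exact: cvg_within.
  have : within J (nbhs t) (fun s => c.1 (gamma s) /\ c.2 (gamma s) =
      z + (c.2 (gamma t) - (z + t *: u)) + s *: u).
    by apply: filterS2 cs near_const => s cs ->; rewrite addrAC.
  exact.
apply: filterS2 cs Js => s cs Js.
by rewrite (translation_chart_ori tc)//; have [] := h s Js.
Qed.

Lemma translation_chart_inj c x y :
  TS c -> c.1 x -> c.1 y -> c.2 x = c.2 y -> x = y.
Proof.
move=> /translation_chartP[[_ _ [g [[_ _ gK _] _]]] _ _] cx cy.
by move=> /(congr1 g); rewrite !gK.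
Qed.

Lemma lifts_line_near gamma J z u t (P : set O) : lifts_line gamma J z u ->
  J t -> nbhs (gamma t) P -> \forall s \near t, J s -> P (gamma s).
Proof. by move=> [/subspace_continuousP cg _] Jt; exact: (cg t Jt P). Qed.

(** Charts give the claim near each time with some base point. Two parallel lines of the torus that
    meet at one time agree at all times, so connectedness of [J] spreads the base point chosen to
    fit at [t0]. *)
Lemma affine_lifts_line f (A : 'M[R]_2) gamma J z u t0 :
  affine_diffeo f A -> connected J -> J t0 -> lifts_line gamma J z u ->
  exists z', lifts_line (f \o gamma) J z' (A *m u).
Proof.
move=> af cJ Jt0 lg; have [cg h] := lg.
have [w hw] := torus_pi_surj (p (f (gamma t0))).
exists (w - t0 *: (A *m u)).
have loc t : J t -> exists y, \forall s \near t, J s ->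
    p (f (gamma s)) = torus_pi (y + s *: (A *m u)).
  move=> Jt; have [pt _] := h t Jt; have [_ _ lf] := af.
  have [c tc ct] := chart_at pt; have [c' tc' c't] := chart_at (affine_fun af pt).
  have [z1 h1] := lifts_line_chart tc lg Jt ct.
  have [z2] := lf _ _ tc tc' _ ct c't => /(lifts_line_near lg Jt) h2.
  have := affine_continuous af pt (translation_chart_near tc' c't).
  rewrite nbhs_simpl/= => /(lifts_line_near lg Jt) h3.
  exists (A *m z1 + z2); apply: filterS3 h1 h2 h3 => s h1 h2 h3 Js.
  have [_ e1] := h1 Js; rewrite -(translation_chart_ori tc') ?h2 ?e1//; last exact: h3.
  by rewrite mulmxDr scalemxAr addrAC.
split.
  apply/subspace_continuousP => t Jt; have [pt _] := h t Jt.
  move/subspace_continuousP : cg => /(_ t Jt) cg.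
  exact: (cvg_comp gamma f cg (affine_continuous af pt)).
move=> t Jt; split; first by apply: (affine_fun af); have [] := h t Jt.
pose P t := p (f (gamma t)) = torus_pi (w - t0 *: (A *m u) + t *: (A *m u)).
apply: (@connected_locally_constant _ J P _ _ t0) => //; last first.
  by rewrite /P subrK.
move=> s Js; have [y hy] := loc s Js.
have e1 := nbhs_singleton hy Js.
by apply: filterS hy => r hr Jr; rewrite /P hr// e1 !torus_piD.
Qed.

(** The set of times of agreement is open because charts are injective, and closed because the
    surface is Hausdorff. *)
Lemma lifts_line_unique gamma gamma' J z u t0 :
  connected J -> J t0 -> lifts_line gamma J z u -> lifts_line gamma' J z u ->
  gamma t0 = gamma' t0 -> forall t, J t -> gamma t = gamma' t.
Proof.
move=> cJ Jt0 lg lg' e0 t Jt.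
apply: (@connected_locally_constant _ J (fun t => gamma t = gamma' t) _ _ t0) => //.
move=> {t Jt} t Jt; have [pt _] := lg.2 t Jt.
have [ett|/eqP nett] := pselect (gamma t = gamma' t).
  have [c tc ct] := chart_at pt.
  have ct' : c.1 (gamma' t) by rewrite -ett.
  have [z1 h1] := lifts_line_chart tc lg Jt ct.
  have [z2 h2] := lifts_line_chart tc lg' Jt ct'.
  have [_ e1] := nbhs_singleton h1 Jt; have [_ e2] := nbhs_singleton h2 Jt.
  have zz : z1 = z2 by apply: (@addIr _ (t *: u)); rewrite -e1 -e2 ett.
  apply: filterS2 h1 h2 => s h1 h2 Js; split=> // _.
  have [cs es] := h1 Js; have [cs' es'] := h2 Js.
  by apply: (translation_chart_inj tc) => //; rewrite es es' zz.
have [hX _ _ _] := ori_closed O.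
have [[B C] /= [Bt Ct] [oB oC /eqP BC]] : exists2 BC : set O * set O,
    gamma t \in BC.1 /\ gamma' t \in BC.2 &
    [/\ open BC.1, open BC.2 & (BC.1 `&` BC.2) == set0].
  by move: hX; rewrite open_hausdorff => /(_ _ _ nett).
rewrite inE in Bt; rewrite inE in Ct.
have h1 := lifts_line_near lg Jt (open_nbhs_nbhs (conj oB Bt)).
have h2 := lifts_line_near lg' Jt (open_nbhs_nbhs (conj oC Ct)).
apply: filterS2 h1 h2 => s h1 h2 Js; split=> [ess|/eqP]; last by rewrite (negbTE nett).
have : (B `&` C) (gamma s) by split; [exact: h1|rewrite ess; exact: h2].
by rewrite BC.
Qed.

(* By compactness the images accumulate somewhere as [t] tends to [tau]; over a
   point other than [infty] they would be pulled back by the continuous inverse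
   of [f] to an accumulation point of [gamma] in the punctured surface. *)
Lemma affine_line_escapes f (A : 'M[R]_2) gamma J z z' u u' (G : set_system R)
    (tau : R) (x : O) :
  affine_diffeo f A -> lifts_line gamma J z u ->
  lifts_line (f \o gamma) J z' u' ->
  ProperFilter G -> G J -> G --> tau -> gamma @ G --> x -> ~ pX x ->
  torus_pi (z' + tau *: u') = @infty R.
Proof.
move=> af [_ h] [_ h'] PG GJ Gt gx npx; apply/not_notP => ninf.
have [hX cX _ _] := ori_closed O.
have [y [_ cly]] := cX ((f \o gamma) @ G) _ filterT.
have py : p y = torus_pi (z' + tau *: u').
  apply: torus_hausdorff => B C By Ce.
  have GC : ((f \o gamma) @ G) (p @^-1` C).
    have lim : torus_pi (z' + t *: u') @[t --> G] --> torus_pi (z' + tau *: u').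
      apply: (cvg_comp (fun t => z' + t *: u') (@torus_pi R)); last exact: torus_pi_continuous.
      exact: line_cvg.
    have := lim C Ce; rewrite nbhs_simpl/= => h1.
    by apply: filterS2 h1 GJ => t Ct Jt /=; have [_ /= ->] := h' t Jt.
  have [a [Ca Ba]] := cly _ _ GC (ori_continuous By).
  by exists (p a).
have pXy : pX y by rewrite /punctured/= py.
have [g ag [gf fg]] := affine_inv af.
apply: npx; rewrite -(_ : g y = x); first exact: affine_fun ag _.
apply: hX => B C Bgy Cx.
have GC : ((f \o gamma) @ G) (g @^-1` C).
  have := gx C Cx; rewrite nbhs_simpl/= => h1.
  by apply: filterS2 h1 GJ => t Ct Jt /=; rewrite gf//; have [] := h t Jt.
have [a [Ca Ba]] := cly _ _ GC (affine_continuous ag pXy Bgy).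
by exists (g a).
Qed.

(** The sides of a square provide these paths in [tiled_edge_path]. An affine map sends the ends to
    points over the lattice, which makes column [j] of its derivative integral. *)
Hypothesis edge_path : forall j : 'I_2, exists gamma z (x0 x1 : O),
  [/\ lifts_line gamma `]0, 1[ z (delta_mx j 0),
       gamma t @[t --> 0^'+] --> x0, gamma t @[t --> 1^'-] --> x1,
       ~ pX x0 & ~ pX x1].

Lemma affine_int (f : O -> O) (A : 'M[R]_2) i j : affine_diffeo f A -> A i j \is a Num.int.
Proof.
move=> af; have [gamma [z [x0 [x1 [lg g0 g1 nx0 nx1]]]]] := edge_path j.
have half : `]0, 1[%classic (2^-1 : R) by rewrite /= in_itv/=; lra.
have [z' lg'] := affine_lifts_line af (@itv_connected R _) half lg.
have near0 : \forall t \near (0:R)^'+, `]0, 1[%classic t.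
  by near=> t; rewrite /= in_itv/=; apply/andP; split; near: t;
    [exact: nbhs_right_gt|exact: nbhs_right_lt].
have near1 : \forall t \near (1:R)^'-, `]0, 1[%classic t.
  by near=> t; rewrite /= in_itv/=; apply/andP; split; near: t;
    [exact: nbhs_left_gt|exact: nbhs_left_lt].
have e0 := affine_line_escapes af lg lg' (at_right_proper_filter _) near0 (cvg_at_right_filter (@cvg_id _ _)) g0 nx0.
have e1 := affine_line_escapes af lg lg' (at_left_proper_filter _) near1 (cvg_at_left_filter (@cvg_id _ _)) g1 nx1.
move: e1; rewrite -e0 scale0r scale1r addr0 => /torus_piP.
have e k : (z' + A *m delta_mx j 0) k 0 - z' k 0 = A k j.
  by rewrite -colE !mxE addrAC subrr add0r.
by rewrite !e; case: (ord2P i) => -> [].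
Unshelve. all: by end_near. Qed.

Lemma veech_group_subgroup : subgroup_of_SL2Z (veech_group O).
Proof.
have inv A : veech_group O A -> veech_group O (invmx A).
  move=> [dA [f af]]; split; first by rewrite det_inv invr_gt0.
  by have [g ag _] := affine_inv af; exists g.
have intA A : veech_group O A -> exists B, A = intmx R B.
  move=> [_ [f af]]; exists (\matrix_(i, j) Num.floor (A i j)).
  apply/matrixP => i j; rewrite !mxE; apply/eqP.
  by rewrite eq_sym -intrEfloor; exact: affine_int af.
split=> //.
(* Both [A] and its inverse are integral, so the integer determinant divides 1, and it is
   positive. *)
- move=> A GA; have [B AB] := intA A GA; have [B' AB'] := intA _ (inv _ GA).
  exists B => //; have [dA [f [uA _ _]]] := GA.
  have dB : 0 < \det B by move: dA; rewrite AB /intmx det_map_mx ltr0z.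
  have : \det B * \det B' = 1.
    apply: (@intr_inj R); rewrite intrM -!(det_map_mx intr) -/(intmx R B).
    by rewrite -/(intmx R B') -AB -AB' -det_mulmx mulmxV// det1.
  move=> BB'; have : (\det B %| 1)%Z.
    by apply/dvdzP; exists (\det B'); rewrite mulrC.
  by rewrite dvdz1 => /eqP; rewrite /SL2Z/= -{2}(gtz0_abs dB) => ->.
- split; first by rewrite det1.
  by exists id; exact: affine_id.
- move=> A B [dA [f af]] [dB [g ag]]; split; first by rewrite det_mulmx mulr_gt0.
  by exists (f \o g); exact: affine_comp.
Qed.

Lemma lifts_line_eq gamma gamma' J z u : {in J, gamma =1 gamma'} ->
  lifts_line gamma J z u -> lifts_line gamma' J z u.
Proof.
move=> e [cg h]; split; first exact: (subspace_eq_continuous e).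
by move=> t Jt; rewrite -e ?inE//; exact: h.
Qed.

Lemma lifts_line_sub gamma (J J' : set R) z u : J' `<=` J ->
  lifts_line gamma J z u -> lifts_line gamma J' z u.
Proof.
by move=> sub [cg h]; split; [exact: continuous_subspaceW cg|move=> t /sub/h].
Qed.

Lemma lifts_lineU gamma (J J' : set R) z u : closed J -> closed J' ->
  lifts_line gamma J z u -> lifts_line gamma J' z u ->
  lifts_line gamma (J `|` J') z u.
Proof.
move=> cJ cJ' [cg h] [cg' h']; split; first exact: withinU_continuous.
by move=> t [/h|/h'].
Qed.

Lemma lifts_line_translate gamma (J : set R) z u s : lifts_line gamma J z u ->
  lifts_line (fun t => gamma (t - s)) [set t | J (t - s)] (z - s *: u) u.
Proof.
move=> [/subspace_continuousP cg h]; split.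
  apply/subspace_continuousP => t Jt.
  apply: (cvg_comp (fun t => t - s) gamma _ (cg _ Jt)) => W.
  rewrite /within/= => HW.
  have c : (t' - s) @[t' --> t] --> t - s by apply: cvgB; [exact: cvg_id|exact: cvg_cst].
  exact: (c _ HW).
move=> t /h[pt ->]; split=> //; congr torus_pi.
by rewrite scalerBl addrA addrAC.
Qed.

(** A relation and not a map, because a trajectory that runs into a vertex has no continuation. Time
    is measured in units of [u], so a closed geodesic of holonomy [u] is a point that returns at
    time 1. *)
Definition flow (u : 'cV[R]_2) (s : R) (x y : O) : Prop :=
  exists gamma z, [/\ lifts_line gamma `[0, s] z u, gamma 0 = x & gamma s = y].

Lemma flow_trans u (s s' : R) x y w : 0 <= s -> 0 <= s' ->
  flow u s x y -> flow u s' y w -> flow u (s + s') x w.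
Proof.
move=> s0 s0' [g [z [lg g0 gs]]] [g' [z' [lg' g0' gs']]].
pose G t := if t <= s then g t else g' (t - s).
exists G, z; split; first last.
- rewrite /G; have [le|_] := boolP (s + s' <= s); last by rewrite addrAC subrr add0r.
  have s'0 : s' = 0 by lra.
  by rewrite s'0 addr0 gs -gs' s'0.
- by rewrite /G s0.
have l1 : lifts_line G `[0, s] z u.
  apply: lifts_line_eq lg => t; rewrite inE/= in_itv/= => /andP[_ ts].
  by rewrite /G ts.
(* The base points of the two pieces need to be compatible only modulo the lattice; evaluation at
   the common point shows that they are. *)
have l2 : lifts_line G `[s, s + s'] z u.
  have zz : torus_pi (z' - s *: u) = torus_pi z.
    rewrite -[z](addrK (s *: u)); apply/torus_piD.
    have : `[0, s]%classic s by rewrite /= in_itv/= s0 lexx.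
    move=> /(lg.2)[_ <-]; have : `[0, s']%classic (0 : R) by rewrite /= in_itv/= s0' lexx.
    by move=> /(lg'.2)[_ ]; rewrite scale0r addr0 g0' gs => <-.
  apply: (lifts_line_shift zz).
  have sub : `[s, s + s']%classic `<=` [set t | `[0, s']%classic (t - s)].
    by move=> t; rewrite /= !in_itv/=; lra.
  apply: lifts_line_eq (lifts_line_sub sub (lifts_line_translate s lg')) => t.
  rewrite inE/= in_itv/= => /andP[st _]; rewrite /G.
  case: (leP t s) => // ts; have -> : t = s by lra.
  by rewrite subrr g0' gs.
have cl (a b : R) : closed `[a, b]%classic by exact: interval_closed.
have := lifts_lineU (cl 0 s) (cl s (s + s')) l1 l2.
apply: lifts_line_sub => t; rewrite /= !in_itv/=.
by have [|] := leP t s; [left|right]; lra.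
Qed.

Lemma flow_split u (s s' : R) x y : 0 <= s <= s' -> flow u s' x y ->
  exists2 w, flow u s x w & flow u (s' - s) w y.
Proof.
move=> ss' [g [z [lg g0 gs]]]; exists (g s).
  exists g, z; split=> //; apply: lifts_line_sub lg => t.
  by rewrite /= !in_itv/=; lra.
exists (fun t => g (t - - s)), (z - (- s) *: u); split.
- have := lifts_line_translate (- s) lg; apply: lifts_line_sub => t.
  by rewrite /= !in_itv/=; lra.
- by rewrite opprK add0r.
- by rewrite opprK subrK.
Qed.

Lemma flow_end u (s : R) x y z : 0 <= s -> flow u s x y -> torus_pi z = p x ->
  [/\ pX x, pX y & p y = torus_pi (z + s *: u)].
Proof.
move=> s0 [g [z' [[_ h] <- <-]]] zx.
have [|p0 e0] := h 0; first by rewrite /= in_itv/= s0 lexx.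
have [|p1 e1] := h s; first by rewrite /= in_itv/= s0 lexx.
split=> //; rewrite e1; apply/torus_piD.
by rewrite zx e0 scale0r addr0.
Qed.

Lemma flow_unique u (s : R) x y y' : 0 <= s -> flow u s x y -> flow u s x y' -> y = y'.
Proof.
move=> s0 [g [z [lg g0 gs]]] [g' [z' [lg' g0' gs']]].
have J0 : `[0, s]%classic (0 : R) by rewrite /= in_itv/= s0 lexx.
have Js : `[0, s]%classic (s : R) by rewrite /= in_itv/= s0 lexx.
have zz : torus_pi z' = torus_pi z.
  have [_ e] := lg.2 _ J0; have [_ e'] := lg'.2 _ J0.
  by rewrite -[z]addr0 -[z']addr0 -(scale0r u) -e -e' g0 g0'.
rewrite -gs -gs'.
apply: (lifts_line_unique (@itv_connected R _) J0 lg (lifts_line_shift zz lg')) => //.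
by rewrite g0 g0'.
Qed.

Lemma flow_affine (f : O -> O) A u (s : R) x y : 0 <= s -> affine_diffeo f A ->
  flow u s x y -> flow (A *m u) s (f x) (f y).
Proof.
move=> s0 af [g [z [lg g0 gs]]].
have J0 : `[0, s]%classic (0 : R) by rewrite /= in_itv/= s0 lexx.
have [z' lg'] := affine_lifts_line af (@itv_connected R _) J0 lg.
by exists (f \o g), z'; rewrite /= g0 gs.
Qed.

(** Allows a closed geodesic to be started at any of its points, later at a crossing with a vertical
    edge. *)
Lemma closed_flow_rotate u (s : R) x : 0 <= s <= 1 -> flow u 1 x x ->
  exists2 w, flow u s x w & flow u 1 w w.
Proof.
move=> s01 fx; have [w xw wx] := flow_split s01 fx.
exists w => //; rewrite -[1](subrK s); apply: flow_trans wx xw; lra.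
Qed.

End TranslationCharts.

(** * Surfaces tiled by squares *)

Lemma closed_cover_continuous (T S : topologicalType) (I : finType)
    (C : I -> set T) (g : I -> T -> S) (f : T -> S) :
  (forall i, closed (C i)) -> (forall i, continuous (g i)) ->
  (forall i x, C i x -> f x = g i x) -> (forall x, exists i, C i x) ->
  continuous f.
Proof.
move=> clC cg fg cover x U fxU.
have loc i : \forall y \near x, C i y -> U (f y).
  have [Cx|nCx] := pselect (C i x).
    have : \forall y \near x, U (g i y) by apply: cg; rewrite -fg.
    by apply: filterS => y Uy Cy; rewrite (fg i).
  have : \forall y \near x, ~ C i y.
    by apply: open_nbhs_nbhs; split=> //; exact: closed_openC.
  by apply: filterS => y nCy Cy.
have : \forall y \near x, forall i, C i y -> U (f y) by exact: filter_forall.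
by rewrite nbhs_simpl; apply: filterS => y h; have [i /h] := cover y.
Qed.

Section Clamp.
Variable R : realType.

(** The retraction onto the unit interval extends the maps on a square to the whole plane, so that
    continuity and openness are never relative to a subspace. *)
Definition clampR (x : R) : R := Num.min 1 (Num.max 0 x).

Lemma clampR_itv x : 0 <= clampR x <= 1.
Proof. by rewrite /clampR minEle maxEle; case: (leP 0 x) => ?; case: (leP 1 _) => ?; lra. Qed.

Lemma clampR_id x : 0 <= x <= 1 -> clampR x = x.
Proof. move=> ?; by rewrite /clampR minEle maxEle; case: (leP 0 x) => ?; case: (leP 1 _) => ?; lra. Qed.

Lemma clampR0 : clampR 0 = 0. Proof. by rewrite clampR_id// lexx ler01. Qed.
Lemma clampR1 : clampR 1 = 1. Proof. by rewrite clampR_id// lexx ler01. Qed.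

Lemma clampR_continuous : continuous clampR.
Proof.
move=> x; apply: continuous_min; first exact: cvg_cst.
by apply: continuous_max; [exact: cvg_cst|exact: cvg_id].
Qed.

Definition clamp (z : 'cV[R]_2) : 'cV[R]_2 :=
  vec (clampR (z 0 0)) (clampR (z 1 0)).

Lemma clampE z i : clamp z i 0 = clampR (z i 0).
Proof. by case: (ord2P i) => ->; rewrite vecE. Qed.

Lemma clamp_itv z i : 0 <= clamp z i 0 <= 1.
Proof. by rewrite clampE clampR_itv. Qed.

Lemma clamp_id (z : 'cV[R]_2) : (forall i, 0 <= z i 0 <= 1) -> clamp z = z.
Proof. by move=> h; apply: eq_vec; rewrite clampE clampR_id. Qed.

Lemma clamp_continuous : continuous clamp.
Proof.
move=> z; apply: (cvg_vec (G := nbhs z)).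
- apply: (@continuous_comp _ _ _ (fun u : 'cV[R]_2 => u 0 0) clampR).
    exact: coord_continuous.
  exact: clampR_continuous.
- apply: (@continuous_comp _ _ _ (fun u : 'cV[R]_2 => u 1 0) clampR).
    exact: coord_continuous.
  exact: clampR_continuous.
Qed.

End Clamp.

Section Tiles.
Variables (d : nat) (h v : {perm 'I_d}).

(* The corners of the squares, numbered counterclockwise from the lower left
   one; [next_corner] turns counterclockwise around the vertex carrying a
   corner. *)
Definition next_corner (k : 'I_d * 'I_4) : 'I_d * 'I_4 :=
  (match val k.2 with
   | 0 => (h^-1)%g k.1 | 1 => (v^-1)%g k.1 | 2 => h k.1 | _ => v k.1 end,
   inord (k.2.+1 %% 4)).

(** [pick] depends only on the set of squares whose lower left corner is the given vertex, so
    equality of vertices becomes equality of representatives. *)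
Definition vertex_rep (i : 'I_d) : 'I_d :=
  odflt i [pick j | fconnect next_corner (i, ord0) (j, ord0)].

Lemma next_corner0 i : next_corner (i, inord 0) = ((h^-1)%g i, inord 1).
Proof. by rewrite /next_corner /= inordK. Qed.
Lemma next_corner1 i : next_corner (i, inord 1) = ((v^-1)%g i, inord 2).
Proof. by rewrite /next_corner /= inordK. Qed.
Lemma next_corner2 i : next_corner (i, inord 2) = (h i, inord 3).
Proof. by rewrite /next_corner /= inordK. Qed.
Lemma next_corner3 i : next_corner (i, inord 3) = (v i, inord 0).
Proof. by rewrite /next_corner /= inordK. Qed.
Definition next_cornerE :=
  (next_corner0, next_corner1, next_corner2, next_corner3).

Lemma ord4P (r : 'I_4) :
  [\/ r = inord 0, r = inord 1, r = inord 2 | r = inord 3].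
Proof.
case: r => [[|[|[|[|//]]]] i]; [apply: Or41|apply: Or42|apply: Or43|apply: Or44];
  by apply: val_inj; rewrite /= inordK.
Qed.

Lemma next_corner_inj : injective next_corner.
Proof.
move=> [i r] [j s]; case: (ord4P r) => ->; case: (ord4P s) => ->;
  rewrite !next_cornerE => e; have := congr1 (fun k => val k.2) e;
  rewrite /= !inordK// => _; by have /= /perm_inj -> := congr1 fst e.
Qed.

Lemma ord0_inord : ord0 = inord 0 :> 'I_4.
Proof. by apply: val_inj; rewrite /= inordK. Qed.

Lemma iter_next_corner2 n k : (iter n next_corner k).2 = ((k.2 + n) %% 4)%N :> nat.
Proof.
elim: n => [|n IHn]; first by rewrite addn0 modn_small.
by rewrite iterS /next_corner /= inordK ?ltn_mod// IHn -addn1 modnDml addn1 addnS.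
Qed.

Lemma vertex_connect_sym : connect_sym (frel next_corner).
Proof. exact/fconnect_sym/next_corner_inj. Qed.

Lemma vertex_rep_connect i : fconnect next_corner (i, ord0) (vertex_rep i, ord0).
Proof. by rewrite /vertex_rep; case: pickP => [j|_] //=; exact: connect0. Qed.

Lemma vertex_repP i j :
  vertex_rep i = vertex_rep j <-> fconnect next_corner (i, ord0) (j, ord0).
Proof.
split=> [e|ij].
  apply: connect_trans (vertex_rep_connect i) _; rewrite e.
  by rewrite vertex_connect_sym; exact: vertex_rep_connect.
rewrite /vertex_rep; have same k : fconnect next_corner (i, ord0) (k, ord0) =
    fconnect next_corner (j, ord0) (k, ord0).
  exact: (same_connect vertex_connect_sym ij).
rewrite (eq_pick same); case: pickP => // /(_ j).
by rewrite connect0.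
Qed.

Lemma vertex_rep_id i : vertex_rep (vertex_rep i) = vertex_rep i.
Proof. by apply/vertex_repP; rewrite vertex_connect_sym; exact: vertex_rep_connect. Qed.

(** Four quarter turns around a vertex amount to the commutator of [h] and [v], whose cycles are
    therefore the vertices. *)
Lemma vertex_rep_comm i : vertex_rep (h (v i)) = vertex_rep (v (h i)).
Proof.
apply/vertex_repP; rewrite ord0_inord.
have -> : (v (h i), inord 0) = iter 4 next_corner (h (v i), inord 0).
  by rewrite /= !next_cornerE !permK.
exact: fconnect_iter.
Qed.

End Tiles.

Section TiledSurface.
Variables (R : realType) (d : nat) (h v : {perm 'I_d}).

(** Normal form of a point: a coordinate 1 is traded for 0 in the adjacent square, the top side
    being crossed before the right one, and at a vertex the square is replaced by its
    representative. The order of crossing matters only at the upper right corner, where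
    [vertex_rep_comm] reconciles the two. *)
Definition tile_code (a : 'I_d * 'cV[R]_2) : 'I_d * 'cV[R]_2 :=
  let z := clamp a.2 in
  let x := if z 0 0 == 1 then 0 else z 0 0 in
  let y := if z 1 0 == 1 then 0 else z 1 0 in
  let i := if z 1 0 == 1 then v a.1 else a.1 in
  let j := if z 0 0 == 1 then h i else i in
  (if (x == 0) && (y == 0) then vertex_rep h v j else j, vec x y).

Lemma tile_code_itv a i : 0 <= (tile_code a).2 i 0 < 1.
Proof.
by case: (ord2P i) => ->; rewrite vecE; case: eqP => [|/eqP] e; rewrite ?lexx ?ltr01//;
  have := clamp_itv a.2 0; have := clamp_itv a.2 1; move: e; rewrite neq_lt; lra.
Qed.

Lemma tile_code_id a : tile_code (tile_code a) == tile_code a.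
Proof.
have h0 := tile_code_itv a 0; have h1 := tile_code_itv a 1.
have n0 : (tile_code a).2 0 0 == 1 = false by apply/negP => /eqP e; move: h0; rewrite e; lra.
have n1 : (tile_code a).2 1 0 == 1 = false by apply/negP => /eqP e; move: h1; rewrite e; lra.
apply/eqP; rewrite {1}/tile_code clamp_id; last first.
  by apply: forall_ord2; lra.
rewrite n0 n1 vec_eta; case e : (tile_code a) => [i z] /=.
congr pair; case: ifP => // /andP[/eqP z0 /eqP z1].
have ez : (tile_code a).2 = z by rewrite e.
have -> : i = (tile_code a).1 by rewrite e.
rewrite -ez vec0 in z0; rewrite -ez vec1 in z1; rewrite /tile_code z0 z1 eqxx /=.
exact: vertex_rep_id.
Qed.

(** The quotient of the squares by the gluing, realised as the fixed points of the idempotent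
    [tile_code]. *)
Definition tiled : Type := {a : 'I_d * 'cV[R]_2 | tile_code a == a}.

HB.instance Definition _ := Choice.on tiled.

Definition tile (i : 'I_d) (z : 'cV[R]_2) : tiled :=
  exist _ (tile_code (i, z)) (tile_code_id (i, z)).

(** The quotient topology: the final one for the maps [tile i], each defined on the whole plane. *)
Definition tiled_open (U : set tiled) : Prop :=
  forall i, open [set z | U (tile i z)].

Lemma tiled_openT : tiled_open setT.
Proof. by move=> i; exact: openT. Qed.

Lemma tiled_openI : setI_closed tiled_open.
Proof. by move=> U W oU oW i; apply: openI; [exact: oU|exact: oW]. Qed.

Lemma tiled_open_bigU (I : Type) (f : I -> set tiled) :
  (forall i, tiled_open (f i)) -> tiled_open (\bigcup_i f i).
Proof.
move=> oU i; rewrite [X in open X](_ : _ = \bigcup_k [set z | f k (tile i z)]).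
  by apply: bigcup_open => k _; exact: oU.
by apply/seteqP; split=> z [k _ fk]; exists k.
Qed.

HB.instance Definition _ :=
  isOpenTopological.Build tiled tiled_openT tiled_openI tiled_open_bigU.

End TiledSurface.

Section TiledTopology.
Variables (R : realType) (d : nat) (h v : {perm 'I_d}).
Local Notation X := (tiled R h v).
Local Notation T := (tile h v).
Local Notation rep := (vertex_rep h v).

Definition half_open (z : 'cV[R]_2) := forall k, 0 <= z k 0 < 1.

Lemma half_open_cube z : half_open z -> closed_cube z.
Proof. by move=> hz k; have := hz k; lra. Qed.

Lemma tile_eqP i j (z w : 'cV[R]_2) :
  T i z = T j w <-> tile_code h v (i, z) = tile_code h v (j, w).
Proof. by split=> [/(congr1 val)|e] //; exact: val_inj. Qed.

Lemma tile_clamp i (z : 'cV[R]_2) : T i (clamp z) = T i z.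
Proof.
apply/tile_eqP; rewrite /tile_code /= [clamp (clamp z)]clamp_id//.
by move=> k; exact: clamp_itv.
Qed.

Lemma tile_half i (z : 'cV[R]_2) : half_open z ->
  val (T i z) = (if z == 0 then rep i else i, z).
Proof.
move=> hz; rewrite /= /tile_code clamp_id/=; last exact: half_open_cube.
have n1 k : (z k 0 == 1) = false by apply/negP => /eqP e; have := hz k; rewrite e; lra.
rewrite !n1 vec_eta; congr (if _ then _ else _, _).
apply/andP/eqP => [[/eqP z0 /eqP z1]|->]; last by rewrite !mxE.
by apply: eq_vec; rewrite !mxE.
Qed.

Lemma tile_half_eq i j (z w : 'cV[R]_2) : half_open z -> half_open w ->
  T i z = T j w -> [/\ z = w, z != 0 -> i = j & rep i = rep j].
Proof.
move=> hz hw /(congr1 val); rewrite !tile_half// => -[/[swap] <-].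
by case: eqP => [_|_] ->.
Qed.

Lemma tile_vertex i j : rep i = rep j -> T i (0 : 'cV[R]_2) = T j 0.
Proof.
have h0 : half_open 0 by move=> k; rewrite mxE; lra.
by move=> e; apply: val_inj; rewrite !tile_half// eqxx e.
Qed.

Lemma tile_surj (x : X) : exists i z, half_open z /\ x = T i z.
Proof.
case: x => -[i z] /= e; exists i, z; split; last first.
  by apply: val_inj => /=; exact/esym/eqP.
by move=> k; have := tile_code_itv h v (i, z) k; rewrite (eqP e).
Qed.

Lemma tile_glue0 i (z : 'cV[R]_2) :
  z 0 0 = 1 -> T i z = T (h i) (z - delta_mx 0 0).
Proof.
move=> z0; apply/tile_eqP; rewrite /tile_code !clampE !mxE z0 /= subrr subr0.
rewrite clampR0 clampR1.
rewrite eqxx eqxx /= [0 == 1]eq_sym oner_eq0 eqxx /=.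
(* At the upper right corner the two sides yield [h (v i)] and [v (h i)], which agree only up to
   [vertex_rep]. *)
by case: (clampR (z 1 0) == 1); rewrite ?eqxx ?vertex_rep_comm.
Qed.

Lemma tile_glue1 i (z : 'cV[R]_2) :
  z 1 0 = 1 -> T i z = T (v i) (z - delta_mx 1 0).
Proof.
move=> z0; apply/tile_eqP; rewrite /tile_code !clampE !mxE z0 /= subrr subr0.
rewrite clampR0 clampR1.
by rewrite eqxx [0 == 1]eq_sym oner_eq0 /=.
Qed.

Lemma tiled_openP (U : set X) : open U <-> forall i, open [set z | U (T i z)].
Proof. by []. Qed.

Lemma tile_continuous i : continuous (T i : 'cV[R]_2 -> X).
Proof. by apply/continuousP => U /tiled_openP; exact. Qed.

Lemma tiled_continuousP (Y : topologicalType) (f : X -> Y) :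
  (forall i, continuous (f \o T i)) -> continuous f.
Proof.
move=> cf; apply/continuousP => U oU; apply/tiled_openP => i.
by have /continuousP /(_ U oU) := cf i.
Qed.

Lemma closed_cube_compact : compact (@closed_cube R 2).
Proof.
pose f (t : R * R) := vec t.1 t.2.
have cf : continuous f.
  by move=> t; apply: (cvg_vec (G := nbhs t)); [exact: cvg_fst|exact: cvg_snd].
rewrite (_ : @closed_cube R 2 = f @` (`[0, 1]%classic `*` `[0, 1]%classic)).
  apply: continuous_compact; first exact: continuous_subspaceT.
  by apply: compact_setX; exact: segment_compact.
apply/seteqP; split=> [z hz|_ [t [h0 h1] <-]]; last first.
  by rewrite /= !in_itv/= in h0 h1; apply: forall_ord2; rewrite /f vecE.
exists (z 0 0, z 1 0); last exact: vec_eta.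
by split; rewrite /= in_itv/=; exact: hz.
Qed.

Lemma tiled_compact : compact [set: X].
Proof.
rewrite (_ : [set: X] = \big[setU/set0]_(i : 'I_d) (T i @` @closed_cube R 2)).
  elim/big_ind: _ => [|U W|i _]; [exact: compact0|exact: compactU|].
  apply: continuous_compact; last exact: closed_cube_compact.
  exact/continuous_subspaceT/tile_continuous.
apply/seteqP; split=> // x _; have [i [z [hz ->]]] := tile_surj x.
rewrite (bigD1 i)//=; left; exists z => //; exact: half_open_cube.
Qed.

Definition tiled_map (x : X) : torus R := torus_pi (val x).2.

Lemma tiled_mapE i z : tiled_map (T i z) = torus_pi (clamp z).
Proof.
rewrite /tiled_map /= /tile_code /=; apply/torus_piP; rewrite !vecE.
by split; case: eqP => [->|_]; rewrite ?subrr ?sub0r ?rpredN ?rpred0 ?rpred1.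
Qed.

Lemma tiled_map_cube i z : closed_cube z -> tiled_map (T i z) = torus_pi z.
Proof. by move=> hz; rewrite tiled_mapE clamp_id. Qed.

Lemma tiled_map_continuous : continuous tiled_map.
Proof.
apply: tiled_continuousP => i.
rewrite (_ : _ \o _ = @torus_pi R \o @clamp R); last first.
  by apply/funext => z; exact: tiled_mapE.
move=> z; apply: continuous_comp; first exact: clamp_continuous.
exact: torus_pi_continuous.
Qed.

(** A set that is open and closed contains all or nothing of each square, by connectedness of
    segments, so the squares in it form a set invariant under [h] and [v]. *)
Lemma tiled_connected :
  (forall P : 'I_d -> Prop, (forall i, P i <-> P (h i)) ->
     (forall i, P i <-> P (v i)) -> forall i j, P i -> P j) ->
  connected [set: X].
Proof.
move=> trans E [x Ex] [U oU EU] [C cC EC]; rewrite setTI in EU; rewrite setTI in EC.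
have oE : open E by rewrite EU.
have oNE : open (~` E) by rewrite EC; exact: closed_openC.
have same i z w : E (T i z) -> E (T i w).
  pose P t := E (T i (z + t *: (w - z))).
  have J0 : `[0, 1]%classic (0 : R) by rewrite /= in_itv/= lexx ler01.
  have J1 : `[0, 1]%classic (1 : R) by rewrite /= in_itv/= lexx ler01.
  have cP (W : set X) t : open W -> W (T i (z + t *: (w - z))) ->
      \forall s \near t, W (T i (z + s *: (w - z))).
    have c : z + s *: (w - z) @[s --> t] --> z + t *: (w - z).
      by apply: line_cvg; exact: cvg_id.
    move=> oW Wt; apply: (c [set u | W (T i u)]).
    by apply: open_nbhs_nbhs; split => //; move/tiled_openP : oW; exact.
  suff : P 0 -> P 1 by rewrite /P scale0r addr0 scale1r addrC subrK.
  apply: (connected_locally_constant (@itv_connected R `[0, 1]) _ J0 J1) => t _.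
  have [Et|nEt] := pselect (P t).
    by apply: filterS (cP _ _ oE Et) => s Ps _; split.
  by apply: filterS (cP _ _ oNE nEt) => s nPs _; split=> // /nPs.
have glue0 i : E (T i 0) <-> E (T (h i) 0).
  have e : T i (delta_mx 0 0 : 'cV[R]_2) = T (h i) 0.
    by rewrite tile_glue0 ?subrr// mxE.
  by split=> [/same|]; [rewrite -e; exact|rewrite -e; exact: same].
have glue1 i : E (T i 0) <-> E (T (v i) 0).
  have e : T i (delta_mx 1 0 : 'cV[R]_2) = T (v i) 0.
    by rewrite tile_glue1 ?subrr// mxE.
  by split=> [/same|]; [rewrite -e; exact|rewrite -e; exact: same].
apply/seteqP; split=> // y _.
have [i [z [_ xz]]] := tile_surj x; have [j [w [_ ->]]] := tile_surj y.
apply: (same j 0); apply: (trans (fun i => E (T i 0)) glue0 glue1 i).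
by apply: (same _ z); rewrite -xz.
Qed.

End TiledTopology.

(** * The covering of the punctured torus *)

Lemma homeomorphism_eq (X Y : topologicalType) (A : set X) (B : set Y)
    (f g : X -> Y) :
  {in A, f =1 g} -> homeomorphism_between A B f -> homeomorphism_between A B g.
Proof.
move=> fg [f' [[fAB fBA f'f ff'] [cf cf']]]; exists f'; split; split=> //.
- by move=> x Ax; rewrite -fg ?inE//; exact: fAB.
- by move=> x Ax; rewrite -fg ?inE//; exact: f'f.
- by move=> y By; rewrite -fg ?inE ?ff'//; exact: fBA.
- exact: (subspace_eq_continuous fg).
Qed.

Lemma open_embedding_homeomorphism (R : realType) (Y : topologicalType)
    (V : set 'cV[R]_2) (s : 'cV[R]_2 -> Y) :
  continuous s -> (forall z w, V z -> V w -> s z = s w -> z = w) ->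
  (forall W, open W -> W `<=` V -> open (s @` W)) -> open V ->
  homeomorphism_between V (s @` V) s.
Proof.
move=> cs injs os oV; pose g y := xget 0 [set z | V z /\ s z = y].
have gs z : V z -> g (s z) = z.
  by move=> Vz; rewrite /g; case: xgetP => [w _ [Vw /injs->]//|/(_ z)]; case.
exists g; split; split.
- by move=> z Vz; exists z.
- by move=> _ [z Vz <-]; rewrite gs.
- exact: gs.
- by move=> _ [z Vz <-]; rewrite gs.
- exact: continuous_subspaceT.
- rewrite continuous_open_subspace; last exact: os.
  move=> _ /set_mem[z Vz <-] N; rewrite gs// => /nbhs_interior Nz.
  rewrite nbhs_simpl/=.
  have : open (s @` (N° `&` V)).
    by apply: os; [apply: openI => //; exact: open_interior|move=> ? []].
  move=> oN; apply: (filterS _ (open_nbhs_nbhs (conj oN _))).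
    by move=> _ [w [Nw Vw] <-] /=; rewrite gs//; exact: interior_subset.
  by exists z => //; split => //; exact: nbhs_singleton.
Qed.

Lemma open_embedding_chart (R : realType) (Y : topologicalType)
    (V : set 'cV[R]_2) (s : 'cV[R]_2 -> Y) :
  continuous s -> (forall z w, V z -> V w -> s z = s w -> z = w) ->
  (forall W, open W -> W `<=` V -> open (s @` W)) -> open V ->
  exists2 phi, is_chart (s @` V, phi) & forall z, V z -> phi (s z) = z.
Proof.
move=> cs injs os oV.
have [phi hphi [phis _]] := homeomorphism_sym
  (open_embedding_homeomorphism cs injs os oV).
exists phi => //; have e : phi @` (s @` V) = V.
  apply/seteqP; split=> [_ [_ [z Vz <-] <-]|z Vz]; first by rewrite phis.
  by exists (s z); [exists z|exact: phis].
by split; rewrite /= ?e//; exact: os.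
Qed.

Lemma box_open (R : realType) (U : 'I_2 -> set R) :
  (forall k, open (U k)) -> open [set z : 'cV[R]_2 | forall k, U k (z k 0)].
Proof.
move=> oU; have o k : open [set z : 'cV[R]_2 | U k (z k 0)].
  apply: (@open_comp _ _ (fun z : 'cV[R]_2 => z k 0)); last exact: oU.
  by move=> z _; exact: coord_continuous.
have -> : [set z : 'cV[R]_2 | forall k, U k (z k 0)] =
    [set z | U 0 (z 0 0)] `&` [set z | U 1 (z 1 0)].
  by apply/seteqP; split=> z /=; [split|move=> [? ?]; exact: forall_ord2].
exact: (openI (o 0) (o 1)).
Qed.

Section Strips.
Variables (R : realType) (d : nat) (h v : {perm 'I_d}).
Variables (e : 'I_2) (s : {perm 'I_d}).
Local Notation X := (tiled R h v).
Local Notation T := (tile h v).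
Local Notation eb := (delta_mx e 0 : 'cV[R]_2).
Hypothesis glue : forall i (z : 'cV[R]_2), z e 0 = 1 -> T i z = T (s i) (z - eb).

Implicit Types z w : 'cV[R]_2.

(* Three consecutive squares of the strip through the square [i]. *)
Definition strip (i : 'I_d) (z : 'cV[R]_2) : X :=
  if z e 0 < 0 then T ((s^-1)%g i) (z + eb)
  else if z e 0 < 1 then T i z else T (s i) (z - eb).

Definition strip_dom : set 'cV[R]_2 :=
  [set z | -1 < z e 0 < 2 /\ forall k, k != e -> 0 < z k 0 < 1].

Lemma eb_e : eb e 0 = 1. Proof. by rewrite mxE !eqxx. Qed.

Lemma eb_ne k : k != e -> eb k 0 = 0.
Proof. by move=> ke; rewrite mxE (negbTE ke). Qed.

Lemma addeb z k : (z + eb) k 0 = if k == e then z k 0 + 1 else z k 0.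
Proof.
by rewrite mxE; case: eqVneq => [->|ke]; rewrite ?eb_e// eb_ne ?addr0.
Qed.

Lemma subeb z k : (z - eb) k 0 = if k == e then z k 0 - 1 else z k 0.
Proof.
rewrite [LHS]mxE [X in _ + X]mxE.
by case: eqVneq => [->|ke]; rewrite ?eb_e// eb_ne ?subr0.
Qed.

Lemma strip_le0 i z : z e 0 <= 0 -> strip i z = T ((s^-1)%g i) (z + eb).
Proof.
rewrite /strip le_eqVlt => /orP[/eqP z0|->//]; rewrite z0 ltxx ltr01.
rewrite [RHS]glue; last by rewrite mxE z0 add0r eb_e.
by rewrite permKV addrK.
Qed.

Lemma strip_mid i z : 0 <= z e 0 <= 1 -> strip i z = T i z.
Proof.
move=> /andP[z0 z1]; rewrite /strip ltNge z0 /=; case: ltP => // z1'.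
by rewrite -glue//; apply/eqP; rewrite eq_le z1 z1'.
Qed.

Lemma strip_ge1 i z : 1 <= z e 0 -> strip i z = T (s i) (z - eb).
Proof. by move=> z1; rewrite /strip !ltNge z1 (le_trans _ z1). Qed.

Lemma strip_continuous i : continuous (strip i).
Proof.
pose C (k : 'I_3) : set 'cV[R]_2 :=
  if k == 0 then [set z | z e 0 <= 0] else
  if k == 1 then [set z | 0 <= z e 0 <= 1] else [set z | 1 <= z e 0].
pose g (k : 'I_3) : 'cV[R]_2 -> X :=
  if k == 0 then fun z => T ((s^-1)%g i) (z - - eb) else
  if k == 1 then T i else fun z => T (s i) (z - eb).
have ccoord : continuous (fun z : 'cV[R]_2 => z e 0).
  by move=> z; exact: coord_continuous.
have cge (a : R) : closed [set z : 'cV[R]_2 | a <= z e 0].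
  by move/continuous_closedP : ccoord => /(_ _ (@closed_ge R a)).
have cle (a : R) : closed [set z : 'cV[R]_2 | z e 0 <= a].
  by move/continuous_closedP : ccoord => /(_ _ (@closed_le R a)).
have ctile j (l : 'cV[R]_2) : continuous (fun z => T j (z - l)).
  move=> z; apply: continuous_comp; [exact: continuous_translate|exact: tile_continuous].
apply: (@closed_cover_continuous _ _ _ C g).
- move=> k; rewrite /C; case: ifP => _; first exact: cle.
  case: ifP => _; last exact: cge.
  rewrite (_ : [set _ | _] = [set z | 0 <= z e 0] `&` [set z | z e 0 <= 1]).
    exact: (closedI (cge 0) (cle 1)).
  by apply/seteqP; split=> z /=; [move=> /andP|move=> [-> ->]].
- move=> k; rewrite /g; case: ifP => _; first exact: ctile.
  by case: ifP => _; [exact: tile_continuous|exact: ctile].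
- move=> k z; rewrite /C /g; case: ifP => _; first by rewrite opprK; exact: strip_le0.
  by case: ifP => _; [exact: strip_mid|exact: strip_ge1].
- move=> z; have [z0|z0] := leP (z e 0) 0; first by exists 0.
  have [z1|z1] := leP (z e 0) 1; last by exists 2; exact: ltW.
  by exists 1; rewrite /C /= ltW.
Qed.

Lemma torus_pi_eb (z : 'cV[R]_2) : torus_pi (z + eb) = torus_pi z.
Proof.
have i1 k : (z + eb) k 0 - z k 0 \is a Num.int.
  by rewrite !mxE addrAC subrr add0r; case: (_ && _); rewrite ?rpred1 ?rpred0.
by apply/torus_piP; split.
Qed.

Lemma strip_case (z : 'cV[R]_2) : strip_dom z ->
  [\/ half_open (z + eb) /\ z e 0 < 0, half_open z | half_open (z - eb) /\ 1 <= z e 0].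
Proof.
move=> [ze zk]; have [z0|z0] := ltP (z e 0) 0.
  constructor 1; split=> // k; rewrite addeb; case: eqVneq => [->|/zk]; lra.
have [z1|z1] := ltP (z e 0) 1.
  by constructor 2=> k; have [->|/zk] := eqVneq k e; lra.
by constructor 3; split=> // k; rewrite subeb; case: eqVneq => [->|/zk]; lra.
Qed.

Lemma strip_map i z : strip_dom z -> tiled_map (strip i z) = torus_pi z.
Proof.
move=> /strip_case[[hz z0]|hz|[hz z1]].
- by rewrite strip_le0 ?ltW// tiled_map_cube ?torus_pi_eb//; exact: half_open_cube.
- by rewrite strip_mid ?tiled_map_cube//; exact: (half_open_cube hz).
- rewrite strip_ge1// tiled_map_cube -?[RHS](@torus_pi_eb (z - eb)); last exact: half_open_cube.
  by rewrite -torus_pi_eb subrK.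
Qed.

Lemma strip_index_inj i j z : strip_dom z -> strip i z = strip j z -> i = j.
Proof.
move=> dz; have [_ zk] := dz.
have [k ke] : exists k, k != e by case: (ord2P e) => ->; [exists 1|exists 0].
have nz w : w k 0 = z k 0 -> w != 0.
  by move=> wz; apply/eqP => w0; have := zk k ke; rewrite -wz w0 mxE ltxx.
move/strip_case: dz => [[hz z0]|hz|[hz z1]].
- rewrite !strip_le0 ?ltW// => /(tile_half_eq hz hz)[_ + _].
  by rewrite nz ?addeb ?(negbTE ke)// => /(_ isT) /perm_inj.
- rewrite !strip_mid; try exact: (half_open_cube hz).
  by move=> /(tile_half_eq hz hz)[_ + _]; rewrite nz//; exact.
- rewrite !strip_ge1// => /(tile_half_eq hz hz)[_ + _].
  by rewrite nz ?subeb ?(negbTE ke)// => /(_ isT) /perm_inj.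
Qed.

(** The shift [w - z] is integral and too short to be anything but -1, 0 or 1 times the direction of
    the strip. Accordingly the square [a] is the first, middle or third one of a strip, and this
    strip serves for all [z'] at once. *)
Lemma strip_lift a (z w : 'cV[R]_2) : closed_cube z -> torus_pi w = torus_pi z ->
  strip_dom w -> exists j, forall z', closed_cube z' ->
    strip_dom (z' + (w - z)) -> T a z' = strip j (z' + (w - z)).
Proof.
move=> cz /torus_piP[i0 i1] dw.
have intl k : (w - z) k 0 \is a Num.int by rewrite !mxE; case: (ord2P k) => ->.
have lk k : k != e -> (w - z) k 0 = 0.
  move=> ke; apply/eqP/negPn/negP => /(norm_intr_ge1 (intl k)).
  rewrite leNgt => /negP; apply; rewrite !mxE ltr_norml.
  by have := cz k; have := dw.2 k ke; lra.
have le_ : -2 < (w - z) e 0 < 2 by rewrite !mxE; have := cz e; have := dw.1; lra.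
have lE : w - z = (w - z) e 0 *: eb.
  apply/matrixP => k l; rewrite (ord1 l) [RHS]mxE; have [->|ke] := eqVneq k e.
    by rewrite eb_e mulr1.
  by rewrite eb_ne// mulr0 lk.
have /intrP[m mE] := intl e.
have : m = -1 \/ m = 0 \/ m = 1.
  have m1 : -2 < m by rewrite -(ltr_int R) -mE mulrNz; case/andP: le_.
  have m2 : m < 2 by rewrite -(ltr_int R) -mE; case/andP: le_.
  by lia.
rewrite lE mE => -[->|[->|->]].
- exists (s a) => z' cz' _; rewrite scaleN1r strip_le0; last first.
    by rewrite subeb eqxx; have := cz' e; lra.
  by rewrite permK subrK.
- by exists a => z' cz' _; rewrite scale0r addr0 strip_mid//; exact: cz'.
- exists ((s^-1)%g a) => z' cz' _; rewrite scale1r strip_ge1.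
    by rewrite permKV addrK.
  by rewrite addeb eqxx; have := cz' e; lra.
Qed.

Lemma strip_open i W : open W -> W `<=` strip_dom -> open (strip i @` W).
Proof.
move=> oW sW; apply/tiled_openP => a; rewrite openE => z0 [w Ww wz] /=.
have dw := sW _ Ww.
have wz' : torus_pi w = torus_pi (clamp z0).
  by rewrite -(tiled_mapE h v a) -wz strip_map.
have [j hj] := strip_lift a (clamp_itv z0) wz' dw.
have cz0 : clamp z0 + (w - clamp z0) = w by rewrite addrC subrK.
have ji : j = i.
  apply: (strip_index_inj dw); rewrite wz -[in LHS]cz0 -hj ?cz0 ?tile_clamp//.
  exact: clamp_itv.
have : \forall z \near z0, W (clamp z - (clamp z0 - w)).
  apply: (@continuous_comp _ _ _ (@clamp R) (fun u => u - (clamp z0 - w))).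
  - exact: clamp_continuous.
  - exact: continuous_translate.
  by apply: open_nbhs_nbhs; split=> //=; rewrite opprB cz0.
apply: filterS => z; rewrite opprB => Wz.
exists (clamp z + (w - clamp z0)) => //.
rewrite -[in RHS]tile_clamp (hj (clamp z)) ?ji//; first exact: clamp_itv.
exact: sW.
Qed.

(** Length 1 along the strip keeps [torus_pi] injective on a patch, and three squares leave room for
    one around any half open point, on an edge as well. *)
Definition strip_patch z0 : set 'cV[R]_2 :=
  [set z | `|z e 0 - z0 e 0| < 2^-1 /\ forall k, k != e -> 0 < z k 0 < 1].

Lemma strip_patch_open z0 : open (strip_patch z0).
Proof.
pose U k : set R := if k == e then `]z0 e 0 - 2^-1, z0 e 0 + 2^-1[%classic
  else `]0, 1[%classic.
rewrite (_ : strip_patch z0 = [set z | forall k, U k (z k 0)]).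
  by apply: box_open => k; rewrite /U; case: ifP => _; exact: interval_open.
apply/seteqP; split=> z /=; rewrite /U.
  move=> [ze zk] k; case: eqVneq => [->|/zk]; rewrite /= in_itv//.
  by rewrite -ltr_distl.
move=> hU; split; first by have := hU e; rewrite eqxx /= in_itv/= -ltr_distl.
by move=> k ke; have := hU k; rewrite (negbTE ke) /= in_itv.
Qed.

Lemma strip_patch_dom z0 : half_open z0 -> strip_patch z0 `<=` strip_dom.
Proof.
by move=> h0 z [+ zk]; rewrite ltr_distl => ze; split=> //; have := h0 e; lra.
Qed.

Lemma strip_patch_center z0 : (forall k, k != e -> 0 < z0 k 0 < 1) -> strip_patch z0 z0.
Proof. by move=> zk; split=> //; rewrite subrr normr0 invr_gt0. Qed.

Lemma strip_patch_inj z0 z w : strip_patch z0 z -> strip_patch z0 w ->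
  torus_pi z = torus_pi w -> z = w.
Proof.
move=> [ze zk] [we wk] /torus_piP[i0 i1].
have key k : z k 0 = w k 0.
  have ik : z k 0 - w k 0 \is a Num.int by case: (ord2P k) => ->.
  apply/eqP; rewrite -subr_eq0; apply/negPn/negP => /(norm_intr_ge1 ik).
  rewrite leNgt => /negP; apply; rewrite ltr_norml.
  have [->|ke] := eqVneq k e; last by have := zk k ke; have := wk k ke; lra.
  by move: ze we; rewrite !ltr_norml; lra.
by apply: eq_vec.
Qed.

Lemma strip_patch_ne_infty z0 z : strip_patch z0 z -> torus_pi z <> @infty R.
Proof.
move=> [_ zk] /torus_piP[i0 i1].
have [k ke] : exists k, k != e by case: (ord2P e) => ->; [exists 1|exists 0].
have ik : z k 0 \is a Num.int.
  by move: i0 i1; rewrite !mxE !subr0; case: (ord2P k) => ->.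
have := zk k ke; have nz : z k 0 != 0 by apply/eqP => z_0; have := zk k ke; lra.
move=> /andP[z_gt0 z_lt1]; have := norm_intr_ge1 ik nz.
by rewrite gtr0_norm//; lra.
Qed.

Lemma strip_patch_homeomorphism z0 i : half_open z0 ->
  homeomorphism_between (strip_patch z0) (strip i @` strip_patch z0) (strip i).
Proof.
move=> h0; have sub := strip_patch_dom h0.
apply: open_embedding_homeomorphism.
- exact: strip_continuous.
- move=> z w zQ wQ /(congr1 (@tiled_map _ _ _ _)).
  by rewrite !strip_map; [exact: strip_patch_inj zQ wQ|exact: sub|exact: sub].
- by move=> W oW WQ; apply: strip_open => //; exact: subset_trans WQ sub.
- exact: strip_patch_open.
Qed.

Lemma strip_covering z0 : half_open z0 -> (forall k, k != e -> 0 < z0 k 0 < 1) ->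
  exists (V : set (torus R)) (U : 'I_d -> set X),
    [/\ open V, V (torus_pi z0) & V `<=` [set~ @infty R]] /\
    [/\ @tiled_map R d h v @^-1` V = \bigcup_(i in [set: 'I_d]) U i,
        trivIset [set: 'I_d] U
      & forall i, open (U i) /\ homeomorphism_between (U i) V (@tiled_map R d h v)].
Proof.
move=> h0 zk; have sub := strip_patch_dom h0.
pose Q := strip_patch z0; exists (@torus_pi R @` Q), (fun i => strip i @` Q).
have oQ : open Q by exact: strip_patch_open.
split; split.
- exact: torus_pi_open.
- by exists z0 => //; exact: strip_patch_center.
- by move=> _ [z Qz <-]; exact: strip_patch_ne_infty Qz.
- apply/seteqP; split=> [x [w Qw wx]|_ [i _ [z Qz <-]]]; last first.
    by exists z => //; rewrite strip_map//; exact: sub.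
  have [a [z [hz xz]]] := tile_surj x.
  have cz := half_open_cube hz.
  have wz : torus_pi w = torus_pi z by rewrite wx xz tiled_map_cube.
  have [j hj] := strip_lift a cz wz (sub _ Qw).
  have zw : z + (w - z) = w by rewrite addrC subrK.
  by exists j => //; exists w => //; rewrite xz (hj z)// ?zw//; exact: sub.
- move=> i j _ _ [_ [[z Qz <-] [w Qw]]] ezw.
  have wz : w = z.
    apply: (strip_patch_inj Qw Qz).
    by rewrite -(strip_map i (sub _ Qz)) -(strip_map j (sub _ Qw)) ezw.
  by move: ezw; rewrite wz => /(strip_index_inj (sub _ Qz)).
- move=> i; split; first exact: strip_open.
  (* On a sheet the covering map is [torus_pi] after the inverse of [strip i]. *)
  have [phi hphi [phis _]] := homeomorphism_sym (strip_patch_homeomorphism i h0).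
  have htorus : homeomorphism_between Q (@torus_pi R @` Q) (@torus_pi R).
    apply: open_embedding_homeomorphism => //; first exact: torus_pi_continuous.
      by move=> z w Qz Qw; exact: strip_patch_inj Qz Qw.
    by move=> W oW _; exact: torus_pi_open.
  apply: homeomorphism_eq (homeomorphism_comp hphi htorus) => _ /set_mem[z Qz <-].
  by rewrite /= phis// strip_map//; exact: sub.
Qed.

Lemma strip_chart z0 i : half_open z0 -> exists2 c : set X * (X -> 'cV[R]_2),
  is_chart c & c.1 = strip i @` strip_patch z0 /\
    forall y, c.1 y -> torus_pi (c.2 y) = tiled_map y.
Proof.
move=> h0; have sub := strip_patch_dom h0.
have [phi cphi phis] : exists2 phi, is_chart (strip i @` strip_patch z0, phi) &
    forall z, strip_patch z0 z -> phi (strip i z) = z.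
  apply: open_embedding_chart.
  - exact: strip_continuous.
  - move=> z w zQ wQ /(congr1 (@tiled_map _ _ _ _)).
    by rewrite !strip_map; [exact: strip_patch_inj zQ wQ|exact: sub|exact: sub].
  - by move=> W oW WQ; apply: strip_open => //; exact: subset_trans WQ sub.
  - exact: strip_patch_open.
exists (strip i @` strip_patch z0, phi) => //; split=> // _ [z Qz <-].
by rewrite /= phis// strip_map//; exact: sub.
Qed.

End Strips.

Section TiledCovering.
Variables (R : realType) (d : nat) (h v : {perm 'I_d}).
Local Notation X := (tiled R h v).
Local Notation p := (@tiled_map R d h v).
Implicit Types z w : 'cV[R]_2.

Lemma half_open_rep z : exists2 w, half_open w & torus_pi w = torus_pi z.
Proof.
pose w := vec (z 0 0 - (Num.floor (z 0 0))%:~R) (z 1 0 - (Num.floor (z 1 0))%:~R).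
exists w; last by apply/torus_piP; rewrite /w !vecE;
  split; rewrite addrAC subrr sub0r rpredN intr_int.
have fl (x : R) : 0 <= x - (Num.floor x)%:~R < 1.
  by have := floor_itv x; rewrite intrD1; lra.
by apply: forall_ord2; rewrite /w vecE.
Qed.

(* Away from the vertices one of the two coordinates is not an integer, and the
   strip in the direction of the other one is a local section of the covering. *)
Lemma half_open_direction z : half_open z -> z != 0 ->
  exists e (s : {perm 'I_d}),
    (forall i w, w e 0 = 1 -> tile h v i w = tile h v (s i) (w - delta_mx e 0)) /\
    (forall k, k != e -> 0 < z k 0 < 1).
Proof.
move=> hz nz; have [z1|z1] := ltP 0 (z 1 0).
  exists 0, h; split; first exact: tile_glue0.
  by apply: forall_ord2 => // _; have := hz 1; lra.
exists 1, v; split; first exact: tile_glue1.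
apply: forall_ord2 => // _; have h0 := hz 0; have h1 := hz 1.
have z10 : z 1 0 = 0 by lra.
suff : z 0 0 != 0 by move=> z0; rewrite lt_neqAle eq_sym z0 /=; lra.
by apply: contra nz => /eqP z00; apply/eqP/eq_vec; rewrite mxE.
Qed.

Lemma tiled_covering : covering_over p [set~ @infty R] d.
Proof.
move=> e; have [u <-] := torus_pi_surj e; have [z hz <-] := half_open_rep u => ninf.
have nz : z != 0 by apply/eqP => z0; apply: ninf; rewrite z0.
have [k [s [glue zk]]] := half_open_direction hz nz.
exact: (strip_covering glue hz zk).
Qed.

Lemma tiled_translation_chart (x : X) : p x <> @infty R ->
  exists2 c : set X * (X -> 'cV[R]_2), is_chart c &
    [/\ c.1 x, c.1 `<=` ~` (p @^-1` [set @infty R])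
      & forall y, c.1 y -> torus_pi (c.2 y) = p y].
Proof.
have [i [z [hz ->]]] := tile_surj x; rewrite tiled_map_cube; last exact: half_open_cube.
move=> ninf; have nz : z != 0 by apply/eqP => z0; apply: ninf; rewrite z0.
have [e [s [glue zk]]] := half_open_direction hz nz.
have [c cc [c1 c2]] := strip_chart glue i hz.
exists c => //; split=> //.
- rewrite c1; exists z; first exact: strip_patch_center.
  by rewrite (strip_mid glue)//; exact: (half_open_cube hz).
- move=> y cy /=; rewrite -c2//; move: cy; rewrite c1 => -[w Qw yw].
  have := strip_map glue i (strip_patch_dom hz Qw).
  by rewrite yw c2 ?c1; [move=> ->; exact: strip_patch_ne_infty Qw|exists w].
Qed.

End TiledCovering.

(** * Charts at the vertices *)

Section Fan.
Variables (R : realType) (M : nat).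
(** Makes each angle less than a straight one, so that consecutive rays are independent. *)
Hypothesis M_gt1 : (1 < M)%N.
Implicit Types u w : 'cV[R]_2.

Definition cross u w : R := u 0 0 * w 1 0 - u 1 0 * w 0 0.

(* The plane is cut into [2M] angles by the rays [ray j]; a vertex shared by [2M]
   corners of squares gets its chart by sending the corners linearly onto these
   angles in cyclic order. *)
Definition fan_angle (j : nat) : R := j%:R * (pi / M%:R).

Definition ray (j : nat) : 'cV[R]_2 := vec (cos (fan_angle j)) (sin (fan_angle j)).

Definition fan_point (j : nat) (a b : R) : 'cV[R]_2 := a *: ray j + b *: ray j.+1.

Lemma crossN u w : cross u w = - cross w u.
Proof. by rewrite /cross; ring. Qed.

Lemma cross_combl a b u u' w :
  cross (a *: u + b *: u') w = a * cross u w + b * cross u' w.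
Proof. by rewrite /cross !mxE; ring. Qed.

Lemma cross_combr a b u u' w :
  cross w (a *: u + b *: u') = a * cross w u + b * cross w u'.
Proof. by rewrite /cross !mxE; ring. Qed.

Lemma crossxx u : cross u u = 0.
Proof. by rewrite /cross; ring. Qed.

Lemma cramer u u' w :
  cross u u' *: w = cross w u' *: u + cross u w *: u'.
Proof. by apply: eq_vec; rewrite /cross !mxE; ring. Qed.

Lemma M_neq0 : M%:R != 0 :> R.
Proof. by rewrite pnatr_eq0; lia. Qed.

Lemma fan_angleD i j : fan_angle (i + j) = fan_angle i + fan_angle j.
Proof. by rewrite /fan_angle natrD mulrDl. Qed.

Lemma fan_angleM : fan_angle M = pi.
Proof. by rewrite /fan_angle mulrC divfK// M_neq0. Qed.

Lemma cross_ray i j : cross (ray i) (ray (i + j)) = sin (fan_angle j).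
Proof.
rewrite /cross /ray !vecE fan_angleD sinD cosD.
have := cos2Dsin2 (fan_angle i) => e; rewrite -[RHS]mul1r -e; ring.
Qed.

Lemma ray_half j : ray (j + M) = - ray j.
Proof.
rewrite /ray; apply: eq_vec; rewrite !mxE /= fan_angleD fan_angleM.
  by rewrite cosDpi.
by rewrite sinDpi.
Qed.

Lemma ray_period j : ray (j + M.*2) = ray j.
Proof. by rewrite -addnn addnA !ray_half opprK. Qed.

Lemma sin_fan_gt0 j : (0 < j < M)%N -> 0 < sin (fan_angle j).
Proof.
move=> /andP[j0 jM]; apply: sin_gt0_pi.
rewrite -fan_angleM /fan_angle mulr_gt0 ?ltr0n ?divr_gt0 ?pi_gt0 ?ltr0n//; last lia.
by rewrite ltr_pM2r ?ltr_nat// divr_gt0 ?pi_gt0 ?ltr0n//; lia.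
Qed.

Lemma sin_fan_ge0 j : (j <= M)%N -> 0 <= sin (fan_angle j).
Proof.
case: j => [|j]; first by rewrite /fan_angle mul0r sin0.
rewrite leq_eqVlt => /orP[/eqP->|jM]; first by rewrite fan_angleM sinpi.
by apply/ltW/sin_fan_gt0.
Qed.

Lemma sin_fan_le0 j : (M <= j <= M.*2)%N -> sin (fan_angle j) <= 0.
Proof.
move=> jM; have -> : j = (j - M + M)%N by lia.
by rewrite fan_angleD fan_angleM sinDpi oppr_le0 sin_fan_ge0//; lia.
Qed.

Definition fan_step : R := sin (fan_angle 1).

Lemma fan_step_gt0 : 0 < fan_step.
Proof. by apply: sin_fan_gt0; lia. Qed.

Lemma cross_rayS j : cross (ray j) (ray j.+1) = fan_step.
Proof. by rewrite -addn1 cross_ray. Qed.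

Definition fan_coord0 j w : R := cross w (ray j.+1) / fan_step.
Definition fan_coord1 j w : R := cross (ray j) w / fan_step.

Lemma fan_pointK j w : fan_point j (fan_coord0 j w) (fan_coord1 j w) = w.
Proof.
have s0 : fan_step != 0 by rewrite gt_eqF// fan_step_gt0.
apply: (scalerI s0); rewrite /fan_point scalerDr !scalerA.
rewrite /fan_coord0 /fan_coord1 ![fan_step * _]mulrC !divfK//.
by rewrite -cramer cross_rayS.
Qed.

Lemma fan_coord0K j a b : fan_coord0 j (fan_point j a b) = a.
Proof.
have s0 : fan_step != 0 by rewrite gt_eqF// fan_step_gt0.
by rewrite /fan_coord0 /fan_point cross_combl crossxx mulr0 addr0 cross_rayS mulfK.
Qed.

Lemma fan_coord1K j a b : fan_coord1 j (fan_point j a b) = b.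
Proof.
have s0 : fan_step != 0 by rewrite gt_eqF// fan_step_gt0.
by rewrite /fan_coord1 /fan_point cross_combr crossxx mulr0 add0r cross_rayS mulfK.
Qed.

Lemma fan_coord0_continuous j : continuous (fan_coord0 j).
Proof.
rewrite (_ : fan_coord0 j = fun w : 'cV[R]_2 =>
  (ray j.+1 1 0 / fan_step) * w 0 0 + (- ray j.+1 0 0 / fan_step) * w 1 0).
  by move=> w; apply: (cvg_lincomb (G := nbhs w)); exact: coord_cvg.
by apply/funext => w; rewrite /fan_coord0 /cross; field; rewrite gt_eqF// fan_step_gt0.
Qed.

Lemma fan_coord1_continuous j : continuous (fan_coord1 j).
Proof.
rewrite (_ : fan_coord1 j = fun w : 'cV[R]_2 =>
  (- ray j 1 0 / fan_step) * w 0 0 + (ray j 0 0 / fan_step) * w 1 0).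
  by move=> w; apply: (cvg_lincomb (G := nbhs w)); exact: coord_cvg.
by apply/funext => w; rewrite /fan_coord1 /cross; field; rewrite gt_eqF// fan_step_gt0.
Qed.

Lemma fan_point_period j a b : fan_point (j + M.*2) a b = fan_point j a b.
Proof. by rewrite /fan_point -addSn !ray_period. Qed.

Lemma fan_point_mod j a b : fan_point (j %% M.*2)%N a b = fan_point j a b.
Proof.
rewrite [in RHS](divn_eq j M.*2) addnC; elim: (j %/ M.*2)%N => [|n IHn].
  by rewrite mul0n addn0.
by rewrite mulSn [(M.*2 + _)%N]addnC addnA fan_point_period.
Qed.

(** Read the point of sector [j] in the coordinates of sector [j']. If [j'] is less than half a turn
    ahead, the second coordinate would be negative; from half a turn on, the first would not be
    positive. *)
Lemma fan_sector_lt j j' a b a' b' : (j < j' < M.*2)%N ->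
  0 < a -> 0 <= b -> 0 < a' -> 0 <= b' -> fan_point j a b <> fan_point j' a' b'.
Proof.
move=> /andP[jj' j'M] a0 b0 a'0 b'0 e.
pose n := (j' - j)%N; have j'E : j' = (j + n)%N by rewrite /n; lia.
have n0 : (0 < n)%N by rewrite /n; lia.
have e0 : a * sin (fan_angle n.+1) + b * sin (fan_angle n) = a' * fan_step.
  have := fan_coord0K j' a' b'; rewrite -e /fan_coord0 /fan_point => /(congr1 ( *%R^~ fan_step)).
  rewrite divfK ?gt_eqF ?fan_step_gt0// cross_combl j'E -addnS cross_ray => <-.
  by rewrite -[(j + n.+1)%N]addSnnS cross_ray.
have e1 : a * sin (fan_angle n) + b * sin (fan_angle n.-1) = - (b' * fan_step).
  have := fan_coord1K j' a' b'; rewrite -e /fan_coord1 /fan_point => /(congr1 ( *%R^~ fan_step)).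
  rewrite divfK ?gt_eqF ?fan_step_gt0// crossN cross_combl j'E cross_ray => <-.
  by rewrite opprK -[n in (j + n)%N](prednK n0) -addSnnS cross_ray.
have s0 := fan_step_gt0.
have [nM|Mn] := ltnP n M.
  have h1 : 0 < a * sin (fan_angle n) by rewrite mulr_gt0// sin_fan_gt0 ?n0.
  have h2 : 0 <= b * sin (fan_angle n.-1) by rewrite mulr_ge0// sin_fan_ge0//; lia.
  have h3 : 0 <= b' * fan_step by rewrite mulr_ge0// ltW.
  by lra.
have h1 : a * sin (fan_angle n.+1) <= 0.
  by apply: mulr_ge0_le0; [exact: ltW|apply: sin_fan_le0; lia].
have h2 : b * sin (fan_angle n) <= 0 by rewrite mulr_ge0_le0// sin_fan_le0//; lia.
have h3 : 0 < a' * fan_step by rewrite mulr_gt0.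
by lra.
Qed.

Lemma fan_sector_inj j j' a b a' b' : (j < M.*2)%N -> (j' < M.*2)%N ->
  0 < a -> 0 <= b -> 0 < a' -> 0 <= b' ->
  fan_point j a b = fan_point j' a' b' -> [/\ j = j', a = a' & b = b'].
Proof.
move=> jM j'M a0 b0 a'0 b'0 e.
have jj' : j = j'.
  case: (ltngtP j j') => // lt; exfalso.
    by apply: fan_sector_lt e => //; rewrite lt.
  by apply: fan_sector_lt (esym e) => //; rewrite lt.
move: e; rewrite -jj' => e; split=> //.
  by rewrite -[LHS](fan_coord0K j _ b) e fan_coord0K.
by rewrite -[LHS](fan_coord1K j a) e fan_coord1K.
Qed.

(** The sector is where the cross product of the rays with [w] passes from nonnegative to negative.
    If that never happened, a nonnegative value would persist although half a turn negates it, so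
    the product would vanish on two consecutive rays and [w] would be 0. *)
Lemma fan_cover w : w != 0 ->
  exists j a b, [/\ (j < M.*2)%N, 0 < a, 0 <= b & w = fan_point j a b].
Proof.
move=> w0; pose f j := cross (ray j) w.
suff [j [fj fj1]] : exists j, 0 <= f j /\ f j.+1 < 0.
  exists (j %% M.*2)%N, (fan_coord0 j w), (fan_coord1 j w); split.
  - by rewrite ltn_mod; lia.
  - by rewrite divr_gt0 ?fan_step_gt0// crossN oppr_gt0.
  - by rewrite divr_ge0// ltW// fan_step_gt0.
  - by rewrite fan_point_mod fan_pointK.
apply/not_existsP => hN.
have step j : 0 <= f j -> 0 <= f j.+1.
  by move=> fj; rewrite leNgt; apply/negP => fj1; apply: (hN j).
have fM j : f (j + M)%N = - f j by rewrite /f ray_half /cross !mxE; ring.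
have up j n : 0 <= f j -> 0 <= f (j + n)%N.
  by move=> fj; elim: n => [|n IHn]; rewrite ?addn0// addnS; exact: step.
have zero j : 0 <= f j -> f j = 0.
  by move=> fj; have := up j M fj; rewrite fM; lra.
have [j fj] : exists j, 0 <= f j.
  have [f0|f0] := leP 0 (f 0%N); first by exists 0%N.
  by exists (0 + M)%N; rewrite fM; lra.
have f1 := zero _ fj; have f2 := zero _ (step _ fj).
case/eqP: w0; have := cramer (ray j) (ray j.+1) w.
have f3 : cross w (ray j.+1) = 0 by rewrite crossN -/(f j.+1) f2 oppr0.
rewrite -/(f j) f1 f3 !scale0r addr0 cross_rayS.
by move=> /eqP; rewrite scaler_eq0 gt_eqF ?fan_step_gt0//= => /eqP.
Qed.

End Fan.

(** * Corners of squares around a vertex *)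

Section Corners.
Variables (R : realType) (d : nat) (h v : {perm 'I_d}).
Local Notation X := (tiled R h v).
Local Notation T := (tile h v).
Local Notation next := (next_corner h v).
Implicit Types (a b : R) (z : 'cV[R]_2) (k : 'I_d * 'I_4).

(* Coordinates at a corner of the unit square along the two sides meeting there,
   in counterclockwise order. *)
Definition corner_pos (r : 'I_4) a b : 'cV[R]_2 :=
  match val r with
  | 0 => vec a b | 1 => vec (1 - b) a | 2 => vec (1 - a) (1 - b)
  | _ => vec b (1 - a) end.

Definition corner_coord (r : 'I_4) z : R * R :=
  match val r with
  | 0 => (z 0 0, z 1 0) | 1 => (z 1 0, 1 - z 0 0)
  | 2 => (1 - z 0 0, 1 - z 1 0) | _ => (1 - z 1 0, z 0 0) end.

Lemma corner_pos0 a b : corner_pos (inord 0) a b = vec a b.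
Proof. by rewrite /corner_pos /= inordK. Qed.
Lemma corner_pos1 a b : corner_pos (inord 1) a b = vec (1 - b) a.
Proof. by rewrite /corner_pos /= inordK. Qed.
Lemma corner_pos2 a b : corner_pos (inord 2) a b = vec (1 - a) (1 - b).
Proof. by rewrite /corner_pos /= inordK. Qed.
Lemma corner_pos3 a b : corner_pos (inord 3) a b = vec b (1 - a).
Proof. by rewrite /corner_pos /= inordK. Qed.
Definition corner_posE := (corner_pos0, corner_pos1, corner_pos2, corner_pos3).

Lemma corner_coordK r z :
  corner_pos r (corner_coord r z).1 (corner_coord r z).2 = z.
Proof.
rewrite /corner_pos /corner_coord; case: r => [[|[|[|r]]] /= _];
  by apply: eq_vec; rewrite vecE ?subKr.
Qed.

Lemma corner_coord_ge0 r z : closed_cube z ->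
  0 <= (corner_coord r z).1 /\ 0 <= (corner_coord r z).2.
Proof.
move=> cz; have c0 := cz 0; have c1 := cz 1; rewrite /corner_coord.
by case: r => [[|[|[|r]]] /= _]; lra.
Qed.

Lemma corner_pos_cube r a b : 0 <= a <= 1 -> 0 <= b <= 1 -> closed_cube (corner_pos r a b).
Proof.
move=> ha hb; rewrite /corner_pos; case: r => [[|[|[|r]]] /= _];
  by apply: forall_ord2; rewrite vecE; lra.
Qed.

Definition sector k a b : X := T k.1 (corner_pos k.2 a b).

Lemma sector_glue k b : sector k 0 b = sector (next k) b 0.
Proof.
case: k => i r; rewrite /sector; case: (ord4P r) => ->;
  rewrite !next_cornerE !corner_posE /= ?subr0.
- rewrite [RHS]tile_glue0 ?vecE// permKV; congr T.
  by apply: eq_vec; rewrite !mxE /=; ring.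
- rewrite [RHS]tile_glue1 ?vecE// permKV; congr T.
  by apply: eq_vec; rewrite !mxE /=; ring.
- rewrite [LHS]tile_glue0 ?vecE//; congr T.
  by apply: eq_vec; rewrite !mxE /=; ring.
- rewrite [LHS]tile_glue1 ?vecE//; congr T.
  by apply: eq_vec; rewrite !mxE /=; ring.
Qed.

(* Recovers sector and coordinates from the canonical representative of a point
   off the ray [a = 0] of a sector. *)
Definition sector_of (i : 'I_d) z : ('I_d * 'I_4) * R * R :=
  let x := z 0 0 in let y := z 1 0 in
  if x < 2^-1 then
    if y < 2^-1 then
      if 0 < x then ((i, inord 0), x, y) else (((h^-1)%g i, inord 1), y, 0)
    else ((i, inord 3), 1 - y, x)
  else
    if y == 0 then (((v^-1)%g i, inord 2), 1 - x, 0)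
    else if y < 2^-1 then ((i, inord 1), y, 1 - x)
    else ((i, inord 2), 1 - x, 1 - y).

(** Having a left inverse settles injectivity in four cases instead of all pairs of corners. The
    bound 1/2 keeps the corners of a square apart. *)
Lemma sector_ofK k a b : 0 < a < 2^-1 -> 0 <= b < 2^-1 ->
  exists i z, [/\ half_open z, z != 0, sector k a b = T i z &
                 sector_of i z = (k, a, b)].
Proof.
case: k => i r; rewrite /sector => ha hb.
have b0P : b = 0 \/ 0 < b by rewrite lt_neqAle; case: eqVneq => [|] /=; [left|right; lra].
have nz (x y : R) : x != 0 \/ y != 0 -> vec x y != 0.
  move=> xy; apply/eqP => /matrixP e; have := e 0 0; have := e 1 0.
  by rewrite !mxE /= => y0 x0; move: xy; rewrite x0 y0 eqxx => -[].
have ho (x y : R) : 0 <= x < 1 -> 0 <= y < 1 -> half_open (vec x y).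
  by move=> hx hy; apply: forall_ord2; rewrite vecE.
have lt0 (x : R) : 0 < x -> x != 0 by move=> x0; rewrite gt_eqF.
have [a0 a1] := andP ha; have [_ b1] := andP hb.
have half_lt1 (x : R) : x < 2^-1 -> (1 - x < 2^-1) = false.
  by move=> hx; apply/negP => ?; lra.
have half_ne0 (x : R) : x < 2^-1 -> (1 - x == 0) = false.
  by move=> hx; apply/negP => /eqP ?; lra.
have a_ne0 : (a == 0) = false by rewrite gt_eqF.
case: (ord4P r) => ->; rewrite !corner_posE /=.
- exists i, (vec a b); split=> //; [apply: ho; lra|by apply: nz; left; apply: lt0; lra|].
  by rewrite /sector_of !vecE a1 b1 a0.
- case: b0P => [->|b0].
    exists (h i), (vec 0 a); split.
    + by apply: ho; lra.
    + by apply: nz; right; apply: lt0; lra.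
    + rewrite [LHS]tile_glue0 ?vecE ?subr0//; congr T.
      by apply: eq_vec; rewrite !mxE /=; ring.
    + by rewrite /sector_of !vecE ltxx invr_gt0 ltr0n a1 permK.
  exists i, (vec (1 - b) a); split=> //.
  + by apply: ho; lra.
  + by apply: nz; right; apply: lt0; lra.
  + by rewrite /sector_of !vecE half_lt1// a_ne0 a1 subKr.
- case: b0P => [->|b0].
    exists (v i), (vec (1 - a) 0); split.
    + by apply: ho; lra.
    + by apply: nz; left; apply: lt0; lra.
    + rewrite [LHS]tile_glue1 ?vecE ?subr0//; congr T.
      by apply: eq_vec; rewrite !mxE /=; ring.
    + by rewrite /sector_of !vecE half_lt1// eqxx permK subKr.
  exists i, (vec (1 - a) (1 - b)); split=> //.
  + by apply: ho; lra.
  + by apply: nz; left; apply: lt0; lra.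
  + by rewrite /sector_of !vecE !half_lt1// half_ne0// !subKr.
- exists i, (vec b (1 - a)); split=> //.
  + by apply: ho; lra.
  + by apply: nz; right; apply: lt0; lra.
  + by rewrite /sector_of !vecE b1 half_lt1// subKr.
Qed.

Lemma sector_inj k k' a b a' b' : 0 < a < 2^-1 -> 0 <= b < 2^-1 ->
  0 < a' < 2^-1 -> 0 <= b' < 2^-1 ->
  sector k a b = sector k' a' b' -> [/\ k = k', a = a' & b = b'].
Proof.
move=> ha hb ha' hb'.
have [i [z [hz nz -> e]]] := sector_ofK k ha hb.
have [i' [z' [hz' nz' -> e']]] := sector_ofK k' ha' hb'.
move=> /(tile_half_eq hz hz')[zz /(_ nz) ii _].
by move: e; rewrite ii zz e' => -[-> -> ->].
Qed.

(** At most three quarter turns lead to a lower left corner, and turning does not leave the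
    vertex. *)
Lemma sector_vertex k :
  exists2 i, fconnect next k (i, ord0) & sector k 0 0 = T i 0.
Proof.
have at0 k' : k'.2 = inord 0 -> k' = (k'.1, ord0) /\ sector k' 0 0 = T k'.1 0.
  case: k' => i r /= ->; rewrite ord0_inord /sector corner_posE /=; split=> //.
  by congr T; apply: eq_vec; rewrite !mxE.
have key n : (iter n next k).2 = inord 0 -> exists2 i, fconnect next k (i, ord0) &
    sector k 0 0 = T i 0.
  move=> /at0[e1 e2]; exists (iter n next k).1; first by rewrite -e1 fconnect_iter.
  by rewrite -{}e2 {e1}; elim: n => //= n ->; rewrite sector_glue.
case: k key => i r key; case: (ord4P r) key => -> key.
- exact: (key 0%N).
- by apply: (key 3%N); rewrite -[iter _ _ _]/(next (next (next _))) !next_cornerE.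
- by apply: (key 2%N); rewrite -[iter _ _ _]/(next (next _)) !next_cornerE.
- by apply: (key 1%N); rewrite -[iter _ _ _]/(next _) !next_cornerE.
Qed.

Lemma half_open0 : half_open (0 : 'cV[R]_2).
Proof. by move=> k; rewrite mxE; lra. Qed.

Lemma sector_vertex_connect k k' :
  sector k 0 0 = sector k' 0 0 -> fconnect next k k'.
Proof.
have [i ki ->] := sector_vertex k; have [j k'j ->] := sector_vertex k'.
move=> /(tile_half_eq half_open0 half_open0)[_ _ /vertex_repP ij].
apply: connect_trans ki (connect_trans ij _).
by rewrite vertex_connect_sym.
Qed.

Lemma sector_not_vertex k a b i : 0 < a < 2^-1 -> 0 <= b < 2^-1 ->
  sector k a b <> T i 0.
Proof.
move=> ha hb; have [j [z [hz nz -> _]]] := sector_ofK k ha hb.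
by move=> /(tile_half_eq hz half_open0)[z0]; rewrite z0 eqxx in nz.
Qed.

Lemma sector_normal k a b : 0 <= a < 2^-1 -> 0 <= b < 2^-1 ->
  (a = 0 /\ b = 0) \/ exists k' a' b', [/\ fconnect next k k', 0 < a' < 2^-1, 0 <= b' < 2^-1 &
    sector k a b = sector k' a' b'].
Proof.
move=> ha hb; have [a0|a0] := ltP 0 a.
  by right; exists k, a, b; rewrite connect0 a0; split=> //; lra.
have -> : a = 0 by lra.
have [b0|b0] := ltP 0 b; last by left; split=> //; lra.
right; exists (next k), b, 0; rewrite fconnect1 sector_glue; split=> //; lra.
Qed.

(** Makes the stars of distinct vertices disjoint. *)
Lemma sector_connect k k' a b a' b' : 0 <= a < 2^-1 -> 0 <= b < 2^-1 ->
  0 <= a' < 2^-1 -> 0 <= b' < 2^-1 ->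
  sector k a b = sector k' a' b' -> fconnect next k k'.
Proof.
move=> ha hb ha' hb'.
have [[-> ->]|[l [c [e [kl hc he ->]]]]] := sector_normal k ha hb;
  have [[-> ->]|[l' [c' [e' [kl' hc' he' ->]]]]] := sector_normal k' ha' hb'.
- exact: sector_vertex_connect.
- by have [i _ ->] := sector_vertex k => /esym/sector_not_vertex; case.
- by have [i _ ->] := sector_vertex k' => /sector_not_vertex; case.
- move=> /(sector_inj hc he hc' he')[ll _ _].
  by apply: connect_trans kl _; rewrite ll vertex_connect_sym.
Qed.

End Corners.

(** * The chart at a vertex *)

Section VertexStar.
Variables (R : realType) (d : nat) (h v : {perm 'I_d}).
Local Notation X := (tiled R h v).
Local Notation T := (tile h v).
Local Notation next := (next_corner h v).
Variable k0 : 'I_d * 'I_4.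
Implicit Types (a b : R) (z w : 'cV[R]_2).

Definition star_half : nat := (fingraph.order next k0)./2.
Local Notation M := star_half.

(** Each turn raises the corner number by one modulo 4. The number of corners at a vertex is thus
    even and at least 4, as a fan of [2M] angles with [1 < M] requires. *)
Lemma order_next_corner : (4 %| fingraph.order next k0)%N.
Proof.
have := iter_next_corner2 h v (fingraph.order next k0) k0; rewrite (iter_order (@next_corner_inj _ h v)) => e.
have : (k0.2 + fingraph.order next k0 = k0.2 + 0 %[mod 4])%N by rewrite -e addn0 modn_small.
by move=> /eqP; rewrite eqn_modDl mod0n.
Qed.

Lemma star_halfK : M.*2 = fingraph.order next k0.
Proof. by have := order_next_corner; rewrite /M; lia. Qed.

Lemma star_half_gt1 : (1 < M)%N.
Proof.
have := order_next_corner; have := fingraph.order_gt0 next k0; rewrite -star_halfK.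
by case: M => [|[|//]].
Qed.
Local Notation M1 := star_half_gt1.

Definition star_corner (j : nat) := iter j next k0.

Lemma star_corner_mod j : star_corner (j %% M.*2) = star_corner j.
Proof.
rewrite star_halfK /star_corner [in RHS](divn_eq j (fingraph.order next k0)) addnC iterD.
congr iter; elim: (j %/ fingraph.order next k0)%N => //= n IHn.
by rewrite mulSn iterD -IHn (iter_order (@next_corner_inj _ h v)).
Qed.

Lemma star_corner_inj i j : (i < M.*2)%N -> (j < M.*2)%N ->
  star_corner i = star_corner j -> i = j.
Proof.
rewrite star_halfK => iM jM; rewrite /star_corner.
by move=> /(congr1 (findex next k0)); rewrite !findex_iter.
Qed.

Lemma star_cornerP k : fconnect next k0 k -> exists j, k = star_corner j.
Proof. by move=> /iter_findex e; exists (findex next k0 k). Qed.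

Lemma star_corner_connect j : fconnect next k0 (star_corner j).
Proof. exact: fconnect_iter. Qed.

Definition star_point (j : nat) a b : X := sector h v (star_corner j) a b.
Local Notation F := (@fan_point R M).
Local Notation P := star_point.
Local Notation small := (fun a b => 0 <= a < 2^-1 /\ 0 <= b < 2^-1).

Lemma star_point_glue j b : P j 0 b = P j.+1 b 0.
Proof. exact: sector_glue. Qed.

Lemma fan_point_glue j b : F j 0 b = F j.+1 b 0.
Proof. by rewrite /fan_point !scale0r add0r addr0. Qed.

Lemma fan_point0 j : F j 0 0 = 0.
Proof. by rewrite /fan_point !scale0r addr0. Qed.

Lemma star_point_mod j a b : P (j %% M.*2)%N a b = P j a b.
Proof. by rewrite /star_point star_corner_mod. Qed.

Lemma star_center j : P j 0 0 = P 0 0 0.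
Proof. by elim: j => // j <-; rewrite [RHS]star_point_glue. Qed.

Lemma fan_normal j a b : 0 <= a -> 0 <= b -> (a = 0 /\ b = 0) \/
  exists j' a' b', [/\ (j' < M.*2)%N, 0 < a', 0 <= b' & [/\ F j a b = F j' a' b',
    P j a b = P j' a' b' & small a b <-> small a' b']].
Proof.
move=> ha hb; have M2 : (0 < M.*2)%N by have := M1; lia.
have [a0|a0] := ltP 0 a.
  right; exists (j %% M.*2)%N, a, b.
  by rewrite ltn_mod (fan_point_mod M1) star_point_mod.
have -> : a = 0 by lra.
have [b0|b0] := ltP 0 b; last by left; split=> //; lra.
right; exists (j.+1 %% M.*2)%N, b, 0.
rewrite ltn_mod (fan_point_mod M1) star_point_mod fan_point_glue star_point_glue.
by split=> //; split=> //; split=> -[]; split=> //; lra.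
Qed.

(** Fan coordinates are ambiguous on the rays and at the origin; this makes [star] and the size
    condition in [star_dom] well defined. *)
Lemma star_unique j j' a b a' b' : 0 <= a -> 0 <= b -> 0 <= a' -> 0 <= b' ->
  F j a b = F j' a' b' -> P j a b = P j' a' b' /\ (small a b <-> small a' b').
Proof.
have nz i c e : 0 < c -> F i c e <> 0.
  move=> c0 e0; have := fan_coord0K M1 i c e.
  by rewrite e0 -(fan_point0 i) fan_coord0K ?M1// => c_0; rewrite -c_0 ltxx in c0.
move=> ha hb ha' hb'.
have [[-> ->]|[i [c [e [iM c0 e0 [-> -> ->]]]]]] := fan_normal j ha hb;
  have [[-> ->]|[i' [c' [e' [iM' c0' e0' [-> -> ->]]]]]] := fan_normal j' ha' hb'.
- by rewrite (star_center j) (star_center j').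
- by rewrite fan_point0 => /esym/nz; case.
- by rewrite fan_point0 => /nz; case.
- by move=> /(fan_sector_inj M1 iM iM' c0 e0 c0' e0')[-> -> ->].
Qed.

Lemma fan_exists w : exists j a b,
  [/\ (j < M.*2)%N, 0 <= a, 0 <= b & w = F j a b].
Proof.
have [->|w0] := eqVneq w 0.
  by exists 0%N, 0, 0; rewrite fan_point0; split=> //; have := M1; lia.
have [j [a [b [jM a0 b0 wE]]]] := fan_cover M1 w0.
by exists j, a, b; split=> //; exact: ltW.
Qed.

(** The inverse of the chart: each angle of the fan goes linearly onto a corner of a square. By
    [fan_exists] the default of [xget] is never taken. *)
Definition star w : X :=
  xget (P 0 0 0) [set x | exists j a b, [/\ 0 <= a, 0 <= b, w = F j a b & x = P j a b]].

Lemma star_fan j a b : 0 <= a -> 0 <= b -> star (F j a b) = P j a b.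
Proof.
move=> ha hb; rewrite /star; case: xgetP => [x _ [j' [a' [b' [ha' hb' e ->]]]]|].
  by have [-> _] := star_unique ha hb ha' hb' e.
by move=> /(_ (P j a b)); case; exists j, a, b.
Qed.

Definition star_dom : set 'cV[R]_2 :=
  [set w | exists j a b, small a b /\ w = F j a b].

Lemma star_dom_fan j a b : 0 <= a -> 0 <= b -> star_dom (F j a b) <-> small a b.
Proof.
move=> ha hb; split=> [[j' [a' [b' [[ha' hb'] e]]]]|]; last by exists j, a, b.
have [a0' _] := andP ha'; have [b0' _] := andP hb'.
by have [_ ->] := star_unique ha hb a0' b0' e.
Qed.

Definition fan_sector (j : nat) : set 'cV[R]_2 :=
  [set w | 0 <= fan_coord0 M j w] `&` [set w | 0 <= fan_coord1 M j w].

Lemma closed_ge_fun (Y : topologicalType) (f : Y -> R) (c : R) :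
  continuous f -> closed [set x | c <= f x].
Proof. by move=> /continuous_closedP /(_ _ (@closed_ge R c)). Qed.

Lemma fan_sector_closed j : closed (fan_sector j).
Proof.
by apply: closedI; apply: closed_ge_fun;
  [exact/fan_coord0_continuous/M1|exact/fan_coord1_continuous/M1].
Qed.

Lemma fan_sector_cover w : exists j : 'I_(M.*2), fan_sector j w.
Proof.
have [j [a [b [jM a0 b0 ->]]]] := fan_exists w.
exists (Ordinal jM); split; rewrite /= ?fan_coord0K ?fan_coord1K//; exact: M1.
Qed.

Lemma continuous_vec (f g : 'cV[R]_2 -> R) : continuous f -> continuous g ->
  continuous (fun w => vec (f w) (g w)).
Proof. by move=> cf cg w; apply: (cvg_vec (G := nbhs w)); [exact: cf|exact: cg]. Qed.

Lemma sector_continuous k (f g : 'cV[R]_2 -> R) : continuous f -> continuous g ->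
  continuous (fun w => sector h v k (f w) (g w)).
Proof.
move=> cf cg w; have c1 (f' : 'cV[R]_2 -> R) : continuous f' -> continuous (fun w => 1 - f' w).
  by move=> cf' w'; apply: (@cvgB _ _ _ (nbhs w')); [exact: cvg_cst|exact: cf'].
have cp : continuous (fun w => corner_pos k.2 (f w) (g w)).
  rewrite /corner_pos; case: k.2 => [[|[|[|r]]] /= _].
  - exact: (continuous_vec cf cg).
  - exact: (continuous_vec (c1 _ cg) cf).
  - exact: (continuous_vec (c1 _ cf) (c1 _ cg)).
  - exact: (continuous_vec cg (c1 _ cf)).
apply: (continuous_comp (cp w)); exact: tile_continuous.
Qed.

Lemma star_continuous : continuous star.
Proof.
apply: (@closed_cover_continuous _ _ 'I_(M.*2) (fun j => fan_sector j)
  (fun j w => P j (fan_coord0 M j w) (fan_coord1 M j w))).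
- by move=> j; exact: fan_sector_closed.
- by move=> j; apply: sector_continuous;
    [exact/fan_coord0_continuous/M1|exact/fan_coord1_continuous/M1].
- by move=> j w [w0 w1]; rewrite -star_fan// fan_pointK//; exact: M1.
- exact: fan_sector_cover.
Qed.

Lemma star_dom_open : open star_dom.
Proof.
rewrite openE => w dw; rewrite /interior.
have loc (j : 'I_(M.*2)) : \forall u \near w, fan_sector j u -> star_dom u.
  have [Cw|nCw] := pselect (fan_sector j w); last first.
    have : \forall u \near w, ~ fan_sector j u.
      by apply: open_nbhs_nbhs; split=> //; exact/closed_openC/fan_sector_closed.
    by apply: filterS => u nCu Cu.
  have [w0 w1] := Cw; move: dw; rewrite -{1}[w](fan_pointK M1 j) star_dom_fan//.
  move=> [/andP[_ a1] /andP[_ b1]].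
  have ltf (f : 'cV[R]_2 -> R) : continuous f -> f w < 2^-1 -> \forall u \near w, f u < 2^-1.
    move=> cf fw; apply: (cf w [set x | x < 2^-1]); apply: open_nbhs_nbhs.
    by split=> //; exact: open_lt.
  have := ltf _ (@fan_coord0_continuous R M M1 j) a1.
  have := ltf _ (@fan_coord1_continuous R M M1 j) b1.
  apply: filterS2 => u u1 u0 [/= cu0 cu1].
  rewrite -[u](fan_pointK M1 j) star_dom_fan//; split; lra.
have : \forall u \near w, forall j : 'I_(M.*2), fan_sector j u -> star_dom u.
  exact: (@filter_forall _ _ (fun (j : 'I_(M.*2)) u => fan_sector j u -> star_dom u)
    (nbhs w) (nbhs_filter w) loc).
by apply: filterS => u hu; have [j /hu] := fan_sector_cover u.
Qed.

Lemma star_inj w w' : star_dom w -> star_dom w' -> star w = star w' -> w = w'.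
Proof.
move=> [j [a [b [[ha hb] ->]]]] [j' [a' [b' [[ha' hb'] ->]]]].
have [a0 a1] := andP ha; have [b0 b1] := andP hb.
have [a0' a1'] := andP ha'; have [b0' b1'] := andP hb'.
rewrite !star_fan//.
have vert i : exists i', P i 0 0 = T i' 0.
  by have [i' _ e] := sector_vertex R h v (star_corner i); exists i'.
have [[-> ->]|[i [c [e [iM c0 e0 [-> -> [+ _]]]]]]] := fan_normal j a0 b0;
  have [[-> ->]|[i' [c' [e' [iM' c0' e0' [-> -> [+ _]]]]]]] := fan_normal j' a0' b0'.
- by rewrite !fan_point0.
- move=> /(_ (conj ha' hb'))[/andP[_ c1'] he'].
  by have [l ->] := vert j => /esym/sector_not_vertex; rewrite c0' c1' => /(_ isT he'); case.
- move=> /(_ (conj ha hb))[/andP[_ c1] he].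
  by have [l ->] := vert j' => /sector_not_vertex; rewrite c0 c1 => /(_ isT he); case.
- move=> /(_ (conj ha' hb'))[/andP[_ c1'] he'] /(_ (conj ha hb))[/andP[_ c1] he].
  move=> /sector_inj; rewrite c0 c1 c0' c1' => /(_ isT he isT he')[ll -> ->].
  by rewrite (star_corner_inj iM iM' ll).
Qed.

Lemma star_lift i z w : closed_cube z -> star_dom w -> star w = T i z ->
  exists j r, (i, r) = star_corner j /\
    small (corner_coord r z).1 (corner_coord r z).2.
Proof.
move=> cz [j [a [b [[ha hb] ->]]]].
have [a0 a1] := andP ha; have [b0 b1] := andP hb.
rewrite star_fan// => e.
(* The image of the star in the torus avoids the two circles where a coordinate is 1/2, so [z] lies
   in one of the four open quarters of its square. *)
have half k' : z k' 0 != 2^-1.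
  apply/eqP => zk.
  have : torus_pi (corner_pos (star_corner j).2 a b) = torus_pi z.
    rewrite -(tiled_map_cube h v i cz) -e /star_point /sector tiled_map_cube//.
    by apply: corner_pos_cube; lra.
  move=> /torus_piP[i0 i1].
  have ik : corner_pos (star_corner j).2 a b k' 0 - 2^-1 \is a Num.int.
    by rewrite -zk; case: (ord2P k') => ->.
  have nz : corner_pos (star_corner j).2 a b k' 0 - 2^-1 != 0.
    apply/eqP; case: (ord2P k') => ->; rewrite /corner_pos;
    by case: (star_corner j).2 => [[|[|[|r]]] /= _]; rewrite vecE; lra.
  have := norm_intr_ge1 ik nz; rewrite leNgt => /negP; apply; rewrite ltr_norml.
  case: (ord2P k') => ->; rewrite /corner_pos;
  by case: (star_corner j).2 => [[|[|[|r]]] /= _]; rewrite vecE; lra.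
have [r hr] : exists r, small (corner_coord r z).1 (corner_coord r z).2.
  have := cz 0; have := cz 1; move: (half 0) (half 1).
  rewrite !neq_lt /corner_coord => /orP[x|x] /orP[y|y] y01 x01.
  - by exists (inord 0); rewrite /= inordK//=; lra.
  - by exists (inord 3); rewrite /= inordK//=; lra.
  - by exists (inord 1); rewrite /= inordK//=; lra.
  - by exists (inord 2); rewrite /= inordK//=; lra.
have [hr0 hr1] := hr.
have e' : P j a b = sector h v (i, r) (corner_coord r z).1 (corner_coord r z).2.
  by rewrite e /sector corner_coordK.
have := sector_connect ha hb hr0 hr1 e' => /(connect_trans (star_corner_connect j)).
by move=> /star_cornerP[j' jE]; exists j', r.
Qed.

(** Near a preimage in the square [i], the map [tile i] is [star] after a continuous map into the
    fan, which pulls [W] back to a neighbourhood. *)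
Lemma star_open W : open W -> W `<=` star_dom -> open (star @` W).
Proof.
move=> oW sW; apply/tiled_openP => i; rewrite openE => z0 [w Ww].
rewrite -tile_clamp => wz.
have [j [r [jE [hr0 hr1]]]] := star_lift (clamp_itv z0) (sW _ Ww) wz.
pose g0 z := (corner_coord r (clamp z)).1; pose g1 z := (corner_coord r (clamp z)).2.
have g01 z : 0 <= g0 z /\ 0 <= g1 z by apply: corner_coord_ge0; exact: clamp_itv.
have starE z : star (F j (g0 z) (g1 z)) = T i z.
  have [h0 h1] := g01 z; rewrite star_fan// /star_point -jE /sector corner_coordK.
  exact: tile_clamp.
have cc k : continuous (fun z => clamp z k 0).
  move=> z; apply: (@continuous_comp _ _ _ (@clamp R) (fun u : 'cV[R]_2 => u k 0)).
    exact: clamp_continuous.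
  exact: coord_continuous.
have c1 k : continuous (fun z => 1 - clamp z k 0).
  by move=> z; apply: (@cvgB _ _ _ (nbhs z)); [exact: cvg_cst|exact: cc].
have cg0 : continuous g0.
  rewrite /g0 /corner_coord; case: r {jE hr0 hr1 g0 g1 g01 starE} => [[|[|[|r]]] /= _];
  by [exact: cc|exact: c1].
have cg1 : continuous g1.
  rewrite /g1 /corner_coord; case: r {jE hr0 hr1 g0 g1 g01 starE cg0} => [[|[|[|r]]] /= _];
  by [exact: cc|exact: c1].
have cF : F j (g0 z) (g1 z) @[z --> z0] --> F j (g0 z0) (g1 z0).
  have E k a b : F j a b k 0 = ray R M j k 0 * a + ray R M j.+1 k 0 * b.
    by rewrite /fan_point mxE [X in X + _]mxE [X in _ + X]mxE; ring.
  have coord k : F j (g0 z) (g1 z) k 0 @[z --> z0] --> F j (g0 z0) (g1 z0) k 0.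
    rewrite E (_ : (fun z => _) = fun z => ray R M j k 0 * g0 z + ray R M j.+1 k 0 * g1 z);
      last by apply/funext => z; exact: E.
    by apply: (cvg_lincomb (G := nbhs z0)); [exact: cg0|exact: cg1].
  by apply: (cvg_cV2 (G := nbhs z0)); exact: coord.
have Fw : F j (g0 z0) (g1 z0) = w.
  apply: star_inj; [|exact: sW|by rewrite starE wz tile_clamp].
  by exists j, (g0 z0), (g1 z0).
have : \forall z \near z0, W (F j (g0 z) (g1 z)).
  by apply: cF; apply: open_nbhs_nbhs; rewrite Fw.
by apply: filterS => z Wz; exists (F j (g0 z) (g1 z)).
Qed.

Lemma star_chart : exists c : set X * (X -> 'cV[R]_2),
  is_chart c /\ c.1 = star @` star_dom.
Proof.
have [phi cphi _] := open_embedding_chart star_continuous star_inj star_open star_dom_open.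
by exists (star @` star_dom, phi).
Qed.

Lemma star_center_mem : (star @` star_dom) (sector h v k0 0 0).
Proof.
exists 0; last by rewrite -(fan_point0 0) star_fan.
by exists 0%N, 0, 0; rewrite fan_point0; split=> //; split; lra.
Qed.

End VertexStar.

(** * The tiled space as a closed surface *)

Section TiledSurfaceClosed.
Variables (R : realType) (d : nat) (h v : {perm 'I_d}).
Local Notation X := (tiled R h v).
Local Notation T := (tile h v).
Local Notation p := (@tiled_map R d h v).

Lemma star_disjoint k k' (x : X) : (star h v k @` star_dom h v k) x ->
  (star h v k' @` star_dom h v k') x -> fconnect (next_corner h v) k k'.
Proof.
move=> [w [j [a [b [[ha hb] ->]]]] <-] [w' [j' [a' [b' [[ha' hb'] ->]]]]].
have [a0 a1] := andP ha; have [b0 b1] := andP hb.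
have [a0' a1'] := andP ha'; have [b0' b1'] := andP hb'.
rewrite !star_fan// => /esym e; have := sector_connect ha hb ha' hb' e.
move=> /(connect_trans (star_corner_connect h v k j)) kj.
apply: connect_trans kj _; rewrite vertex_connect_sym; exact: star_corner_connect.
Qed.

Lemma tile_sector i : T i (0 : 'cV[R]_2) = sector h v (i, ord0) 0 0.
Proof. by congr T; apply: eq_vec; rewrite /corner_pos /= !mxE. Qed.

Lemma tiled_map_infty (x : X) : p x = @infty R -> exists i, x = T i 0.
Proof.
have [i [z [hz ->]]] := tile_surj x; rewrite tiled_map_cube; last exact: half_open_cube.
move=> /torus_piP[]; rewrite !mxE !subr0 => i0 i1.
have z0 k : z k 0 = 0.
  have ik : z k 0 \is a Num.int by case: (ord2P k) => ->.
  apply/eqP/negPn/negP => /(norm_intr_ge1 ik); have := hz k => /andP[k0 k1].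
  by rewrite ger0_norm// leNgt k1.
by exists i; congr T; apply: eq_vec; rewrite mxE.
Qed.

(** Points with different images are separated in the torus, two vertices by their stars, and two
    other points of one fibre by the sheets of the covering. *)
Lemma tiled_hausdorff : hausdorff_space X.
Proof.
rewrite open_hausdorff => x y xy.
suff [A [B [oA oB Ax By AB]]] : exists A B : set X,
    [/\ open A, open B, A x, B y & forall u, A u -> B u -> False].
  exists (A, B) => /=; first by rewrite !inE.
  by split=> //; apply/eqP/seteqP; split=> // u [/AB].
have [exy|/eqP nexy] := pselect (p x = p y); last first.
  have := @torus_hausdorff R; rewrite open_hausdorff => /(_ _ _ nexy).
  move=> [[A B] /= [Ax By] [oA oB /eqP AB]].
  exists (p @^-1` A), (p @^-1` B); rewrite inE in Ax; rewrite inE in By.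
  have cp := @tiled_map_continuous R d h v.
  split=> //; try by move/continuousP: cp; apply.
  by move=> u Au Bu; have : (A `&` B) (p u) by []; rewrite AB.
have [inf|ninf] := pselect (p x = @infty R).
  have [i xi] := tiled_map_infty inf.
  have [j yj] : exists j, y = T j 0 by apply: tiled_map_infty; rewrite -exy.
  exists (star h v (i, ord0) @` star_dom h v (i, ord0)),
    (star h v (j, ord0) @` star_dom h v (j, ord0)); split.
  - by apply: star_open => //; exact: star_dom_open.
  - by apply: star_open => //; exact: star_dom_open.
  - by rewrite xi tile_sector; exact: star_center_mem.
  - by rewrite yj tile_sector; exact: star_center_mem.
  - move=> u ui uj; have /vertex_repP ij := star_disjoint ui uj.
    by move/eqP: xy; apply; rewrite xi yj; exact: tile_vertex.
have [V [U [[oV Vx _] [pV triv hU]]]] := tiled_covering h v ninf.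
have [i _ Ui] : (\bigcup_(i in [set: 'I_d]) U i) x by rewrite -pV.
have [j _ Uj] : (\bigcup_(i in [set: 'I_d]) U i) y by rewrite -pV /= -exy.
exists (U i), (U j); split=> //; try by have [] := hU i; have [] := hU j.
move=> u Ui' Uj'; have ij : i = j by apply: triv => //; exists u.
have [_ [g [[_ _ gp _] _]]] := hU i.
by move/eqP: xy; apply; rewrite -(gp x)// -(gp y) ?exy// ij.
Qed.

Lemma tiled_closed_surface :
  (forall P : 'I_d -> Prop, (forall i, P i <-> P (h i)) ->
     (forall i, P i <-> P (v i)) -> forall i j, P i -> P j) ->
  closed_surface R X.
Proof.
move=> trans; split.
- exact: tiled_hausdorff.
- exact: tiled_compact.
- exact: tiled_connected.
- move=> x; have [inf|ninf] := pselect (p x = @infty R).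
    have [i ->] := tiled_map_infty inf; rewrite tile_sector.
    have [c [cc c1]] := star_chart R h v (i, ord0); exists c => //.
    by rewrite c1; exact: star_center_mem.
  by have [c cc [cx _ _]] := tiled_translation_chart ninf; exists c.
Qed.

End TiledSurfaceClosed.

(** * Veech group and cell structure *)

Definition transitive_pair (d : nat) (h v : {perm 'I_d}) : Prop :=
  forall P : 'I_d -> Prop, (forall i, P i <-> P (h i)) ->
    (forall i, P i <-> P (v i)) -> forall i j, P i -> P j.

Section TiledOrigami.
Variables (R : realType) (d : nat) (h v : {perm 'I_d}).
Hypotheses (d_gt0 : (0 < d)%N) (trans : transitive_pair h v).
Local Notation X := (tiled R h v).
Local Notation T := (tile h v).
Implicit Types z w u : 'cV[R]_2.

Lemma tiled_map_finite : finite_set (@tiled_map R d h v @^-1` [set @infty R]).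
Proof.
apply: (@sub_finite_set _ _ ((fun i => T i (0 : 'cV[R]_2)) @` [set: 'I_d])).
  by move=> x /tiled_map_infty[i ->]; exists i.
exact/finite_image/finite_finset.
Qed.

Definition tiled_origami : origami R :=
  @Origami R X d (@tiled_map R d h v) (tiled_closed_surface R trans) d_gt0
    (@tiled_map_continuous R d h v) (tiled_covering h v) tiled_map_finite.

Local Notation O := tiled_origami.
Local Notation pX := (@punctured R O).

Lemma puncturedP (x : O) : pX x <-> tiled_map x <> @infty R.
Proof. by []. Qed.

Lemma tiled_chart_at (x : O) : pX x ->
  exists2 c, @translation_structure R O 1%:M c & c.1 x.
Proof.
move=> /puncturedP/tiled_translation_chart[c cc [cx cp ch]]; exists c => //.
by split=> // y cy; rewrite invmx1 mul1mx; exact: ch.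
Qed.

Lemma delta_cube (j : 'I_2) (t : R) : 0 <= t <= 1 ->
  closed_cube (t *: (delta_mx j 0 : 'cV[R]_2)).
Proof. by move=> ht k; rewrite !mxE andbT; case: eqP => _; rewrite ?mulr1 ?mulr0//; lra. Qed.

Lemma tiled_edge_path (j : 'I_2) : exists gamma z (x0 x1 : O),
  [/\ lifts_line gamma `]0, 1[ z (delta_mx j 0),
      gamma t @[t --> 0^'+] --> x0, gamma t @[t --> 1^'-] --> x1,
      ~ pX x0 & ~ pX x1].
Proof.
pose i0 := Ordinal d_gt0; pose e : 'cV[R]_2 := delta_mx j 0.
pose gamma (t : R) : O := T i0 (0 + t *: e).
have cg (t : R) : gamma s @[s --> t] --> gamma t.
  apply: (cvg_comp (fun s : R => 0 + s *: e) (T i0)); last exact: tile_continuous.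
  by apply: line_cvg; exact: cvg_id.
have mapE (t : R) : 0 <= t <= 1 -> tiled_map (gamma t : X) = torus_pi (0 + t *: e).
  by move=> ht; rewrite tiled_map_cube//= add0r; exact: delta_cube.
have not_punctured (t : R) : 0 <= t <= 1 -> t \is a Num.int -> ~ pX (gamma t).
  move=> ht it; rewrite /punctured /= mapE// => npx; apply: npx.
  apply/torus_piP; rewrite !mxE !add0r !subr0.
  by split; case: (_ && _); rewrite ?mulr1 ?mulr0 ?rpred0.
exists gamma, 0, (gamma 0), (gamma 1); split.
- split; first by apply: continuous_subspaceT => t; exact: cg.
  move=> t; rewrite /= in_itv/= => /andP[t0 t1].
  have ht : 0 <= t <= 1 by lra.
  split; last exact: mapE.
  rewrite /punctured /= mapE// => /torus_piP[i0' i1'].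
  have it : t \is a Num.int.
    by move: i0' i1'; rewrite !mxE !add0r !subr0 /=; case: (ord2P j) => ->;
      rewrite /= ?mulr1.
  by have := norm_intr_ge1 it; rewrite gt_eqF// gtr0_norm// leNgt t1 => /(_ isT).
- exact/cvg_at_right_filter/cg.
- exact/cvg_at_left_filter/cg.
- by apply: not_punctured; rewrite ?lexx ?ler01 ?rpred0.
- by apply: not_punctured; rewrite ?lexx ?ler01 ?rpred1.
Qed.

Lemma tiled_veech_subgroup : subgroup_of_SL2Z (veech_group O).
Proof. exact: (veech_group_subgroup tiled_chart_at tiled_edge_path). Qed.

(** [strip_dom] is convex and contains no lattice point, so a segment with both ends in it maps to a
    geodesic. *)
Lemma strip_flow (e : 'I_2) (s : {perm 'I_d})
    (glue : forall i z, z e 0 = 1 -> T i z = T (s i) (z - delta_mx e 0))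
    i z u (t : R) : 0 <= t ->
  strip_dom e z -> strip_dom e (z + t *: u) ->
  @flow R O u t (strip h v e s i z) (strip h v e s i (z + t *: u)).
Proof.
move=> t0 dz dz'.
exists (fun r => strip h v e s i (z + r *: u)), z; split=> //; last by rewrite scale0r addr0.
split.
  apply: continuous_subspaceT => r.
  apply: (cvg_comp (fun s : R => z + s *: u) (strip h v e s i)).
    by apply: line_cvg; exact: cvg_id.
  exact: strip_continuous.
move=> r; rewrite /= in_itv/= => /andP[r0 rt].
have dr : strip_dom e (z + r *: u).
  have between k a b : a < z k 0 < b -> a < (z + t *: u) k 0 < b -> a < (z + r *: u) k 0 < b.
    rewrite !mxE => hz hz'; have [u0|u0] := leP 0 (u k 0).
      have := ler_wpM2r u0 rt; have := mulr_ge0 r0 u0; lra.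
    have := ler_wnM2r (ltW u0) rt; have := mulr_ge0_le0 r0 (ltW u0); lra.
  split; first by apply: between; [exact: dz.1|exact: dz'.1].
  by move=> k ke; apply: between; [exact: dz.2|exact: dz'.2].
split; last exact: strip_map.
apply/puncturedP; rewrite (strip_map glue)// => /torus_piP[i0 i1].
have [k ke] : exists k, k != e by case: (ord2P e) => ->; [exists 1|exists 0].
have ik : (z + r *: u) k 0 \is a Num.int.
  by move: i0 i1; rewrite ![(0 : 'cV_2) _ _]mxE !subr0; case: (ord2P k) => ->.
have /andP[k0 k1] := dr.2 k ke.
by have := norm_intr_ge1 ik; rewrite gt_eqF// gtr0_norm// leNgt k1 => /(_ isT).
Qed.

(** * Cell decomposition and Euler characteristic *)

Let is_rep := [pred i | vertex_rep h v i == i].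
(** A square contributes its interior and its bottom and left sides; the other two sides belong to
    its neighbours. *)
Let cell := ({i | is_rep i} + 'I_d * 'I_2 + 'I_d)%type.

Definition cell_dim (c : cell) : nat :=
  match c with inl (inl _) => 0 | inl (inr _) => 1 | inr _ => 2 end.

Definition cell_map (c : cell) : 'cV[R]_(cell_dim c) -> X :=
  match c with
  | inl (inl i) => fun=> T (val i) 0
  | inl (inr ie) => fun t => T ie.1 (t 0 0 *: delta_mx ie.2 0)
  | inr i => fun z => T i z
  end.

Lemma vertex_rep_is_rep i : is_rep (vertex_rep h v i).
Proof. by rewrite /= vertex_rep_id. Qed.

Definition cell_of (i : 'I_d) z : {c : cell & 'cV[R]_(cell_dim c)} :=
  if z == 0 then
    existT (fun c : cell => 'cV[R]_(cell_dim c))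
      (inl (inl (exist _ (vertex_rep h v i) (vertex_rep_is_rep i)))) 0
  else if z 1 0 == 0 then
    existT (fun c : cell => 'cV[R]_(cell_dim c)) (inl (inr (i, 0))) (const_mx (z 0 0))
  else if z 0 0 == 0 then
    existT (fun c : cell => 'cV[R]_(cell_dim c)) (inl (inr (i, 1))) (const_mx (z 1 0))
  else existT (fun c : cell => 'cV[R]_(cell_dim c)) (inr i) z.

Lemma cell_ofP i z : half_open z ->
  open_cube (projT2 (cell_of i z)) /\ cell_map (projT2 (cell_of i z)) = T i z.
Proof.
move=> hz; rewrite /cell_of; have h0 := hz 0; have h1 := hz 1.
case: (eqVneq z 0) => [->|nz] /=.
  split; first by case.
  by apply: tile_vertex; rewrite vertex_rep_id.
case: (eqVneq (z 1 0) 0) => [z1|z1] /=.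
  have z0 : z 0 0 != 0 by apply: contra nz => /eqP z0; apply/eqP/eq_vec; rewrite mxE.
  split; first by move=> k; rewrite mxE lt_neqAle eq_sym z0; lra.
  by congr T; apply: eq_vec; rewrite !mxE /= ?mulr1 ?mulr0.
case: (eqVneq (z 0 0) 0) => [z0|z0] /=.
  split; first by move=> k; rewrite mxE lt_neqAle eq_sym z1; lra.
  by congr T; apply: eq_vec; rewrite !mxE /= ?mulr1 ?mulr0.
by split=> //; apply: forall_ord2; rewrite lt_neqAle eq_sym ?z0 ?z1; lra.
Qed.

Lemma cell_of_unique (c : cell) (t : 'cV[R]_(cell_dim c)) i z : half_open z ->
  open_cube t -> cell_map t = T i z -> cell_of i z = existT _ c t.
Proof.
move=> hz; case: c t => [[[j rj]|[j e]]|j] /= t ot.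
- move=> /(tile_half_eq (half_open0 R) hz)[<- _ e]; rewrite /cell_of eqxx.
  have -> : t = 0 by apply/matrixP => -[].
  set a := exist _ _ _; suff -> : a = exist _ j rj by [].
  by apply: val_inj; rewrite /= -e; exact/eqP.
- have t0 := ot 0; have nt : t 0 0 != 0 by rewrite gt_eqF//; lra.
  pose w : 'cV[R]_2 := t 0 0 *: delta_mx e 0.
  have hw : half_open w.
    by move=> k; rewrite !mxE andbT; case: eqP => _; rewrite ?mulr1 ?mulr0; lra.
  have nw : w != 0.
    apply/eqP => /matrixP /(_ e 0); rewrite !mxE !eqxx mulr1 => t_0.
    by rewrite t_0 eqxx in nt.
  move=> /(tile_half_eq hw hz)[<- /(_ nw) <- _]; rewrite /cell_of (negbTE nw).
  have tE : t = const_mx (t 0 0) by apply/matrixP => a b; rewrite mxE !ord1.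
  rewrite /w !mxE; case: (ord2P e) => ->; rewrite /= ?mulr1 ?mulr0 ?eqxx ?(negbTE nt);
    by rewrite -tE.
- have ht : half_open t by move=> k; have := ot k; lra.
  have nt k : t k 0 == 0 = false by rewrite gt_eqF//; have := ot k; lra.
  have nt0 : t == 0 = false by apply/negP => /eqP t0; have := nt 0; rewrite t0 mxE eqxx.
  move=> /(tile_half_eq ht hz)[<- + _]; rewrite nt0 => /(_ isT) <-.
  by rewrite /cell_of nt0 !nt.
Qed.

Lemma cell_of_dim0 i z : z = 0 -> cell_dim (projT1 (cell_of i z)) = 0%N.
Proof. by move=> ->; rewrite /cell_of eqxx. Qed.

Lemma cell_of_dim1 i z k : z k 0 = 0 -> (cell_dim (projT1 (cell_of i z)) < 2)%N.
Proof.
rewrite /cell_of; case: eqP => // _; case: eqP => // z1; case: eqP => // z0.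
by case: (ord2P k) => ->.
Qed.

Lemma int_half_open (x y : R) : 0 <= x < 1 -> y \is a Num.int -> y - x \is a Num.int -> x = 0.
Proof.
move=> /andP[x0 x1] iy iyx; apply/eqP/negPn/negP => nx.
have ix : x \is a Num.int by rewrite -[x](subKr y) rpredB.
by have := norm_intr_ge1 ix nx; rewrite ger0_norm// leNgt x1.
Qed.

Lemma tiled_cells : is_cell_decomposition cell_map.
Proof.
split.
- move=> [[i|[i e]]|i] /=; apply: continuous_subspaceT => t.
  + by move=> W /nbhs_singleton HW; apply: (@filterE _ (nbhs t)) => x; exact: HW.
  + apply: (@continuous_comp _ _ _ (fun t : 'cV[R]_1 => t 0 0)
      (fun s : R => T i (s *: delta_mx e 0))); first exact: coord_continuous.
    apply: (@continuous_comp _ _ _ (fun s : R => s *: delta_mx e 0) (T i)); last exact: tile_continuous.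
    exact: scalel_continuous.
  + exact: tile_continuous.
- move=> x; have [i [z [hz ->]]] := tile_surj x.
  exists (cell_of i z); split; first exact: cell_ofP.
  by move=> [c t] [ot e]; exact: cell_of_unique.
- move=> c t ct not_.
  have [i [z [hz xz]]] := tile_surj (cell_map t).
  exists (projT1 (cell_of i z)), (projT2 (cell_of i z)).
  have [oz mz] := cell_ofP i hz; split=> //; last by rewrite mz xz.
  (* A boundary point has an integral coordinate. Normal forms keep coordinates modulo 1, so this
     one becomes 0 and the point falls into a cell of smaller dimension. *)
  have int01 (x : R) : 0 <= x <= 1 -> ~ (0 < x < 1) -> x \is a Num.int.
    move=> hx nx; have [->|[->|?]] : x = 0 \/ x = 1 \/ 0 < x < 1 by lra.
    + exact: rpred0.
    + exact: rpred1.
    + by [].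
  case: c t ct not_ xz => [[j|[j e]]|j] /= t ct not_.
  + by case: not_ => -[].
  + have cw := delta_cube e (ct 0).
    move=> /(congr1 (@tiled_map R d h v)); rewrite tiled_map_cube// tiled_map_cube; last exact: half_open_cube.
    move=> /torus_piP[i0 i1]; rewrite cell_of_dim0//.
    have it : t 0 0 \is a Num.int.
      by apply: int01; [exact: ct|move=> ht; apply: not_ => k; rewrite ord1].
    have iw k : (t 0 0 *: (delta_mx e 0 : 'cV[R]_2)) k 0 \is a Num.int.
      by rewrite !mxE; case: (_ && _); rewrite ?mulr1 ?mulr0 ?rpred0.
    by apply: eq_vec; rewrite [RHS]mxE; [exact: int_half_open (iw 0) i0|exact: int_half_open (iw 1) i1].
  + move=> /(congr1 (@tiled_map R d h v)); rewrite tiled_map_cube// tiled_map_cube; last exact: half_open_cube.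
    move=> /torus_piP[i0 i1].
    have [k nk] : exists k, ~ (0 < t k 0 < 1) by apply/existsNP.
    have ik := int01 _ (ct k) nk.
    apply: (@cell_of_dim1 _ _ k); apply: int_half_open ik _; first exact: hz.
    by case: (ord2P k) => ->.
Qed.

Lemma tiled_has_genus g : (#|is_rep| + 2 * g = d + 2)%N -> has_genus R O g.
Proof.
move=> card_rep; exists cell, cell_dim, cell_map; split; first exact: tiled_cells.
rewrite !big_sumType /= !sumr_const card_sig card_prod !card_ord.
rewrite expr0 expr1 sqrrN expr1n mulNrn !natz.
set r := #|_|; have {}card_rep : (r + 2 * g = d + 2)%N by exact: card_rep.
by clearbody r; lia.
Qed.

End TiledOrigami.

(** * Closed geodesics *)

Section ClosedGeodesics.
Variables (R : realType) (d : nat) (h v : {perm 'I_d}).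
Hypotheses (d_gt0 : (0 < d)%N) (trans : transitive_pair h v).
Local Notation O := (tiled_origami R d_gt0 trans).
Local Notation T := (tile h v).
Local Notation flowO := (@flow R O).
Implicit Types (x y t : R) (i : 'I_d).

Lemma vec_line x y t (u1 u2 x' y' : R) : x' = x + t * u1 -> y' = y + t * u2 ->
  vec x y + t *: vec u1 u2 = vec x' y'.
Proof. by move=> -> ->; apply: eq_vec; rewrite !mxE. Qed.

Lemma vec_sub0 x y : vec x y - delta_mx 0 0 = vec (x - 1) y.
Proof. by apply: eq_vec; rewrite !mxE /= ?subr0. Qed.

Lemma vec_sub1 x y : vec x y - delta_mx 1 0 = vec x (y - 1).
Proof. by apply: eq_vec; rewrite !mxE /= ?subr0. Qed.

Lemma strip_dom0 x y : -1 < x < 2 -> 0 < y < 1 -> strip_dom 0 (vec x y).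
Proof. by move=> hx hy; split; [rewrite vecE|apply: forall_ord2 => // _; rewrite vecE]. Qed.

Lemma strip_dom1 x y : 0 < x < 1 -> -1 < y < 2 -> strip_dom 1 (vec x y).
Proof. by move=> hx hy; split; [rewrite vecE|apply: forall_ord2 => // _; rewrite vecE]. Qed.

(** The end point is a separate vector tied by equations, which reduces each use to linear
    arithmetic. Only [y] must be interior: the path may begin or end on a vertical edge. *)
Lemma flow_stay i t (u1 u2 x y x' y' : R) : 0 <= t ->
  x' = x + t * u1 -> y' = y + t * u2 -> 0 <= x <= 1 -> 0 <= x' <= 1 ->
  0 < y < 1 -> 0 < y' < 1 ->
  flowO (vec u1 u2) t (T i (vec x y)) (T i (vec x' y')).
Proof.
move=> t0 ex ey hx hx' hy hy'; have glue := @tile_glue0 R d h v.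
rewrite -!(@strip_mid R d h v 0 h glue) ?vecE// -(vec_line ex ey).
apply: (strip_flow d_gt0 trans glue) => //; rewrite ?(vec_line ex ey);
  by apply: strip_dom0 => //; lra.
Qed.

Lemma flow_right i t (u1 u2 x y x' y' : R) : 0 <= t ->
  x' + 1 = x + t * u1 -> y' = y + t * u2 -> 0 <= x <= 1 -> 0 <= x' < 1 ->
  0 < y < 1 -> 0 < y' < 1 ->
  flowO (vec u1 u2) t (T i (vec x y)) (T (h i) (vec x' y')).
Proof.
move=> t0 ex ey hx hx' hy hy'; have glue := @tile_glue0 R d h v.
have -> : T (h i) (vec x' y') = strip h v 0 h i (vec x y + t *: vec u1 u2).
  rewrite (vec_line ex ey) strip_ge1; last by rewrite vecE; lra.
  by rewrite vec_sub0 addrK.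
rewrite -(@strip_mid R d h v 0 h glue) ?vecE//.
apply: (strip_flow d_gt0 trans glue) => //; rewrite ?(vec_line ex ey);
  by apply: strip_dom0 => //; lra.
Qed.

Lemma flow_up i t (u1 u2 x y x' y' : R) : 0 <= t ->
  x' = x + t * u1 -> y' + 1 = y + t * u2 -> 0 < x < 1 -> 0 < x' < 1 ->
  0 <= y <= 1 -> 0 <= y' < 1 ->
  flowO (vec u1 u2) t (T i (vec x y)) (T (v i) (vec x' y')).
Proof.
move=> t0 ex ey hx hx' hy hy'; have glue := @tile_glue1 R d h v.
have -> : T (v i) (vec x' y') = strip h v 1 v i (vec x y + t *: vec u1 u2).
  rewrite (vec_line ex ey) strip_ge1; last by rewrite vecE; lra.
  by rewrite vec_sub1 addrK.
rewrite -(@strip_mid R d h v 1 v glue) ?vecE//.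
apply: (strip_flow d_gt0 trans glue) => //; rewrite ?(vec_line ex ey);
  by apply: strip_dom1 => //; lra.
Qed.

Lemma flow_eq u t t' (a b b' : O) : t = t' -> b = b' -> flowO u t a b -> flowO u t' a b'.
Proof. by move=> -> ->. Qed.

Lemma flow_rights n i (u1 u2 x y : R) : 0 < u1 -> 0 <= u2 -> 0 <= x < 1 ->
  0 < y -> y + n%:R * (u2 / u1) < 1 ->
  flowO (vec u1 u2) (n%:R / u1) (T i (vec x y))
    (T (iter n h i) (vec x (y + n%:R * (u2 / u1)))).
Proof.
move=> u1_gt0 u2_ge0 hx y0.
have q0 : 0 <= u2 / u1 by rewrite divr_ge0// ltW.
elim: n => [|n IHn] hn.
  apply: flow_eq (@flow_stay i 0 u1 u2 x y x y _ _ _ _ _ _ _); rewrite ?mul0r ?addr0//; lra.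
have nS : n.+1%:R * (u2 / u1) = n%:R * (u2 / u1) + u2 / u1 by rewrite -natr1 mulrDl mul1r.
have hn' : y + n%:R * (u2 / u1) < 1 by rewrite nS in hn; lra.
have n0 : 0 <= n%:R * (u2 / u1) by rewrite mulr_ge0.
rewrite nS in hn *; rewrite -natr1 mulrDl mul1r; apply: flow_trans (IHn hn') _.
- by rewrite divr_ge0// ltW.
- by rewrite invr_ge0 ltW.
apply: flow_right; rewrite ?invr_ge0 ?(ltW u1_gt0)//; try lra.
by rewrite mulVf// gt_eqF.
Qed.

Lemma flow_ups n i (u1 u2 x y : R) : 0 <= u1 -> 0 < u2 -> 0 <= y < 1 ->
  0 < x -> x + n%:R * (u1 / u2) < 1 ->
  flowO (vec u1 u2) (n%:R / u2) (T i (vec x y))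
    (T (iter n v i) (vec (x + n%:R * (u1 / u2)) y)).
Proof.
move=> u1_ge0 u2_gt0 hy x0.
have q0 : 0 <= u1 / u2 by rewrite divr_ge0// ltW.
elim: n => [|n IHn] hn.
  rewrite !mul0r !addr0 in hn *.
  (* The start may lie on a horizontal edge, so the constant path comes from the vertical strip and
     not from [flow_stay]. *)
  have glue := @tile_glue1 R d h v.
  have := @strip_flow R d h v d_gt0 trans 1 v glue i (vec x y) (vec u1 u2) 0 (lexx _).
  rewrite scale0r addr0 (strip_mid glue) ?vecE; last lra.
  by apply; apply: strip_dom1; lra.
have nS : n.+1%:R * (u1 / u2) = n%:R * (u1 / u2) + u1 / u2 by rewrite -natr1 mulrDl mul1r.
have hn' : x + n%:R * (u1 / u2) < 1 by rewrite nS in hn; lra.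
have n0 : 0 <= n%:R * (u1 / u2) by rewrite mulr_ge0.
rewrite nS in hn *; rewrite -natr1 mulrDl mul1r; apply: flow_trans (IHn hn') _.
- by rewrite divr_ge0// ltW.
- by rewrite invr_ge0 ltW.
apply: flow_up; rewrite ?invr_ge0 ?(ltW u2_gt0)//; try lra.
by rewrite mulVf// gt_eqF.
Qed.

(* From a point of a vertical edge the geodesic in direction [(1, b)] crosses [b]
   horizontal edges and then a vertical one: the sheet changes by [h v^b = h]. *)
Lemma no_closed_flow (b : nat) : (0 < b)%N -> (forall i, iter b v i = i) ->
  (forall i, h i != i) -> forall x : O, ~ flowO (vec 1 b%:R) 1 x x.
Proof.
move=> b_gt0 vb hfix x0 fx0; set B : R := b%:R.
have B0 : 0 < B by rewrite ltr0n.
have [j [z [hz xz]]] := tile_surj (x0 : tiled R h v).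
(* The horizontal speed is 1, so after this time the geodesic is on a vertical edge. *)
have s01 : 0 <= 1 - z 0 0 <= 1 by have := hz 0; lra.
have [x fx x_closed] := closed_flow_rotate s01 fx0.
have zx0 : torus_pi z = ori_map x0.
  by rewrite xz; exact/esym/tiled_map_cube/half_open_cube.
have [_ px pE] := flow_end (proj1 (andP s01)) fx zx0.
have [i [z' [hz' xz']]] := tile_surj (x : tiled R h v).
have pz' : torus_pi z' = torus_pi (z + (1 - z 0 0) *: vec 1 B).
  by rewrite -pE xz'; exact/esym/tiled_map_cube/half_open_cube.
have z'0 : z' 0 0 = 0.
  have /torus_piP[i0 _] := esym pz'; move: i0; rewrite !mxE /= mulr1 addrC subrK.
  by apply: int_half_open; [exact: hz'|exact: rpred1].
have [y [hy z'E]] : exists y, 0 < y < 1 /\ z' = vec 0 y.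
  exists (z' 1 0); split; last by apply: eq_vec; rewrite vecE.
  have hy := hz' 1; rewrite lt_neqAle eq_sym; case: eqP => [y0|_]; last lra.
  case: px; rewrite xz' /= [tiled_map _]tiled_map_cube; last exact: half_open_cube.
  by congr torus_pi; apply: eq_vec; rewrite mxE.
have {pz' z'0} xE : x = T i (vec 0 y) by rewrite xz' z'E.
(* [c] is below both [y] and [1 - y]. The vertical strip excludes the vertical edges, so the
   horizontal one first carries the geodesic off its edge for time [e], during which it rises by
   [c]; after [b] upward crossings it covers the last stretch of time [e] as well. *)
pose c := y * (1 - y); pose bt : R := B^-1; pose e := c * bt.
have [c0 [cy cy']] : 0 < c /\ c < y /\ c < 1 - y by rewrite /c; split; [|split]; nra.
have bt0 : 0 < bt by rewrite invr_gt0.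
have Bbt : B * bt = 1 by rewrite mulfV// gt_eqF.
have bt1 : bt <= 1 by rewrite invf_le1// /B ler1n.
have e0 : 0 < e by rewrite mulr_gt0.
have e2 : 2 * e < bt by rewrite /e; nra.
have eB : e * B = c by rewrite /e -mulrA [bt * B]mulrC Bbt mulr1.
have b1 : b.-1%:R = B - 1 :> R by rewrite /B -{2}(prednK b_gt0) -natr1 addrK.
have b1B : b.-1%:R * (1 / B) = 1 - bt by rewrite b1 div1r mulrBl mulfV ?gt_eqF// mul1r.
have f1 : flowO (vec 1 B) e x (T i (vec e (y + c))).
  by rewrite xE; apply: flow_stay; rewrite ?mulr1 ?eB ?add0r//; lra.
have f2 : flowO (vec 1 B) (b.-1%:R / B) (T i (vec e (y + c)))
    (T (iter b.-1 v i) (vec (e + (1 - bt)) (y + c))).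
  by rewrite -b1B; apply: flow_ups; rewrite ?b1B//; lra.
have f3 : flowO (vec 1 B) (bt - 2 * e) (T (iter b.-1 v i) (vec (e + (1 - bt)) (y + c)))
    (T i (vec (1 - e) (y - c))).
  rewrite -[in X in flowO _ _ _ X](vb i) -{2}(prednK b_gt0).
  by apply: flow_up; try lra; rewrite mulrBl [bt * B]mulrC Bbt -mulrA eB; lra.
have f4 : flowO (vec 1 B) e (T i (vec (1 - e) (y - c))) (T (h i) (vec 0 y)).
  by apply: flow_right; rewrite ?eB; lra.
have t2 : 0 <= b.-1%:R / B by rewrite divr_ge0// ltW.
have f12 := flow_trans (ltW e0) t2 f1 f2.
have f123 := flow_trans (_ : 0 <= e + b.-1%:R / B) (_ : 0 <= bt - 2 * e) f12 f3.
have f1234 : flowO (vec 1 B) 1 x (T (h i) (vec 0 y)).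
  apply: flow_eq (flow_trans _ (ltW e0) (f123 _ _) f4) => //; try lra.
have := flow_unique (@tiled_chart_at R d h v d_gt0 trans) ler01 x_closed f1234.
have hv : half_open (vec 0 y) by apply: forall_ord2; rewrite vecE; lra.
rewrite xE => /(tile_half_eq hv hv)[_ + _].
have -> : vec 0 y != 0 by apply/eqP => /matrixP /(_ 1 0); rewrite !mxE /=; lra.
by move=> /(_ isT) hi; have := hfix i; rewrite -hi eqxx.
Qed.

(* The geodesic starts next to the lower left corner of the square [i] and crosses
   the edges in the order spelled by the word [h (v h^a)^b]. *)
Lemma closed_flow (a b : nat) (i : 'I_d) : (0 < a)%N -> (0 < b)%N ->
  h (iter b (fun j => v (iter a h j)) i) = i ->
  exists x : O, flowO (vec (1 + a%:R * b%:R) b%:R) 1 x x.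
Proof.
move=> a_gt0 b_gt0 hi; set A : R := a%:R; set B : R := b%:R.
pose g j := v (iter a h j).
have A1 : 1 <= A by rewrite ler1n.
have B1 : 1 <= B by rewrite ler1n.
pose D := 1 + A * B; have DB : B + 1 <= D by rewrite /D; nra.
have D0 : 0 < D by lra.
have B0 : 0 < B by lra.
have AE : A = (D - 1) / B by rewrite /D addrAC subrr add0r mulfK// gt_eqF.
have nzB : B != 0 by rewrite gt_eqF. have nzD : D != 0 by rewrite gt_eqF.
pose q := D^-1; have q0 : 0 < q by rewrite invr_gt0.
have qE : D * q = 1 by rewrite mulfV.
pose r := B^-1; have r0 : 0 < r by rewrite invr_gt0.
have rE : B * r = 1 by rewrite mulfV.
have qr : q < r by rewrite ltf_pV2 ?posrE//; lra.
have q1 : 2 * q <= 1 by rewrite -qE ler_pM2r//; lra.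
(* Crossing [a] vertical edges raises the geodesic by [1 - q], so from a height [et < q] no
   horizontal edge is met meanwhile. The horizontal crossing that follows restores the height and
   shifts the abscissa by [r] in all, so that [b] passages shift it by 1. *)
pose dl := q / 4; pose et := q / 2; rewrite -/D.
have ABD : A * (B / D) = 1 - q by rewrite AE /q; field; rewrite nzB nzD.
have rights j x : 0 <= x < 1 -> flowO (vec D B) (A / D) (T j (vec x et))
    (T (iter a h j) (vec x (et + (1 - q)))).
  by move=> hx; rewrite -ABD; apply: flow_rights; rewrite ?ABD; rewrite /et; lra.
have AD0 : 0 <= A / D by rewrite divr_ge0//; lra.
have loop n : (n < b)%N -> flowO (vec D B) (n%:R * r) (T i (vec dl et))
    (T (iter n g i) (vec (dl + n%:R * r) et)).
  elim: n => [|n IHn] nb.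
    by rewrite mul0r addr0; apply: flow_stay; rewrite /dl /et ?mul0r ?addr0//; lra.
  have nr : n.+1%:R * r <= 1 - r.
    have : n.+2%:R * r <= B * r by rewrite ler_pM2r// /B ler_nat.
    by rewrite -natr1 mulrDl mul1r rE; lra.
  have nr0 : 0 <= n%:R * r by rewrite mulr_ge0// ltW.
  have nS : n.+1%:R * r = n%:R * r + r by rewrite -natr1 mulrDl mul1r.
  have rt := rights (iter n g i) (dl + n%:R * r) (_ : _).
  have up : flowO (vec D B) (r * q) (T (iter a h (iter n g i)) (vec (dl + n%:R * r) (et + (1 - q))))
      (T (iter n.+1 g i) (vec (dl + n.+1%:R * r) et)).
    apply: flow_up; rewrite ?nS /dl /et; try lra.
    + by rewrite mulr_ge0// ltW.
    + by rewrite -mulrA [q * D]mulrC qE mulr1 addrA.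
    + by rewrite mulrAC [r * B]mulrC rE mul1r; lra.
  have tE : n.+1%:R * r = n%:R * r + (A / D + r * q).
    by rewrite nS AE /r /q; field; rewrite nzB nzD.
  rewrite tE; apply: flow_trans (IHn (ltnW nb)) _ => //.
    by rewrite addr_ge0// mulr_ge0// ltW.
  by rewrite -tE; apply: flow_trans up => //; [rewrite mulr_ge0// ltW|apply: rt; rewrite /dl; lra].
pose bq := B * q; have bq0 : 0 < bq by rewrite mulr_gt0.
have bq1 : bq < 1 by rewrite -qE /bq ltr_pM2r//; lra.
have b1 : b.-1%:R = B - 1 :> R by rewrite /B -{2}(prednK b_gt0) -natr1 addrK.
have b1r : b.-1%:R * r = 1 - r by rewrite b1 mulrBl rE mul1r.
have r1 : r <= 1 by rewrite /r invf_le1.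
have lp := loop b.-1 (_ : _); rewrite b1r in lp.
have rt := rights (iter b.-1 g i) (dl + (1 - r)) (_ : _).
(* The last passage is cut at abscissa [1 - dl], between its horizontal edge and the final vertical
   one. The height there is still positive because [dl] is [q / 4] and [bq < 1]. *)
have up : flowO (vec D B) ((r - 2 * dl) * q)
    (T (iter a h (iter b.-1 g i)) (vec (dl + (1 - r)) (et + (1 - q))))
    (T (iter b g i) (vec (1 - dl) (et - 2 * dl * bq))).
  rewrite -[in X in flowO _ _ _ X](prednK b_gt0).
  have dlbq : 2 * dl * bq < et by rewrite /et /dl; nra.
  have dlbq0 : 0 < 2 * dl * bq by rewrite /dl; nra.
  apply: flow_up; try (rewrite /dl /et in dlbq dlbq0 *; lra).
  + by rewrite mulr_ge0//; [rewrite /dl; lra|exact: ltW].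
  + by rewrite -mulrA [q * D]mulrC qE mulr1; lra.
  + have -> : (r - 2 * dl) * q * B = B * r * q - 2 * dl * bq by rewrite /bq; ring.
    by rewrite rE mul1r /et; lra.
have last_ : flowO (vec D B) (2 * dl * q) (T (iter b g i) (vec (1 - dl) (et - 2 * dl * bq)))
    (T i (vec dl et)).
  rewrite -{2}hi; have dlbq : 2 * dl * bq < et by rewrite /et /dl; nra.
  have dlbq0 : 0 < 2 * dl * bq by rewrite /dl; nra.
  apply: flow_right; try (rewrite /dl /et in dlbq dlbq0 *; lra).
  + by rewrite !mulr_ge0// ?ltW// /dl; lra.
  + have -> : 2 * dl * q * D = 2 * dl * (D * q) by ring.
    by rewrite qE; lra.
  + by rewrite /bq; ring.
have tE : 1 = 1 - r + (A / D + ((r - 2 * dl) * q + 2 * dl * q)).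
  by rewrite AE /r /dl /q; field; rewrite nzB nzD.
have dl0 : 0 < dl by rewrite /dl; lra.
have dlr : 2 * dl < r by rewrite /dl; lra.
have t3 : 0 <= (r - 2 * dl) * q by rewrite mulr_ge0// ?ltW//; lra.
have t4 : 0 <= 2 * dl * q by rewrite !mulr_ge0// ltW.
exists (T i (vec dl et)); rewrite [X in flowO _ X]tE.
have b1_lt : (b.-1 < b)%N by rewrite ltn_predL.
have x_lt : 0 <= dl + (1 - r) < 1 by lra.
have r1' : 0 <= 1 - r by lra.
have tail := flow_trans AD0 (addr_ge0 t3 t4) (rt x_lt) (flow_trans t3 t4 up last_).
exact: flow_trans r1' (addr_ge0 AD0 (addr_ge0 t3 t4)) (lp b1_lt) tail.
Qed.

End ClosedGeodesics.

(** * A family of one-cylinder surfaces *)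

Section Noncongruence.
Variables (R : realType) (d : nat) (h v : {perm 'I_d}).
Hypotheses (d_gt0 : (0 < d)%N) (trans : transitive_pair h v).
Local Notation O := (tiled_origami R d_gt0 trans).

(* The commutator of [[1, a], [0, 1]] and [[1, 0], [b, 1]]. *)
Definition twist_mx (a b : int) : 'M[int]_2 :=
  \matrix_(i, j) if i == 0 then (if j == 0 then 1 + a * b + a ^+ 2 * b ^+ 2 else - (a ^+ 2 * b))
                 else (if j == 0 then a * b ^+ 2 else 1 - a * b).

Lemma det_mx2 (K : comNzRingType) (B : 'M[K]_2) :
  \det B = B 0 0 * B 1 1 - B 0 1 * B 1 0.
Proof.
rewrite (expand_det_row _ 0) big_ord_recl big_ord1 /cofactor !det_mx11 !mxE.
rewrite /= /bump /= expr0 expr1 mul1r mulN1r mulrN.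
congr (_ * B _ _ - B _ _ * B _ _); exact: val_inj.
Qed.

Lemma det_twist_mx a b : \det (twist_mx a b) = 1.
Proof. by rewrite det_mx2 !mxE /=; ring. Qed.

Lemma twist_mx_principal (n : nat) (a b : int) : (n%:Z %| a * b)%Z ->
  principal_congruence n (twist_mx a b).
Proof.
move=> nab; split; first exact: det_twist_mx.
move=> i j; apply/eqP; rewrite eqz_mod_dvd.
suff [k ->] : exists k, twist_mx a b i j - 1%:M i j = k * (a * b) by rewrite dvdz_mull.
by case: (ord2P i) => ->; case: (ord2P j) => ->; rewrite !mxE /=;
  [exists (1 + a * b)|exists (- a)|exists b|exists (-1)]; ring.
Qed.

(** The inverse of the lower elementary matrix sends (1, b) to (1, 0), which the upper one fixes;
    the lower one restores (1, b), and the upper one moves it to (1 + ab, b). *)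
Lemma twist_mx_vec (a b : nat) :
  intmx R (twist_mx a b) *m vec 1 b%:R = vec (1 + a%:R * b%:R) b%:R.
Proof.
by apply: eq_vec; rewrite mulmx2E !mxE /= ?vecE !(rmorphD, rmorphB, rmorphN, rmorphM, rmorphXn, rmorph1) /=
  -!pmulrn; ring.
Qed.

Lemma not_principal_congruence_sub (a b n : nat) (i : 'I_d) :
  (0 < a)%N -> (0 < b)%N -> (n %| a * b)%N ->
  (forall j, iter b v j = j) -> (forall j, h j != j) ->
  h (iter b (fun j => v (iter a h j)) i) = i ->
  ~ (@intmx R @` principal_congruence n `<=` veech_group O).
Proof.
move=> a0 b0 nab vb hfix hi sub.
have [_ [f af]] : veech_group O (intmx R (twist_mx a b)).
  by apply: sub; exists (twist_mx a b) => //; apply: twist_mx_principal.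
have [x xw] := closed_flow R d_gt0 trans a0 b0 hi.
have [g ag _] := affine_inv af.
have uA : intmx R (twist_mx a b) \in unitmx by have [] := af.
have := flow_affine (@tiled_chart_at R d h v d_gt0 trans) ler01 ag xw.
by rewrite -twist_mx_vec mulKmx//; exact: no_closed_flow.
Qed.

End Noncongruence.

(** * The permutations, their vertices and the exponents *)

Section Family.
Variable m : nat.
Hypothesis m_gt0 : (0 < m)%N.
Local Notation d := (3 * m).+1.

(* With [h] the cycle [(0 1 ... 3m)] and [v = (0 1)(2 3)...(2m-2 2m-1)], the
   commutator of [h] and [v] has [m] fixed points and one cycle of length [2m + 1],
   so that the surface has [m + 1] vertices and genus [m + 1]. *)
Definition cycle_perm : {perm 'I_d} := perm (@ordS_inj d).

Definition swap_nat (i : nat) : nat :=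
  if (i < m.*2)%N then if odd i then i.-1 else i.+1 else i.

Lemma swap_nat_even l : (l < m)%N -> swap_nat l.*2 = l.*2.+1.
Proof. by move=> lm; rewrite /swap_nat ltn_double lm odd_double. Qed.

Lemma swap_nat_odd l : (l < m)%N -> swap_nat l.*2.+1 = l.*2.
Proof. by move=> lm; rewrite /swap_nat ltn_Sdouble lm /= odd_double. Qed.

Lemma swap_nat_high i : (m.*2 <= i)%N -> swap_nat i = i.
Proof. by rewrite /swap_nat ltnNge => ->. Qed.

Lemma swap_nat_lt i : (i < d)%N -> (swap_nat i < d)%N.
Proof. by rewrite /swap_nat; case: (ltnP i m.*2) => // im id; case: ifP => _; lia. Qed.

Definition swap_ord (i : 'I_d) : 'I_d := Ordinal (swap_nat_lt (ltn_ord i)).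

Lemma swap_natK : involutive swap_nat.
Proof.
move=> i; rewrite /swap_nat; case: (ltnP i m.*2) => [im|im]; last by rewrite ltnNge im.
case oi: (odd i).
  have -> : (i.-1 < m.*2)%N by lia.
  have -> : odd i.-1 = false by lia.
  by lia.
have -> : (i.+1 < m.*2)%N by lia.
by rewrite /= oi.
Qed.

Lemma swap_ord_inj : injective swap_ord.
Proof. by move=> i j /(congr1 val)/= /(congr1 swap_nat); rewrite !swap_natK => /val_inj. Qed.

Definition swap_perm : {perm 'I_d} := perm swap_ord_inj.
Local Notation h := cycle_perm.
Local Notation v := swap_perm.

Lemma cycle_permE (i : 'I_d) : h i = (i.+1 %% d)%N :> nat.
Proof. by rewrite permE. Qed.

Lemma cycle_perm_lt (i : 'I_d) : (i.+1 < d)%N -> h i = i.+1 :> nat.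
Proof. by move=> id; rewrite cycle_permE modn_small. Qed.

Lemma cycle_perm_last (i : 'I_d) : i = (3 * m)%N :> nat -> h i = 0%N :> nat.
Proof. by move=> id; rewrite cycle_permE id modnn. Qed.

Lemma swap_permE (i : 'I_d) : v i = swap_nat i :> nat.
Proof. by rewrite permE. Qed.

Lemma swap_permK i : v (v i) = i.
Proof. by apply: val_inj; rewrite /= !swap_permE swap_natK. Qed.

Lemma iter_cycle_perm n (i : 'I_d) : iter n h i = ((i + n) %% d)%N :> nat.
Proof.
elim: n => [|n IHn]; first by rewrite addn0 modn_small.
by rewrite iterS cycle_permE IHn -addn1 modnDml addn1 addnS.
Qed.

Lemma family_transitive : transitive_pair h v.
Proof.
move=> P Ph _ i j Pi; have Piter n : P (iter n h i).
  by elim: n => // n; rewrite iterS => /Ph.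
suff -> : j = iter (j + d - i)%N h i by [].
apply: val_inj; rewrite /= iter_cycle_perm subnKC; last by have := ltn_ord i; lia.
by rewrite modnDr modn_small.
Qed.

Lemma cycle_perm_neq i : h i != i.
Proof.
apply/eqP => /(congr1 val)/=; rewrite cycle_permE => e.
have [lt|ge] := ltnP i.+1 d; first by rewrite modn_small// in e; lia.
have iE : i.+1 = d by have := ltn_ord i; lia.
by rewrite iE modnn in e; lia.
Qed.

Lemma iter_swap_perm b i : ~~ odd b -> iter b v i = i.
Proof.
move=> ob; rewrite -[b]odd_double_half (negbTE ob) add0n.
by elim: b./2 => // n IHn; rewrite doubleS !iterS IHn swap_permK.
Qed.

Local Notation u := (fun j => v (h j)).
Local Notation r := (m.*2.+1).
Definition base_square : 'I_d := inord m.*2.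

Lemma base_squareE : base_square = m.*2 :> nat.
Proof. by rewrite inordK//; lia. Qed.

(** The cycle of 2m under [v h] is 2m, 2m + 1, ..., 3m, 1, 3, ..., 2m - 1: first m + 1 squares, then
    the m odd ones below 2m. *)
Lemma iter_product_low j : (j <= m)%N -> iter j u base_square = (m.*2 + j)%N :> nat.
Proof.
elim: j => [_|j IHj jm]; first by rewrite addn0 base_squareE.
have IH := IHj (ltnW jm).
rewrite iterS swap_permE cycle_perm_lt IH; last lia.
by rewrite swap_nat_high; lia.
Qed.

Lemma iter_product_high l : (l < m)%N -> iter (m.+1 + l)%N u base_square = l.*2.+1 :> nat.
Proof.
elim: l => [_|l IHl lm].
  rewrite addn0 iterS swap_permE cycle_perm_last ?iter_product_low//; last lia.
  exact: (@swap_nat_even 0).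
have IH := IHl (ltnW lm).
rewrite addnS iterS swap_permE cycle_perm_lt IH; last lia.
by rewrite -doubleS swap_nat_even.
Qed.

Lemma iter_product_period : iter r u base_square = base_square.
Proof.
apply: val_inj.
have IH : iter (m.+1 + m.-1)%N u base_square = m.-1.*2.+1 :> nat.
  by apply: iter_product_high; lia.
have -> : r = (m.+1 + m.-1).+1 by lia.
rewrite iterS /= swap_permE cycle_perm_lt IH; last lia.
by rewrite base_squareE swap_nat_high; lia.
Qed.

Lemma iter_product_dvd n : (r %| n)%N -> iter n u base_square = base_square.
Proof.
move=> /dvdnP[k ->]; elim: k => // k IHk.
by rewrite [(k.+1 * r)%N]mulSn iterD IHk iter_product_period.
Qed.

Lemma family_closed_word a b : (a = 1 %[mod d])%N -> (r %| b.+1)%N ->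
  h (iter b (fun j => v (iter a h j)) base_square) = base_square.
Proof.
move=> a1 rb; have ha j : iter a h j = h j.
  apply: val_inj; rewrite /= iter_cycle_perm cycle_permE.
  by rewrite -modnDmr a1 modnDmr addn1.
have -> : iter b (fun j => v (iter a h j)) base_square = iter b u base_square.
  by apply: eq_iter => j; rewrite ha.
have := iter_product_dvd rb; rewrite iterS => /(congr1 v); rewrite swap_permK => ->.
by apply: val_inj; rewrite /= swap_permE base_squareE swap_nat_high.
Qed.

Lemma vertex_rep_step (i j k : 'I_d) : h (v k) = i -> v (h k) = j ->
  vertex_rep h v i = vertex_rep h v j.
Proof. by move=> <- <-; exact: vertex_rep_comm. Qed.

(** The commutator relation at the square 2l identifies 2l + 2 with 2l. At 2l + 1 it identifies 2l +
    1 with 2l + 3, and at 3m it joins 0 to 1, so all squares up to 2m share their lower left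
    vertex. *)
Lemma vertex_rep_even l : (l <= m)%N ->
  vertex_rep h v (inord l.*2) = vertex_rep h v (inord 0).
Proof.
elim: l => // l IHl lm; rewrite -(IHl (ltnW lm)).
have k0 : (inord l.*2 : 'I_d) = l.*2 :> nat by rewrite inordK//; lia.
apply: (@vertex_rep_step _ _ (inord l.*2)); apply: val_inj; rewrite /=.
  by rewrite cycle_perm_lt swap_permE k0 swap_nat_even ?inordK//; lia.
rewrite swap_permE cycle_perm_lt k0; last lia.
by rewrite swap_nat_odd.
Qed.

Lemma vertex_rep_odd l : (l < m)%N ->
  vertex_rep h v (inord l.*2.+1) = vertex_rep h v (inord 0).
Proof.
elim: l => [_|l IHl lm].
  apply: esym; apply: (@vertex_rep_step _ _ (inord (3 * m)%N)); apply: val_inj; rewrite /=.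
    have k0 : v (inord (3 * m)%N) = (3 * m)%N :> nat.
      by rewrite swap_permE inordK// swap_nat_high//; lia.
    by rewrite cycle_perm_last// inordK.
  rewrite swap_permE cycle_perm_last ?inordK//; last lia.
  exact: (@swap_nat_even 0).
rewrite -(IHl (ltnW lm)).
have k0 : (inord l.*2.+1 : 'I_d) = l.*2.+1 :> nat by rewrite inordK//; lia.
apply: esym; apply: (@vertex_rep_step _ _ (inord l.*2.+1)); apply: val_inj; rewrite /=.
  by rewrite cycle_perm_lt swap_permE k0 swap_nat_odd//; lia.
rewrite swap_permE cycle_perm_lt k0; last lia.
by rewrite -doubleS swap_nat_even ?inordK//; lia.
Qed.

Lemma vertex_rep_low (i : 'I_d) : (i <= m.*2)%N ->
  vertex_rep h v i = vertex_rep h v (inord 0).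
Proof.
move=> im; have -> : i = inord i by rewrite inord_val.
have := odd_double_half i; case: (odd i) => /= iE.
  by rewrite -iE add1n vertex_rep_odd//; lia.
by rewrite -iE add0n vertex_rep_even//; lia.
Qed.

(** Here [v] fixes both [i - 1] and [i], so four quarter turns close up: the cone angle is that of
    the plane. Any return to corner number 0 takes a multiple of four steps. *)
Lemma vertex_connect_high (i j : 'I_d) : (m.*2 < i)%N ->
  fconnect (next_corner h v) (i, ord0) (j, ord0) -> j = i.
Proof.
move=> im; pose k : 'I_d := inord i.-1.
have kE : k = i.-1 :> nat by rewrite inordK//; have := ltn_ord i; lia.
have hk : h k = i by apply: val_inj; rewrite /= cycle_perm_lt kE; have := ltn_ord i; lia.
have vk : v k = k.
  by apply: val_inj; rewrite /= swap_permE kE swap_nat_high//; lia.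
have vi : v i = i.
  by apply: val_inj; rewrite /= swap_permE swap_nat_high//; lia.
have fix4 : iter 4 (next_corner h v) (i, ord0) = (i, ord0).
  rewrite ord0_inord -[iter _ _ _]/(next_corner _ _ (next_corner _ _ (next_corner _ _ (next_corner _ _ _)))).
  by rewrite !next_cornerE -{1}hk permK -{1}vk permK hk vi.
move=> /iter_findex; set n := findex _ _ _ => e.
have := iter_next_corner2 h v n (i, ord0); rewrite e /= add0n => n4.
move: e; rewrite (divn_eq n 4) -n4 addn0; elim: (n %/ 4)%N => [[->//]|q IHq].
by rewrite (_ : (q.+1 * 4)%N = (q * 4 + 4)%N) ?iterD ?fix4//; lia.
Qed.

Lemma vertex_rep_high (i : 'I_d) : (m.*2 < i)%N -> vertex_rep h v i = i.
Proof. by move=> /vertex_connect_high; apply; exact: vertex_rep_connect. Qed.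

Lemma card_vertices : #|[pred i : 'I_d | vertex_rep h v i == i]| = m.+1.
Proof.
set rho := vertex_rep h v (inord 0).
have rho_low : (rho <= m.*2)%N.
  rewrite leqNgt; apply/negP => lt.
  have : inord 0 = rho.
    apply: (vertex_connect_high lt); rewrite vertex_connect_sym.
    exact: vertex_rep_connect.
  by move=> /(congr1 val) /=; rewrite inordK// => e; move: lt; rewrite -e.
(* Among the squares up to 2m only [rho] represents itself; every higher square does. *)
have -> : #|[pred i : 'I_d | vertex_rep h v i == i]| =
    #|[predU1 rho & [pred i : 'I_d | (m.*2 < i)%N]]|.
  apply: eq_card => i; rewrite !inE; have [im|im] := leqP i m.*2.
    by rewrite vertex_rep_low// orbF eq_sym.
  by rewrite vertex_rep_high// eqxx orbT.
rewrite cardU1 inE -leqNgt rho_low add1n; congr _.+1.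
rewrite -sum1_card -(big_mkord (fun i => m.*2 < i)%N (fun=> 1%N)).
rewrite (big_cat_nat (n := r)) //=; last lia.
rewrite big_nat_cond big_pred0 ?add0n; last by move=> i; apply/negP; lia.
rewrite big_nat_cond (eq_bigl (fun i => (r <= i < d)%N && true)); last by move=> i; lia.
by rewrite -big_nat_cond sum_nat_const_nat; lia.
Qed.

(** The factor [n2] of [n] made of the primes of 2m + 1 is coprime to d and goes into [a]; the rest
    [n1] is coprime to 2m + 1 and goes into [b], together with the factor 2. *)
Lemma exponents_exist n : (0 < n)%N -> exists a b,
  [/\ (0 < a)%N /\ (0 < b)%N, ~~ odd b, (a = 1 %[mod d])%N, (r %| b.+1)%N & (n %| a * b)%N].
Proof.
move=> n_gt0; pose n2 := (n`_\pi(r))%N; pose n1 := (n`_(\pi(r)^'))%N.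
have nE : n = (n2 * n1)%N by rewrite partnC.
have cdr : coprime r d.
  (* 3 (2m + 1) - 2 (3m + 1) = 1. *)
  by apply/coprimeP => //; exists (3, 2)%N; rewrite /=; lia.
have cdn2 : coprime d n2.
  by rewrite coprime_sym (@pnat_coprime \pi(r))// ?part_pnat// -coprime_pi'.
have crn1 : coprime r n1.
  by rewrite (@pnat_coprime \pi(r))// ?part_pnat// pnat_pi.
have c2n1r : coprime (2 * n1) r.
  by rewrite coprime_sym coprimeMr crn1 coprimen2 /= odd_double.
pose a := chinese d n2 1 0; pose b := chinese (2 * n1) r 0 m.*2.
have a_d : (a = 1 %[mod d])%N by exact: chinese_modl.
have a_n2 : (n2 %| a)%N by rewrite /dvdn (chinese_modr cdn2) mod0n.
have b_n1 : (2 * n1 %| b)%N by rewrite /dvdn (chinese_modl c2n1r) mod0n.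
have b_r : (b = m.*2 %[mod r])%N by exact: chinese_modr.
exists a, b; split.
- split; rewrite lt0n; apply/eqP => e0.
    by move: a_d; rewrite e0 mod0n modn_small// ltnS muln_gt0.
  have r_gt : (m.*2 < r)%N by [].
  by move/eqP: b_r; rewrite e0 mod0n modn_small// eq_sym double_eq0 eqn0Ngt m_gt0.
- by rewrite -dvdn2 (dvdn_trans _ b_n1)// dvdn_mulr.
- exact: a_d.
- by rewrite /dvdn -addn1 -modnDml b_r modnDml addn1 modnn.
- by rewrite nE dvdn_mul// (dvdn_trans _ b_n1)// dvdn_mull.
Qed.

End Family.

(** Places the origami curve in the moduli space of the right genus: each of its points is a Riemann
    surface homeomorphic to the origami. *)
Lemma has_genus_homeomorphism (R : realType) (X Y : topologicalType) (f : X -> Y) g :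
  homeomorphism_between [set: X] [set: Y] f -> has_genus R X g -> has_genus R Y g.
Proof.
move=> [f' [[_ _ f'f ff'] [cf _]]] [I [dim [Phi [[cPhi uniq bd] chi]]]].
have cf' : continuous f by move=> x; apply: (within_open_continuous openT cf).
exists I, dim, (fun i t => f (Phi i t)); split=> //; split.
- move=> i; apply/subspace_continuousP => t ct.
  move/subspace_continuousP : (cPhi i) => /(_ t ct) cP.
  exact: (cvg_comp (Phi i) f cP (cf' _)).
- move=> y; have [c [[oc e] un]] := uniq (f' y).
  exists c; split; first by split=> //; rewrite e ff'.
  move=> c' [oc' e']; apply: un; split=> //.
  by rewrite -e' f'f.
- move=> i t ct nt; have [j [s [ji os e]]] := bd i t ct nt.
  by exists j, s; rewrite e.
Qed.

Theorem theorem1 (R : realType) (g : nat) (hg : (2 <= g)%N) :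
  exists O : origami R,
    [/\ has_genus R O g,
        (forall c, origami_curve O c -> moduli_space g c)
      & non_congruence_group (veech_group O)].
Proof.
have m_gt0 : (0 < g.-1)%N by lia.
pose O := tiled_origami R (ltn0Sn (3 * g.-1)) (@family_transitive _ m_gt0).
have genusO : has_genus R O g.
  by apply: tiled_has_genus; rewrite card_vertices//; lia.
exists O; split=> //.
- move=> c [A [Y [_ [f hf _] ->]]]; exists Y => //.
  exact: has_genus_homeomorphism hf genusO.
- split; first exact: tiled_veech_subgroup.
  move=> [_ [n n_gt0]].
  have [a [b [[a0 b0] ob ad rb nab]]] := exponents_exist m_gt0 n_gt0.
  apply: (@not_principal_congruence_sub R _ _ _ _ (@family_transitive _ m_gt0)
    a b n (base_square g.-1)) => //.
  + by move=> j; exact: iter_swap_perm.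
  + by move=> j; exact: cycle_perm_neq.
  + exact: (family_closed_word m_gt0 ad rb).
Qed.
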